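(* Let $k\ge1$. The matrix $\mathsf P_k^{\mathrm{mid}}$ satisfies, for $i,j\in[\![1,k']\!]$, $$\mathsf P^{\mathrm{mid}}_{k;i,j}=\begin{cases}\mathrm{IKM}_k(i,2j-1)&\text{if }4\nmid k,\\ \mathrm{IKM}_k(i+1,2j-1)-\gamma_{k,j}\,\mathrm{IKM}_k(i+1,k')&\text{if }4\mid k\text{ and }i<k/4,\\ \mathrm{IKM}_k(i,2j-1)-\gamma_{k,j}\,\mathrm{IKM}_k(i,k')&\text{if }4\mid k\text{ and }i>k/4.\end{cases}$$
   Context: $k\ge1$, $k'=\lfloor(k-1)/2\rfloor$, $[\![1,k']\!]=\{1,\dots,k'\}$ if $4\nmid k$ and $\{1,\dots,k'\}\setminus\{k/4\}$ if $4\mid k$. $I_0,K_0$ are the modified Bessel functions of order zero and $$\mathrm{IKM}_k(i,j)=(-1)^{k-i}2^{k-j}(\pi\mathrm i)^i\int_0^\infty I_0(t)^iK_0(t)^{k-i}t^j\,dt .$$ On $\mathbb G_m=\mathrm{Spec}\,\mathbb C[z,z^{-1}]$, $\mathrm{Kl}_2$ is the free $\mathbb C[z^{\pm1}]$-module with basis $v_0,v_1$ and connection $z\nabla_{\partial_z}v_0=v_1$, $z\nabla_{\partial_z}v_1=zv_0$. $\mathrm{Sym}^k\mathrm{Kl}_2$ is the $\mathfrak S_k$-invariant part of $\mathrm{Kl}_2^{\otimes k}$; monomials denote averages over $\mathfrak S_k$ of the corresponding tensors. With $t=2\sqrt z$ ($\mathrm{Re}\,t>0$ for $z\in\mathbb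 C\setminus\mathbb R_{\le0}$), $e_0=\frac t2I_0'(t)v_0-I_0(t)v_1$ and $e_1=\frac1{\pi\mathrm i}\bigl(-\frac t2K_0'(t)v_0+K_0(t)v_1\bigr)$ are (multivalued) flat sections; continuation once counterclockwise around $0$ fixes $e_0$ and sends $e_1$ to $e_1+e_0$. The pairing $\langle\cdot,\cdot\rangle_{\mathrm{top}}$ on $\mathrm{Sym}^k\mathrm{Kl}_2$ is determined by $\langle e_0^{k-a}e_1^a,e_0^{k-b}e_1^b\rangle_{\mathrm{top}}=(-1)^a\frac{a!b!}{k!}$ if $a+b=k$, $0$ otherwise (and $v_0=2K_0(t)e_0+2\pi\mathrm i\,I_0(t)e_1$). $\mathrm H^1_{\mathrm{dR}}(\mathbb G_m,\mathrm{Sym}^k\mathrm{Kl}_2)=\mathrm{coker}\,\nabla$; $\omega_i=[z^iv_0^k\,dz/z]$. If $4\mid k$, with $w=1/z=4/t^2$, write the asymptotic expansion at $t\to+\infty$ as $2^k(I_0(t)K_0(t))^{k/2}\sim w^{k/4}\sum_{j\ge0}\gamma_{k,k/4+j}w^j$ and set $\gamma_{k,i}=0$ for integers $i<k/4$; if $4\nmid k$ set $\gamma_{k,i}=0$. For $i\in[\![1,k']\!]$ put $\omega_i'=\omega_i-\gamma_{k,i}\omega_{k/4}$ (equal to $\omega_i$ if $4\nmid k$). $\mathrm H_1^{\mathrm{rd}}(\mathbb G_m,\mathrm{Sym}^k\mathrm{Kl}_2)$ is the homology of twisted chains $c\otimes e$, $c$ a chain in the real oriented blow-up of $\mathbb P^1$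 at $0,\infty$ (relative to the boundary), $e$ a flat section along $c$ of rapid decay near $c$ at the boundary. Let $c_0$ be the unit circle starting at $1$, counterclockwise, $c_0^a$ the same run $a$ times, $c_+=[1,+\infty]$ oriented towards $+\infty$, $C_n(a)=\frac{(-1)^{a-1}}{na}\binom na$, $\alpha_0=c_0\otimes e_0^k$ and, for $1\le i\le k'$, $$\alpha_i=-\tfrac{(-1)^{k-i}(k-i)!}{k-i+2}\alpha_0+c_+\otimes e_0^ie_1^{k-i}+\sum_{a=1}^{k-i+1}C_{k-i+1}(a)\,c_0^a\otimes e_0^{i-1}e_1^{k-i+1}.$$ If $4\nmid k$ put $\alpha_i'=\alpha_i$; if $4\mid k$ put, for $i\in[\![1,k']\!]$, $\alpha_i'=\alpha_{i+1}$ if $i<k/4$ and $\alpha'_i=\alpha_i$ if $i>k/4$. The period pairing is $\mathsf P_k^{\mathrm{rd,mod}}(c\otimes e,\omega)=\int_c\langle e,\omega\rangle_{\mathrm{top}}$, and $\mathsf P^{\mathrm{mid}}_{k;i,j}=\mathsf P_k^{\mathrm{rd,mod}}(\alpha_i',\omega_j')$ for $i,j\in[\![1,k']\!]$. *)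

(* Defs.v *)
From Stdlib Require Import Reals ZArith List Arith ClassicalEpsilon.
From Coquelicot Require Import Coquelicot.
Import ListNotations.
Open Scope R_scope.

Definition Csum {A : Type} (f : A -> C) (l : list A) : C :=
  fold_right (fun x acc => Cplus (f x) acc) (RtoC 0) l.

Definition indic (P : Prop) : C :=
  if excluded_middle_informative P then RtoC 1 else RtoC 0.

Definition Cpowz (z : C) (n : Z) : C :=
  match n with
  | Z0 => RtoC 1
  | Zpos p => Cpow z (Pos.to_nat p)
  | Zneg p => Cinv (Cpow z (Pos.to_nat p))
  end.

Definition Cexp (u : C) : C := Cmult (RtoC (exp (Re u))) (cos (Im u), sin (Im u)).

Definition piI : C := Cmult (RtoC PI) Ci.

Definition I0 (t : R) : R := PSeries (fun n => / (INR (fact n)) ^ 2) ((t / 2) ^ 2).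

(* The integral representation of K_0, for t > 0. *)
Definition K0 (t : R) : R :=
  RInt_gen (fun x => exp (- t * cosh x)) (at_point 0) (Rbar_locally p_infty).

(* Meant for i <= k, since k - i is truncated. *)
Definition IKM (k i j : nat) : C :=
  Cmult (Cmult (RtoC ((-1) ^ (k - i) * powerRZ 2 (Z.of_nat k - Z.of_nat j)))
               (Cpow piI i))
        (RtoC (RInt_gen (fun t => I0 t ^ i * K0 t ^ (k - i) * t ^ j)
                        (at_right 0) (Rbar_locally p_infty))).

(* [g i] is gamma_{k,i}: the coefficients of the expansion of
   2^k (I0 K0)^(k/2) in powers of w = 4/t^2 as t -> +oo. *)
Definition is_gamma (k : nat) (g : nat -> R) : Prop :=
  ((k mod 4)%nat <> 0%nat -> forall i, g i = 0) /\
  ((k mod 4)%nat = 0%nat ->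
     (forall i, (i < k / 4)%nat -> g i = 0) /\
     forall N : nat,
       is_lim (fun t =>
         (2 ^ k * (I0 t * K0 t) ^ (k / 2)
          - (4 / t ^ 2) ^ (k / 4)
            * sum_f_R0 (fun j => g (k / 4 + j)%nat * (4 / t ^ 2) ^ j) N)
         / (4 / t ^ 2) ^ (k / 4 + N)) p_infty 0).

Definition kprime (k : nat) : nat := ((k - 1) / 2)%nat.

Definition mid_index (k i : nat) : Prop :=
  (1 <= i <= kprime k)%nat /\ ((k mod 4)%nat = 0%nat -> i <> (k / 4)%nat).

(* A vector of a fibre of Kl_2 is its pair of coordinates in (v_0, v_1).
   A vector of a fibre of Sym^k Kl_2 is given by its coordinates x_0, ..., x_k
   in the basis v_0^{k-a} v_1^a; entries with index > k are irrelevant. *)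
Definition vec : Type := nat -> C.

Definition lin (e : C * C) : vec :=
  fun a => match a with 0%nat => fst e | 1%nat => snd e | _ => RtoC 0 end.

Definition vone : vec := fun a => match a with 0%nat => RtoC 1 | _ => RtoC 0 end.

Definition vmul (x y : vec) : vec :=
  fun a => Csum (fun b => Cmult (x b) (y (a - b)%nat)) (seq 0 (S a)).

Fixpoint vpow (x : vec) (n : nat) : vec :=
  match n with 0%nat => vone | S m => vmul x (vpow x m) end.

(* e^p f^q, the average over S_{p+q} of the tensors e^{(x)p} (x) f^{(x)q}: such
   averages multiply like polynomials in v_0, v_1, which gives its coordinates. *)
Definition mono (e : C * C) (p : nat) (f : C * C) (q : nat) : vec :=
  vmul (vpow (lin e) p) (vpow (lin f) q).

(* The linear part of z nabla_{d/dz} on Sym^k Kl_2 in the basis v_0^{k-a} v_1^a.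
   By the Leibniz rule the basis vector of index a is sent to
   (k-a) v_0^{k-a-1} v_1^{a+1} + a z v_0^{k-a+1} v_1^{a-1}. *)
Definition sym_conn (k : nat) (z : C) (x : vec) : vec :=
  fun a =>
    Cplus (match a with
           | 0%nat => RtoC 0
           | S b => Cmult (RtoC (INR (k - b))) (x b)
           end)
          (if (a <? k)%nat then Cmult (Cmult (RtoC (INR (S a))) z) (x (S a))
           else RtoC 0).

(* Multivalued sections of Kl_2 are functions of the logarithmic coordinate u,
   z = exp u, on the universal cover of G_m; one counterclockwise turn around 0
   is u |-> u + 2 pi i.  Since z d/dz = d/du, the section f_0 v_0 + f_1 v_1 is
   flat iff f_0' = - z f_1 and f_1' = - f_0. *)
Definition is_flat_Kl2 (E : C -> C * C) : Prop :=
  forall u : C,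
    is_derive (K := C_AbsRing) (V := C_NormedModule)
      (fun u => fst (E u)) u (Copp (Cmult (Cexp u) (snd (E u)))) /\
    is_derive (K := C_AbsRing) (V := C_NormedModule)
      (fun u => snd (E u)) u (Copp (fst (E u))).

(* e_0 and e_1 at a real point z > 0, as functions of t = 2 sqrt z. *)
Definition e0_real (t : R) : C * C := (RtoC (t / 2 * Derive I0 t), RtoC (- I0 t)).

Definition e1_real (t : R) : C * C :=
  (Cdiv (RtoC (- (t / 2 * Derive K0 t))) piI, Cdiv (RtoC (K0 t)) piI).

(* E is the multivalued flat section extending e, given on the positive axis
   u = ln z in R, by analytic continuation. *)
Definition is_continuation (e : R -> C * C) (E : C -> C * C) : Prop :=
  is_flat_Kl2 E /\ forall x : R, E (RtoC x) = e (2 * sqrt (exp x)).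

(* A bilinear form on the fibres of Sym^k Kl_2 is given by its Gram matrix
   G z a b in the basis v_0^{k-a} v_1^a. *)
Definition pairing (k : nat) (G : C -> nat -> nat -> C) (z : C) (x y : vec) : C :=
  Csum (fun a => Csum (fun b => Cmult (G z a b) (Cmult (x a) (y b)))
                      (seq 0 (S k)))
       (seq 0 (S k)).

Definition is_top_pairing (k : nat) (E0 E1 : C -> C * C)
    (G : C -> nat -> nat -> C) : Prop :=
  forall (u : C) (a b : nat), (a <= k)%nat -> (b <= k)%nat ->
    pairing k G (Cexp u) (mono (E0 u) (k - a) (E1 u) a)
                         (mono (E0 u) (k - b) (E1 u) b)
    = if (a + b =? k)%nat
      then RtoC ((-1) ^ a * (INR (fact a) * INR (fact b) / INR (fact k)))
      else RtoC 0.

(* A Laurent polynomial is a formal sum of terms c z^n, listed as (n, c). *)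
Definition laurent : Type := list (Z * C).

Definition lcoef (p : laurent) (n : Z) : C :=
  Csum (fun m => if Z.eq_dec (fst m) n then snd m else RtoC 0) p.

Definition leval (p : laurent) (z : C) : C :=
  Csum (fun m => Cmult (snd m) (Cpowz z (fst m))) p.

(* The element f of the free C[z,z^-1]-module Sym^k Kl_2 with coordinates
   f 0, ..., f k in the basis v_0^{k-a} v_1^a; also used for the 1-form f dz/z. *)
Definition sym_section : Type := nat -> laurent.

(* Coefficient of z^n v_0^{k-a} v_1^a in z nabla_{d/dz} f, so that
   nabla f = (z nabla_{d/dz} f) dz/z. *)
Definition nabla_coef (k : nat) (f : sym_section) (a : nat) (n : Z) : C :=
  Cplus (Cmult (RtoC (IZR n)) (lcoef (f a) n))
    (Cplus (match a with
            | 0%nat => RtoC 0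
            | S b => Cmult (RtoC (INR (k - b))) (lcoef (f b) n)
            end)
           (if (a <? k)%nat
            then Cmult (RtoC (INR (S a))) (lcoef (f (S a)) (n - 1))
            else RtoC 0)).

(* f dz/z and g dz/z have the same class in coker nabla. *)
Definition cohomologous (k : nat) (f g : sym_section) : Prop :=
  exists h : sym_section, forall (a : nat) (n : Z), (a <= k)%nat ->
    Cminus (lcoef (f a) n) (lcoef (g a) n) = nabla_coef k h a n.

(* Cohomology and homology classes are represented by the sets of their
   representatives. *)
Definition dR_class (k : nat) (f : sym_section) : sym_section -> Prop :=
  cohomologous k f.

Definition omega (i : nat) : sym_section :=
  fun a => match a with 0%nat => [(Z.of_nat i, RtoC 1)] | _ => [] end.

Definition omega' (k : nat) (g : nat -> R) (i : nat) : sym_section :=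
  if (k mod 4 =? 0)%nat then
    fun a => match a with
             | 0%nat => [(Z.of_nat i, RtoC 1); (Z.of_nat (k / 4), RtoC (- g i))]
             | _ => []
             end
  else omega i.

(* The real oriented blow-up of P^1 at 0 and oo is the annulus S^1 x [-1,1]: the
   point (zeta, x) with -1 < x < 1 is z = zeta (1+x)/(1-x), and the boundary
   circles over 0 and oo are x = -1 and x = 1.  The boundary-defining
   functions |z| at 0 and 1/|z| at oo are comparable with 1 - |x|. *)
Definition inner (x : R) : Prop := -1 < x < 1.

Definition pt (zeta : C) (x : R) : C := Cmult zeta (RtoC ((1 + x) / (1 - x))).

Definition CDerive (f : R -> C) (s : R) : C :=
  (Derive (fun r => Re (f r)) s, Derive (fun r => Im (f r)) s).

Definition C1 (f : R -> R) : Prop :=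
  forall s, ex_derive f s /\ continuous (Derive f) s.

Definition C1_2 (f : R -> R -> R) : Prop :=
  forall p q,
    ex_derive (fun r => f r q) p /\ ex_derive (fun r => f p r) q /\
    continuity_2d_pt (fun p q => Derive (fun r => f r q) p) p q /\
    continuity_2d_pt (fun p q => Derive (fun r => f p r) q) p q.

(* Singular simplices: a 1-simplex is the restriction to [0,1] of a C^1 map, a
   2-simplex the restriction to the triangle p, q >= 0, p + q <= 1 of a C^1 map. *)
Record simplex1 := Simplex1 { dir1 : R -> C; hgt1 : R -> R }.
Record simplex2 := Simplex2 { dir2 : R -> R -> C; hgt2 : R -> R -> R }.

Definition pt1 (c : simplex1) (s : R) : C := pt (dir1 c s) (hgt1 c s).
Definition pt2 (c : simplex2) (p q : R) : C := pt (dir2 c p q) (hgt2 c p q).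

(* c (x) e, with e the coordinates of a section of Sym^k Kl_2 along c; only its
   values over the interior of the annulus are meaningful. *)
Definition twisted1 : Type := (simplex1 * (R -> vec))%type.
Definition twisted2 : Type := (simplex2 * (R -> R -> vec))%type.
Definition chain1 : Type := list twisted1.
Definition chain2 : Type := list twisted2.

Definition in01 (s : R) : Prop := 0 <= s <= 1.
Definition in_triangle (w : R * R) : Prop :=
  0 <= fst w /\ 0 <= snd w /\ fst w + snd w <= 1.

Definition is_simplex1 (c : simplex1) : Prop :=
  C1 (fun s => Re (dir1 c s)) /\ C1 (fun s => Im (dir1 c s)) /\ C1 (hgt1 c) /\
  forall s, in01 s -> Cmod (dir1 c s) = 1 /\ -1 <= hgt1 c s <= 1.

Definition is_simplex2 (c : simplex2) : Prop :=
  C1_2 (fun p q => Re (dir2 c p q)) /\ C1_2 (fun p q => Im (dir2 c p q)) /\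
  C1_2 (hgt2 c) /\
  forall p q, in_triangle (p, q) ->
    Cmod (dir2 c p q) = 1 /\ -1 <= hgt2 c p q <= 1.

(* The section is flat for the pulled-back connection, continuous up to the
   boundary of the simplex, and of rapid decay where the simplex meets the
   boundary of the annulus. *)
Definition is_twisted1 (k : nat) (ce : twisted1) : Prop :=
  let (c, e) := ce in
  is_simplex1 c /\
  (forall (s : R) (a : nat), 0 < s < 1 -> inner (hgt1 c s) -> (a <= k)%nat ->
     is_derive (K := R_AbsRing) (V := C_R_NormedModule) (fun r => e r a) s
       (Copp (Cmult (Cdiv (CDerive (pt1 c) s) (pt1 c s))
                    (sym_conn k (pt1 c s) (e s) a)))) /\
  (forall (s : R) (a : nat), in01 s -> inner (hgt1 c s) -> (a <= k)%nat ->
     filterlim (fun r => e r a) (within in01 (locally s)) (locally (e s a))) /\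
  (forall N : nat, exists M : R, forall (s : R) (a : nat),
     in01 s -> inner (hgt1 c s) -> (a <= k)%nat ->
     Cmod (e s a) <= M * (1 - Rabs (hgt1 c s)) ^ N).

Definition is_twisted2 (k : nat) (ce : twisted2) : Prop :=
  let (c, e) := ce in
  is_simplex2 c /\
  (forall (p q : R) (a : nat),
     0 < p -> 0 < q -> p + q < 1 -> inner (hgt2 c p q) -> (a <= k)%nat ->
     is_derive (K := R_AbsRing) (V := C_R_NormedModule) (fun r => e r q a) p
       (Copp (Cmult (Cdiv (CDerive (fun r => pt2 c r q) p) (pt2 c p q))
                    (sym_conn k (pt2 c p q) (e p q) a))) /\
     is_derive (K := R_AbsRing) (V := C_R_NormedModule) (fun r => e p r a) q
       (Copp (Cmult (Cdiv (CDerive (fun r => pt2 c p r) q) (pt2 c p q))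
                    (sym_conn k (pt2 c p q) (e p q) a)))) /\
  (forall (p q : R) (a : nat),
     in_triangle (p, q) -> inner (hgt2 c p q) -> (a <= k)%nat ->
     filterlim (fun w : R * R => e (fst w) (snd w) a)
       (within in_triangle (locally (p, q))) (locally (e p q a))) /\
  (forall N : nat, exists M : R, forall (p q : R) (a : nat),
     in_triangle (p, q) -> inner (hgt2 c p q) -> (a <= k)%nat ->
     Cmod (e p q a) <= M * (1 - Rabs (hgt2 c p q)) ^ N).

(* The boundary of a 1-chain, relative to the boundary of the annulus: the
   fibre component at the point z of G_m, coordinate a. *)
Definition bd1 (c : chain1) (z : C) (a : nat) : C :=
  Csum (fun ce : twisted1 => let (s, e) := ce in
    Cminus
      (Cmult (indic (inner (hgt1 s 1) /\ pt1 s 1 = z)) (e 1 a))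
      (Cmult (indic (inner (hgt1 s 0) /\ pt1 s 0 = z)) (e 0 a))) c.

Definition is_rd_cycle (k : nat) (c : chain1) : Prop :=
  List.Forall (is_twisted1 k) c /\
  forall (z : C) (a : nat), (a <= k)%nat -> bd1 c z a = RtoC 0.

Definition face (c : simplex2) (e : R -> R -> vec) (f : R -> R * R) : twisted1 :=
  (Simplex1 (fun s => dir2 c (fst (f s)) (snd (f s)))
            (fun s => hgt2 c (fst (f s)) (snd (f s))),
   fun s => e (fst (f s)) (snd (f s))).

Definition scale_twisted (l : C) (ce : twisted1) : twisted1 :=
  (fst ce, fun s a => Cmult l (snd ce s a)).

Definition bd2 (D : chain2) : chain1 :=
  flat_map (fun ce : twisted2 => let (c, e) := ce in
    [ face c e (fun s => (1 - s, s));
      scale_twisted (RtoC (-1)) (face c e (fun s => (0, s)));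
      face c e (fun s => (s, 0)) ]) D.

Definition same_simplex1 (c d : simplex1) : Prop :=
  forall s, in01 s -> dir1 c s = dir1 d s /\ hgt1 c s = hgt1 d s.

(* Formal sums are compared simplex by simplex, adding up the sections carried
   by equal simplices. *)
Definition chain_coef (c : chain1) (t : simplex1) (s : R) (a : nat) : C :=
  Csum (fun ce : twisted1 =>
    Cmult (indic (same_simplex1 (fst ce) t)) (snd ce s a)) c.

(* c - d is the boundary of a rapid decay 2-chain, modulo chains in the boundary
   of the annulus. *)
Definition homologous (k : nat) (c d : chain1) : Prop :=
  exists D : chain2, List.Forall (is_twisted2 k) D /\
    forall (t : simplex1) (s : R) (a : nat),
      in01 s -> inner (hgt1 t s) -> (a <= k)%nat ->
      Cminus (chain_coef c t s a) (chain_coef d t s a) = chain_coef (bd2 D) t s a.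

Definition rd_class (k : nat) (c : chain1) : chain1 -> Prop :=
  fun d => is_rd_cycle k d /\ homologous k c d.

(* The sum over the simplices of c of the integrals of <e, f dz/z>_top, the
   integrand being extended by 0 (its limit) to the boundary of the annulus. *)
Definition period (k : nat) (G : C -> nat -> nat -> C)
    (c : chain1) (f : sym_section) : C :=
  Csum (fun ce : twisted1 => let (s, e) := ce in
    RInt (V := C_R_CompleteNormedModule) (fun r =>
      Cmult (indic (inner (hgt1 s r)))
        (Cmult (pairing k G (pt1 s r) (e r) (fun a => leval (f a) (pt1 s r)))
               (Cdiv (CDerive (pt1 s) r) (pt1 s r)))) 0 1) c.

(* P, on homology and cohomology classes, is computed by integration over any
   representatives. *)
Definition is_period_pairing (k : nat) (G : C -> nat -> nat -> C)
    (P : (chain1 -> Prop) -> (sym_section -> Prop) -> C) : Prop :=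
  forall (c : chain1) (f : sym_section),
    is_rd_cycle k c -> P (rd_class k c) (dR_class k f) = period k G c f.

(* The unit circle from 1, run a times counterclockwise. *)
Definition circle (a : nat) : simplex1 :=
  Simplex1 (fun s => (cos (2 * PI * INR a * s), sin (2 * PI * INR a * s)))
           (fun _ => 0).

Definition circle_log (a : nat) (s : R) : C := Cmult (RtoC (2 * INR a * s)) piI.

(* The half-line [1,+oo], as s |-> (1+s)/(1-s). *)
Definition ray : simplex1 := Simplex1 (fun _ => RtoC 1) (fun s => s).

Definition ray_log (s : R) : C := RtoC (ln ((1 + s) / (1 - s))).

Definition Cn (n a : nat) : R :=
  (-1) ^ (a - 1) / (INR n * INR a) * Binomial.C n a.

Definition alpha0 (E0 E1 : C -> C * C) (k : nat) : chain1 :=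
  [ (circle 1, fun s => mono (E0 (circle_log 1 s)) k (E1 (circle_log 1 s)) 0) ].

Definition alpha (E0 E1 : C -> C * C) (k i : nat) : chain1 :=
  map (scale_twisted
         (RtoC (- ((-1) ^ (k - i) * INR (fact (k - i)) / INR (k - i + 2)))))
      (alpha0 E0 E1 k)
  ++ [ (ray, fun s => mono (E0 (ray_log s)) i (E1 (ray_log s)) (k - i)) ]
  ++ map (fun a =>
       scale_twisted (RtoC (Cn (k - i + 1) a))
         (circle a, fun s => mono (E0 (circle_log a s)) (i - 1)
                                  (E1 (circle_log a s)) (k - i + 1)))
       (seq 1 (k - i + 1)).

Definition alpha' (E0 E1 : C -> C * C) (k i : nat) : chain1 :=
  if ((k mod 4 =? 0) && (i <? k / 4))%nat%bool
  then alpha E0 E1 k (i + 1) else alpha E0 E1 k i.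

Definition P_mid (E0 E1 : C -> C * C) (g : nat -> R)
    (P : (chain1 -> Prop) -> (sym_section -> Prop) -> C) (k i j : nat) : C :=
  P (rd_class k (alpha' E0 E1 k i)) (dR_class k (omega' k g j)).

(* Main.v *)
Require Import Defs.
From Stdlib Require Import Reals ZArith Arith Lia Lra List.
From Stdlib Require Import Classical ClassicalEpsilon FunctionalExtensionality.
From Coquelicot Require Import Coquelicot.
Import ListNotations.

(** The period of [alpha_i] against [omega_j] is an integral over the half-line
    [1 <= z] corrected by integrals over circles, while [IKM] is an integral over the
    whole half-line [0 < z]. The proof shows that the circles account exactly for the
    missing segment [0 < z <= 1].

    Everything takes place on the universal cover, in the coordinate [u = ln z].
    There [v_0 = - X E_0 + B E_1] with [B = 2 pi i I_0] and [X] the continuation of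
    [- 2 K_0], so that [e_0^p e_1^q] pairs with [z^j v_0^k] to
    [phi p q j = B^p X^q e^(j u)] ([pairing_v0]). One turn around [0] fixes [B] and
    replaces [X] by [X + B] ([phi_turns]). The weights [C_n(a)] are those for which
    [sum_a C_n(a) ((X + a B)^n - X^n) = B X^(n-1)] ([Cn_extracts_linear], an instance
    of the vanishing of [n]-th differences of polynomials of degree less than [n]).
    Applied to sections this identity says that the boundary of the circles cancels
    that of the half-line ([alpha_is_cycle]). Applied to functions it says that, if
    [W(x)] denotes the weighted sum of the integrals over the circles of radius
    [e^x], then [W'] is the integrand on the half-line ([RD_primW]): by Cauchy's
    theorem the derivative of a circle integral only sees its end points
    ([RD_Jint]). Hence the circles contribute [W(0)] and the half-line
    [W(+oo) - W(0)], and the period is [W(+oo)]. As [W] tends to [0] at [-oo], this is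
    the integral of [W'] over the real line, which is [IKM] in the variable
    [t = 2 e^(x/2)] ([period_alpha]). The term in [alpha_0] contributes nothing because
    [z^j] with [j >= 1] cancels the pole of [dz/z].

    The analytic input is the behaviour of the flat sections. A pair of explicit
    solutions [solI] and [solL = u solI - T] of the Bessel equation, with [solI] and [T]
    entire in [z], has Wronskian [1], so that every flat section is a combination
    of them with coefficients visible on the real axis ([flat_expansion]). The estimate
    [K_0(t) = - ln (t/2) + O(1)] at [0] ([K0_log]) determines the coefficient of
    [solL] in [E_1], hence the monodromy and the normalisation of the pairing. Decay at
    infinity follows from the monotonicity of [(I_0 + I_0') e^(-t)] and
    [(K_0 - K_0') e^t] ([growing_bound], [decaying_bound]). *)

Local Open Scope R_scope.

(** * The function [K0] from its integral *)

Lemma exp_le_exp (x y : R) : x <= y -> exp x <= exp y.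
Proof. intros [H| ->]; [left; now apply exp_increasing|right; reflexivity]. Qed.

Definition K0_part (t X : R) : R := RInt (fun x => exp (- t * cosh x)) 0 X.

Lemma continuous_K0_integrand (t x : R) : continuous (fun x => exp (- t * cosh x)) x.
Proof.
  apply (ex_derive_continuous (K := R_AbsRing) (V := R_NormedModule)).
  unfold cosh. auto_derive. exact I.
Qed.

Lemma ex_RInt_K0 (t a b : R) : ex_RInt (fun x => exp (- t * cosh x)) a b.
Proof. apply (ex_RInt_continuous (V := R_CompleteNormedModule)). intros; apply continuous_K0_integrand. Qed.

Lemma K0_part_split (t X Y : R) :
  K0_part t Y = K0_part t X + RInt (fun x => exp (- t * cosh x)) X Y.
Proof.
  unfold K0_part. symmetry.
  apply (RInt_Chasles (V := R_CompleteNormedModule)); apply ex_RInt_K0.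
Qed.

(** [exp(-y) <= 1/y] at [y = t e^x / 2 <= t cosh x] gives an integrable majorant. *)
Lemma K0_tail (t a b : R) : 0 < t -> a <= b ->
  0 <= RInt (fun x => exp (- t * cosh x)) a b <= 2 / t * (exp (- a) - exp (- b)).
Proof.
  intros Ht Hab. split.
  - apply RInt_ge_0; [exact Hab|apply ex_RInt_K0|]. intros; left; apply exp_pos.
  - assert (HI : is_RInt (fun x => 2 / t * exp (- x)) a b
       (minus (- (2 / t) * exp (- b)) (- (2 / t) * exp (- a)))).
    { apply (is_RInt_derive (V := R_CompleteNormedModule) (fun x => - (2 / t) * exp (- x))).
      - intros x _. auto_derive; [exact I|]. field. lra.
      - intros x _. apply (ex_derive_continuous (K := R_AbsRing) (V := R_NormedModule)).
        auto_derive. exact I. }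
    replace (2 / t * (exp (- a) - exp (- b)))
      with (minus (- (2 / t) * exp (- b)) (- (2 / t) * exp (- a))).
    2: { unfold minus, plus, opp; simpl. ring. }
    rewrite <- (is_RInt_unique _ _ _ _ HI).
    apply RInt_le; [exact Hab|apply ex_RInt_K0|eexists; exact HI|].
    intros x _.
    assert (Hy : 0 < t / 2 * exp x) by (apply Rmult_lt_0_compat; [lra|apply exp_pos]).
    replace (2 / t * exp (- x)) with (/ (t / 2 * exp x)).
    2: { rewrite exp_Ropp. field. split; apply Rgt_not_eq; [apply exp_pos|lra]. }
    replace (- t * cosh x) with (- (t * cosh x)) by ring. rewrite exp_Ropp.
    apply Rinv_le_contravar; [exact Hy|].
    apply Rle_trans with (1 + t * cosh x).
    + unfold cosh. pose proof (Rmult_lt_0_compat _ _ Ht (exp_pos (- x))) as H.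
      apply Rmult_lt_compat_l with (r := 1) in H; lra.
    + apply exp_ineq1_le.
Qed.

Lemma K0_part_mono (t X Y : R) : 0 < t -> X <= Y -> K0_part t X <= K0_part t Y.
Proof. intros Ht H. rewrite (K0_part_split t X Y). pose proof (K0_tail t X Y Ht H). lra. Qed.

(** The integrand is positive with an integrable majorant, so the improper integral
    converges; all estimates of [K0] then reduce to integrals over bounded intervals. *)
Lemma K0_lub (t : R) : 0 < t -> is_lub (fun y => exists X, 0 <= X /\ y = K0_part t X) (K0 t).
Proof.
  intros Ht.
  destruct (completeness (fun y => exists X, 0 <= X /\ y = K0_part t X)) as [l Hl].
  { exists (2 / t). intros y (X & HX & ->).
    pose proof (K0_tail t 0 X Ht HX) as [_ H]. fold (K0_part t X) in H.
    eapply Rle_trans; [exact H|]. rewrite Ropp_0, exp_0.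
    pose proof (exp_pos (- X)). assert (0 < 2 / t) by (apply Rdiv_lt_0_compat; lra). nra. }
  { exists (K0_part t 0). exists 0. split; [lra|reflexivity]. }
  replace (K0 t) with l; [exact Hl|]. symmetry.
  unfold K0. apply is_RInt_gen_unique.
  intros P [eps HP].
  destruct (Hl) as [Hub Hleast].
  assert (Hex : exists X, 0 <= X /\ l - eps < K0_part t X).
  { destruct (classic (exists X, 0 <= X /\ l - eps < K0_part t X)) as [H|H]; [exact H|].
    exfalso. assert (l <= l - eps).
    { apply Hleast. intros y (X & HX & ->). apply Rnot_lt_le. intros Hlt. apply H. now exists X. }
    pose proof (cond_pos eps). lra. }
  destruct Hex as (X & HX & HlX).
  apply (Filter_prod _ _ _ (fun a => a = 0) (fun b => X < b)).
  - reflexivity.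
  - exists X. auto.
  - intros a b -> Hb. exists (K0_part t b). split.
    + apply (RInt_correct (V := R_CompleteNormedModule)), ex_RInt_K0.
    + apply HP. assert (Hb1 := K0_part_mono t X b Ht (Rlt_le _ _ Hb)).
      assert (Hb2 : K0_part t b <= l) by (apply Hub; exists b; split; [lra|reflexivity]).
      unfold ball; simpl. unfold AbsRing_ball, abs, minus, plus, opp; simpl.
      apply Rabs_def1; pose proof (cond_pos eps); lra.
Qed.

Lemma K0_pos (t : R) : 0 < t -> 0 <= K0 t.
Proof.
  intros Ht. destruct (K0_lub t Ht) as [H _].
  replace 0 with (K0_part t 0); [apply H; exists 0; split; [lra|reflexivity]|].
  unfold K0_part. apply (RInt_point (V := R_CompleteNormedModule)).
Qed.

Lemma K0_antitone (t t' : R) : 0 < t -> t <= t' -> K0 t' <= K0 t.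
Proof.
  intros Ht Htt. destruct (K0_lub t Ht) as [H _]. destruct (K0_lub t' ltac:(lra)) as [_ H'].
  apply H'. intros y (X & HX & ->). apply Rle_trans with (K0_part t X).
  - unfold K0_part. apply RInt_le; [exact HX|apply ex_RInt_K0|apply ex_RInt_K0|].
    intros x _. assert (0 < cosh x).
    { unfold cosh. pose proof (exp_pos x). pose proof (exp_pos (- x)). lra. }
    assert (Hle : - t' * cosh x <= - t * cosh x) by nra.
    now apply exp_le_exp.
  - apply H. now exists X.
Qed.

(** Splitting the integral at [ln (2/t)], where [t e^x / 2] passes [1]: below it
    [1 - t cosh x <= exp (- t cosh x) <= 1], beyond it the integral is at most [1]. *)
Lemma K0_log (t : R) : 0 < t <= 2 -> Rabs (K0 t - ln (2 / t)) <= 1.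
Proof.
  intros Ht. destruct (K0_lub t (proj1 Ht)) as [H H'].
  set (X := ln (2 / t)).
  assert (H2t : 1 <= 2 / t).
  { apply Rmult_le_reg_r with t; [lra|]. unfold Rdiv. rewrite Rmult_assoc, Rinv_l; lra. }
  assert (HX : 0 <= X) by (unfold X; rewrite <- ln_1; apply ln_le; lra).
  assert (HeX : exp X = 2 / t) by (apply exp_ln; lra).
  apply Rabs_le_between. split.
  - assert (HL : X - 1 <= K0_part t X).
    { assert (HI : is_RInt (fun x => 1 - t * cosh x) 0 X
         (minus (X - t * sinh X) (0 - t * sinh 0))).
      { apply (is_RInt_derive (V := R_CompleteNormedModule) (fun x => x - t * sinh x)).
        - intros x _. unfold sinh, cosh. auto_derive; [exact I|]. field.
        - intros x _. apply (ex_derive_continuous (K := R_AbsRing) (V := R_NormedModule)).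
          unfold cosh. auto_derive. exact I. }
      apply Rle_trans with (RInt (fun x => 1 - t * cosh x) 0 X).
      - rewrite (is_RInt_unique _ _ _ _ HI). unfold minus, plus, opp; simpl.
        rewrite sinh_0. unfold sinh. rewrite HeX.
        pose proof (exp_pos (- X)).
        assert (t * (2 / t) = 2) by (field; lra). nra.
      - unfold K0_part. apply RInt_le; [exact HX|eexists; exact HI|apply ex_RInt_K0|].
        intros x _. replace (1 - t * cosh x) with (1 + (- t * cosh x)) by ring. apply exp_ineq1_le. }
    assert (K0_part t X <= K0 t) by (apply H; now exists X). lra.
  - assert (K0 t <= X + 1); [|lra].
    apply H'. intros y (Y & HY & ->).
    assert (HU : forall Z, X <= Z -> K0_part t Z <= X + 1).
    { intros Z HZ. rewrite (K0_part_split t X Z). apply Rplus_le_compat.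
      - unfold K0_part. apply Rle_trans with (RInt (fun _ => 1) 0 X).
        + apply RInt_le; [exact HX|apply ex_RInt_K0|apply ex_RInt_const|].
          intros x _. rewrite <- exp_0. apply exp_le_exp.
          unfold cosh. pose proof (exp_pos x). pose proof (exp_pos (- x)). nra.
        + rewrite RInt_const. unfold scal; simpl; unfold mult; simpl. lra.
      - eapply Rle_trans; [apply K0_tail; [lra|exact HZ]|].
        rewrite exp_Ropp, HeX. pose proof (exp_pos (- Z)).
        assert (2 / t * / (2 / t) = 1) by (field; lra). nra. }
    destruct (Rle_lt_dec X Y) as [HXY|HXY]; [now apply HU|].
    eapply Rle_trans; [apply (K0_part_mono t Y X); lra|]. apply HU. lra.
Qed.

Local Open Scope C_scope.

(** * Finite sums and binomial identities *)

Lemma Csum_ext {A} (f g : A -> C) (l : list A) :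
  (forall x, In x l -> f x = g x) -> Csum f l = Csum g l.
Proof.
  induction l as [|x l IH]; intros H; simpl; [reflexivity|].
  now rewrite H, IH; [ | intros; apply H; right | left].
Qed.

Lemma Csum_plus {A} (f g : A -> C) (l : list A) :
  Csum (fun x => f x + g x) l = Csum f l + Csum g l.
Proof. induction l as [|x l IH]; simpl; [ring|rewrite IH; ring]. Qed.

Lemma Csum_scal {A} (c : C) (f : A -> C) (l : list A) :
  Csum (fun x => c * f x) l = c * Csum f l.
Proof. induction l as [|x l IH]; simpl; [ring|rewrite IH; ring]. Qed.

Lemma Csum_app {A} (f : A -> C) (l m : list A) :
  Csum f (l ++ m) = Csum f l + Csum f m.
Proof. induction l as [|x l IH]; simpl; [ring|rewrite IH; ring]. Qed.

Lemma Csum_map {A B} (f : B -> C) (h : A -> B) (l : list A) :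
  Csum f (map h l) = Csum (fun x => f (h x)) l.
Proof. induction l as [|x l IH]; simpl; [ring|rewrite IH; ring]. Qed.

Lemma Csum_zero {A} (f : A -> C) (l : list A) :
  (forall x, In x l -> f x = 0) -> Csum f l = 0.
Proof.
  induction l as [|x l IH]; intros H; simpl; [reflexivity|].
  rewrite H, IH; [ring | intros; apply H; now right | now left].
Qed.

Lemma Csum_swap {A B} (f : A -> B -> C) (l : list A) (m : list B) :
  Csum (fun x => Csum (f x) m) l = Csum (fun y => Csum (fun x => f x y) l) m.
Proof.
  induction l as [|x l IH]; simpl.
  - now rewrite Csum_zero.
  - now rewrite IH, Csum_plus.
Qed.

Lemma Csum_seq_l (f : nat -> C) (n : nat) :
  Csum f (seq 0 (S n)) = f 0%nat + Csum (fun m => f (S m)) (seq 0 n).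
Proof. simpl. now rewrite <- seq_shift, Csum_map. Qed.

Lemma Csum_seq_r (f : nat -> C) (n : nat) :
  Csum f (seq 0 (S n)) = Csum f (seq 0 n) + f n.
Proof. rewrite seq_S, Csum_app. simpl. ring. Qed.

Lemma Cpow_0_r (c : C) : c ^ 0 = 1.
Proof. reflexivity. Qed.

Lemma Cplus_eq_0 (x y : C) : x + y = 0 -> y = - x.
Proof. intros H. replace y with (x + y - x) by ring. rewrite H. ring. Qed.

(** A natural-number binomial coefficient that vanishes for [m > n], unlike
    [Binomial.C]: Pascal's rule then has no side condition. *)
Fixpoint bin (n m : nat) : nat :=
  match n, m with
  | _, 0%nat => 1
  | 0%nat, S _ => 0
  | S n', S m' => bin n' m' + bin n' (S m')
  end.

Lemma bin_gt (n m : nat) : (n < m)%nat -> bin n m = 0%nat.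
Proof.
  revert m; induction n as [|n IH]; intros [|m] H; simpl; try lia.
  rewrite !IH; lia.
Qed.

Lemma bin_0_r (n : nat) : bin n 0 = 1%nat.
Proof. now destruct n. Qed.

Lemma bin_absorb (n m : nat) : (S m * bin (S n) (S m) = S n * bin n m)%nat.
Proof.
  revert m; induction n as [|n IH]; intros m.
  - destruct m as [|[|m]]; simpl; lia.
  - change (bin (S (S n)) (S m)) with (bin (S n) m + bin (S n) (S m))%nat.
    rewrite Nat.mul_add_distr_l, IH.
    destruct m as [|m].
    + rewrite !bin_0_r. lia.
    + rewrite Nat.mul_succ_l, IH.
      change (bin (S n) (S m)) with (bin n m + bin n (S m))%nat. lia.
Qed.

Lemma bin_fact (n m : nat) :
  (m <= n)%nat -> (bin n m * (fact m * fact (n - m)) = fact n)%nat.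
Proof.
  revert m; induction n as [|n IH]; intros m H.
  - replace m with 0%nat by lia. reflexivity.
  - destruct m as [|m].
    + rewrite bin_0_r, Nat.sub_0_r. change (fact 0) with 1%nat. lia.
    + pose proof (bin_absorb n m) as Ha. pose proof (IH m ltac:(lia)) as Hb.
      rewrite (fact_simpl m), (fact_simpl n), Nat.sub_succ, <- Hb, !Nat.mul_assoc, <- Ha.
      lia.
Qed.

Lemma bin_C (n m : nat) : (m <= n)%nat -> Binomial.C n m = INR (bin n m).
Proof.
  intros H. unfold Binomial.C. rewrite <- (bin_fact n m H), !mult_INR.
  field. split; apply INR_fact_neq_0.
Qed.

(** Induction on [r] by the absorption [a bin(n,a) = n bin(n-1,a-1)]. It shifts [a] by
    one, whence the arbitrary translate [c]. *)
Lemma alternating_power (r n : nat) (c : C) : (r < n)%nat ->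
  Csum (fun a => RtoC ((-1) ^ a * INR (bin n a)) * (RtoC (INR a) + c) ^ r)
       (seq 0 (S n)) = 0.
Proof.
  revert n c; induction r as [|r IH]; intros n c Hr.
  - assert (H : forall n, Csum (fun a => RtoC ((-1) ^ a * INR (bin (S n) a)))
      (seq 0 (S (S n))) = 0).
    { clear. intros n.
      rewrite Csum_seq_l.
      assert (H : forall N, RtoC ((-1) ^ 0 * INR (bin (S n) 0)) +
        Csum (fun m => RtoC ((-1) ^ S m * INR (bin (S n) (S m)))) (seq 0 N)
        = RtoC ((-1) ^ N * INR (bin n N))).
      { induction N as [|N IHN].
        - simpl. rewrite bin_0_r. simpl. ring.
        - rewrite Csum_seq_r.
          transitivity (RtoC ((-1) ^ N * INR (bin n N))
             + RtoC ((-1) ^ S N * INR (bin (S n) (S N)))).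
          + rewrite <- IHN. ring.
          + rewrite <- RtoC_plus. f_equal.
            change (bin (S n) (S N)) with (bin n N + bin n (S N))%nat.
            rewrite plus_INR. simpl pow. ring. }
      rewrite H, (bin_gt n (S n)); [|lia]. simpl. rewrite Rmult_0_r. reflexivity. }
    destruct n as [|n]; [lia|]. rewrite <- (H n). apply Csum_ext; intros.
    rewrite Cpow_0_r. ring.
  - destruct n as [|n]; [lia|].
    rewrite (Csum_ext _ (fun a =>
      c * (RtoC ((-1) ^ a * INR (bin (S n) a)) * (RtoC (INR a) + c) ^ r)
      + RtoC ((-1) ^ a * INR (a * bin (S n) a)) * (RtoC (INR a) + c) ^ r)).
    2: { intros a _. rewrite mult_INR, Cpow_S, !RtoC_mult. ring. }
    rewrite Csum_plus, Csum_scal, IH by lia.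
    rewrite Csum_seq_l. simpl (0 * _)%nat.
    rewrite (Csum_ext _ (fun a => RtoC (- INR (S n)) *
      (RtoC ((-1) ^ a * INR (bin n a)) * (RtoC (INR a) + (1 + c)) ^ r))).
    2: { intros a _. rewrite bin_absorb, mult_INR.
         replace (RtoC (INR (S a)) + c) with (RtoC (INR a) + (1 + c)).
         2: { rewrite S_INR, RtoC_plus. ring. }
         rewrite Cmult_assoc, <- RtoC_mult. f_equal. f_equal. simpl pow. ring. }
    rewrite Csum_scal, IH by lia. simpl. rewrite Rmult_0_r. ring.
Qed.

(** For [m >= 2] the coefficient of [w m] is an [n]-th difference of [a^(m-1)] and vanishes
    by [alternating_power]; for [m = 1] the missing term [a = 0] of the alternating sum
    leaves [1]; for [m = 0] the subtraction of [w 0] leaves nothing. *)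
Lemma Cn_extracts_linear (n : nat) (w : nat -> C) : (1 <= n)%nat ->
  Csum (fun a => RtoC (Cn n a) *
     (Csum (fun m => RtoC (INR (bin n m)) * RtoC (INR a) ^ m * w m) (seq 0 (S n))
      - w 0%nat)) (seq 1 n) = w 1%nat.
Proof.
  intros Hn.
  rewrite (Csum_ext _ (fun a => Csum (fun m => RtoC (INR (bin n (S m))) * w (S m)
     * (RtoC (Cn n a) * RtoC (INR a) ^ (S m))) (seq 0 n))).
  2: { intros a _. rewrite Csum_seq_l, bin_0_r, Cpow_0_r. simpl INR.
       replace (RtoC 1 * 1 * w 0%nat + Csum (fun m : nat =>
         RtoC (INR (bin n (S m))) * RtoC (INR a) ^ (S m) * w (S m)) (seq 0 n) - w 0%nat)
       with (Csum (fun m : nat =>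
         RtoC (INR (bin n (S m))) * RtoC (INR a) ^ (S m) * w (S m)) (seq 0 n)) by ring.
       rewrite <- Csum_scal. apply Csum_ext; intros; ring. }
  rewrite Csum_swap.
  assert (Hkey : forall m, (m < n)%nat ->
     Csum (fun a => RtoC (Cn n a) * RtoC (INR a) ^ S m) (seq 1 n)
     = if (m =? 0)%nat then RtoC (/ INR n) else 0).
  { intros m Hm.
    assert (Hn0 : INR n <> 0%R) by (apply not_0_INR; lia).
    pose proof (alternating_power m n 0 Hm) as H.
    rewrite Csum_seq_l in H. rewrite <- seq_shift, Csum_map.
    rewrite (Csum_ext _ (fun a => RtoC (- / INR n) *
       (RtoC ((-1) ^ S a * INR (bin n (S a))) * (RtoC (INR (S a)) + 0) ^ m))).
    2: { intros a Ha. apply in_seq in Ha. unfold Cn.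
         rewrite bin_C by lia. simpl Nat.sub. rewrite Nat.sub_0_r.
         rewrite Cplus_0_r, Cpow_S, Cmult_assoc, <- RtoC_mult, Cmult_assoc, <- RtoC_mult.
         f_equal. f_equal. simpl pow.
         field. split; try assumption; apply not_0_INR; lia. }
    rewrite Csum_scal.
    apply Cplus_eq_0 in H.
    rewrite H, bin_0_r, RtoC_opp.
    replace ((-1) ^ 0 * INR 1)%R with 1%R by (simpl; ring).
    destruct m; cbn [Nat.eqb].
    - rewrite Cpow_0_r. ring.
    - rewrite Cpow_S. simpl (INR 0). ring. }
  destruct n as [|n]; [lia|].
  rewrite Csum_seq_l.
  rewrite (Csum_zero (fun m => Csum _ (seq 1 (S n))) (seq 0 n)).
  - rewrite Csum_scal, (Hkey 0%nat) by lia. simpl Nat.eqb. cbv iota.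
    assert (Hb : bin (S n) 1 = S n).
    { pose proof (bin_absorb n 0). rewrite bin_0_r in H. lia. }
    rewrite Hb. rewrite Cplus_0_r.
    replace (RtoC (INR (S n)) * w 1%nat * RtoC (/ INR (S n)))
      with (RtoC (INR (S n) * / INR (S n)) * w 1%nat) by (rewrite RtoC_mult; ring).
    rewrite Rinv_r by (apply not_0_INR; lia). ring.
  - intros m Hm. apply in_seq in Hm.
    rewrite Csum_scal, Hkey by lia. simpl. ring.
Qed.

(** * Symmetric powers in coordinates *)

(** Multiplication of a polynomial in [v_0], [v_1] by a linear form. Building monomials
    one factor at a time makes induction possible without the convolution [vmul]. *)
Definition lmul (e : C * C) (y : vec) : vec :=
  fun a => fst e * y a + match a with 0%nat => 0 | S b => snd e * y b end.

Lemma vmul_lin (e : C * C) (y : vec) : vmul (lin e) y = lmul e y.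
Proof.
  extensionality a. unfold vmul, lmul.
  rewrite Csum_seq_l, Nat.sub_0_r. simpl lin at 1. f_equal.
  destruct a as [|a]; [reflexivity|].
  rewrite Csum_seq_l. simpl lin at 1. simpl Nat.sub. rewrite Nat.sub_0_r.
  rewrite Csum_zero; [ring|]. intros; simpl; ring.
Qed.

Lemma vmul_vone (y : vec) : vmul vone y = y.
Proof.
  extensionality a. unfold vmul. rewrite Csum_seq_l, Nat.sub_0_r, Csum_zero.
  - simpl; ring.
  - intros; simpl; ring.
Qed.

Lemma vmul_lmul (e : C * C) (x y : vec) : vmul (lmul e x) y = lmul e (vmul x y).
Proof.
  extensionality a. unfold vmul, lmul.
  rewrite (Csum_ext _ (fun b => fst e * (x b * y (a - b)%nat) +
     match b with 0%nat => 0 | S b' => snd e * x b' * y (a - b)%nat end)).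
  2: { intros [|b] _; ring. }
  rewrite Csum_plus, Csum_scal. f_equal.
  rewrite Csum_seq_l, Cplus_0_l.
  destruct a as [|a]; [reflexivity|].
  rewrite <- Csum_scal. apply Csum_ext; intros b _. simpl Nat.sub. ring.
Qed.

Fixpoint lpow (e : C * C) (n : nat) (y : vec) : vec :=
  match n with 0%nat => y | S m => lmul e (lpow e m y) end.

Lemma vmul_vpow (e : C * C) (n : nat) (y : vec) : vmul (vpow (lin e) n) y = lpow e n y.
Proof.
  induction n as [|n IH]; simpl.
  - apply vmul_vone.
  - now rewrite vmul_lin, vmul_lmul, IH.
Qed.

Lemma mono_lpow (e : C * C) (p : nat) (f : C * C) (q : nat) :
  mono e p f q = lpow e p (lpow f q vone).
Proof.
  unfold mono. rewrite vmul_vpow. f_equal.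
  assert (H : forall y, vmul y vone = y).
  { intros y. extensionality a. unfold vmul. rewrite Csum_seq_r, Nat.sub_diag, Csum_zero.
    - simpl; ring.
    - intros b Hb. apply in_seq in Hb.
      destruct (a - b)%nat eqn:Hd; [lia|]. simpl; ring. }
  now rewrite <- (H (vpow (lin f) q)), vmul_vpow.
Qed.

Lemma lmul_comm (e f : C * C) (y : vec) : lmul e (lmul f y) = lmul f (lmul e y).
Proof. extensionality a. unfold lmul. destruct a as [|[|a]]; ring. Qed.

Lemma lpow_lmul (e f : C * C) (n : nat) (y : vec) :
  lpow e n (lmul f y) = lmul f (lpow e n y).
Proof. induction n as [|n IH]; simpl; [reflexivity|]. now rewrite IH, lmul_comm. Qed.

Lemma lpow_comm (e f : C * C) (n m : nat) (y : vec) :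
  lpow e n (lpow f m y) = lpow f m (lpow e n y).
Proof. induction m as [|m IH]; simpl; [reflexivity|]. now rewrite lpow_lmul, IH. Qed.

Definition vcomb (A : C) (e : C * C) (B : C) (f : C * C) : C * C :=
  (A * fst e + B * fst f, A * snd e + B * snd f).

Lemma lmul_vcomb (A B : C) (e f : C * C) (y : vec) (a : nat) :
  lmul (vcomb A e B f) y a = A * lmul e y a + B * lmul f y a.
Proof. unfold lmul, vcomb; simpl. destruct a; ring. Qed.

Lemma lmul_Csum {T} (e : C * C) (c : T -> C) (v : T -> vec) (l : list T) (a : nat) :
  lmul e (fun a => Csum (fun t => c t * v t a) l) a
  = Csum (fun t => c t * lmul e (v t) a) l.
Proof.
  unfold lmul. destruct a as [|a].
  - rewrite Cplus_0_r, <- Csum_scal. apply Csum_ext; intros; ring.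
  - rewrite <- !Csum_scal, <- Csum_plus. apply Csum_ext; intros; ring.
Qed.

(** Serves to expand [v_0^k] in the flat basis and the effect of the monodromy
    [e_1 |-> e_1 + a e_0] on a monomial; in degree [0] it is the scalar binomial formula. *)
Lemma lpow_binomial (A B : C) (e f : C * C) (n : nat) (y : vec) (a : nat) :
  lpow (vcomb A e B f) n y a =
  Csum (fun m => RtoC (INR (bin n m)) * A ^ (n - m) * B ^ m
                 * lpow e (n - m) (lpow f m y) a) (seq 0 (S n)).
Proof.
  revert a; induction n as [|n IH]; intros a.
  - simpl. ring.
  - change (lpow (vcomb A e B f) (S n) y) with (lmul (vcomb A e B f) (lpow (vcomb A e B f) n y)).
    assert (HE : lpow (vcomb A e B f) n y = fun a =>
      Csum (fun m => RtoC (INR (bin n m)) * A ^ (n - m) * B ^ m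
                 * lpow e (n - m) (lpow f m y) a) (seq 0 (S n))).
    { extensionality b. apply IH. }
    rewrite HE, lmul_vcomb.
    rewrite !(lmul_Csum _ (fun m => RtoC (INR (bin n m)) * A ^ (n - m) * B ^ m)
                (fun m => lpow e (n - m) (lpow f m y))).
    rewrite (Csum_seq_l _ (S n)).
    rewrite (Csum_ext (fun m => RtoC (INR (bin (S n) (S m))) * A ^ (S n - S m)
        * B ^ S m * lpow e (S n - S m) (lpow f (S m) y) a) (fun m =>
      B * (RtoC (INR (bin n m)) * A ^ (n - m) * B ^ m * lmul f (lpow e (n - m) (lpow f m y)) a)
      + RtoC (INR (bin n (S m))) * A ^ (n - m) * B ^ (S m) *
         lpow e (n - m) (lpow f (S m) y) a) (seq 0 (S n))).
    2: { intros m _.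
         change (bin (S n) (S m)) with (bin n m + bin n (S m))%nat.
         rewrite plus_INR, RtoC_plus. simpl Nat.sub.
         simpl lpow at 1. rewrite (lpow_lmul e f). simpl lpow. rewrite lpow_lmul, Cpow_S. ring. }
    rewrite Csum_plus, Csum_scal.
    rewrite (Csum_seq_r (fun m => RtoC (INR (bin n (S m))) * A ^ (n - m) * B ^ S m *
         lpow e (n - m) (lpow f (S m) y) a) n).
    rewrite (bin_gt n (S n)) by lia. simpl (INR 0).
    rewrite (Csum_seq_l (fun t => RtoC (INR (bin n t)) * A ^ (n - t) * B ^ t *
        lmul e (lpow e (n - t) (lpow f t y)) a) n).
    rewrite !bin_0_r, !Nat.sub_0_r, !Cpow_0_r. simpl (lpow f 0 y).
    change (lpow e (S n) y) with (lmul e (lpow e n y)).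
    rewrite Cmult_plus_distr_l, <- Csum_scal.
    rewrite (Csum_ext (fun m => A * _) (fun m => RtoC (INR (bin n (S m))) * A ^ (n - m) * B ^ (S m) *
         lpow e (n - m) (lpow f (S m) y) a)).
    2: { intros m Hm. apply in_seq in Hm.
         replace (n - m)%nat with (S (n - S m)) by lia. rewrite !Cpow_S.
         cbn [lpow]. ring. }
    rewrite Cpow_S. ring.
Qed.

(** The operator [z nabla_{d/dz}] on a fibre of [Kl_2]: [v_0 |-> v_1], [v_1 |-> z v_0]. *)
Definition kl2_conn (z : C) (e : C * C) : C * C := (z * snd e, fst e).

Definition vsupp (n : nat) (y : vec) : Prop := forall a, (n < a)%nat -> y a = 0.

Lemma vsupp_lmul (e : C * C) (n : nat) (y : vec) : vsupp n y -> vsupp (S n) (lmul e y).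
Proof. intros H [|a] Ha; [lia|]. unfold lmul. rewrite !H by lia. ring. Qed.

Lemma vsupp_vone : vsupp 0 vone.
Proof. intros [|a] Ha; [lia|reflexivity]. Qed.

(** On a vector supported in degrees [<= n] the truncations in [sym_conn] never act;
    the untruncated formula is the one that satisfies a Leibniz rule. *)
Lemma sym_conn_supp (n : nat) (z : C) (y : vec) (a : nat) : vsupp n y ->
  sym_conn n z y a =
  match a with 0%nat => 0 | S b => (RtoC (INR n) - RtoC (INR b)) * y b end
  + RtoC (INR (S a)) * z * y (S a).
Proof.
  intros H. unfold sym_conn. f_equal.
  - destruct a as [|b]; [reflexivity|].
    destruct (le_lt_dec b n) as [Hb|Hb].
    + now rewrite minus_INR, RtoC_minus.
    + rewrite H by lia. ring.
  - destruct (Nat.ltb_spec a n); [reflexivity|]. rewrite H by lia. ring.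
Qed.

Lemma sym_conn_lmul (e : C * C) (n : nat) (z : C) (y : vec) (a : nat) : vsupp n y ->
  sym_conn (S n) z (lmul e y) a = lmul (kl2_conn z e) y a + lmul e (sym_conn n z y) a.
Proof.
  intros H. rewrite sym_conn_supp by now apply vsupp_lmul.
  unfold lmul, kl2_conn; cbn [fst snd].
  destruct a as [|[|a]]; rewrite ?(sym_conn_supp n z y _ H), ?S_INR, ?RtoC_plus; simpl (INR 0); ring.
Qed.

(** * Complex derivatives *)

(** Derivatives with respect to a complex variable, and of complex valued functions of a
    real variable. *)
Local Notation CD := (is_derive (K := C_AbsRing) (V := C_NormedModule)).
Local Notation RD := (is_derive (K := R_AbsRing) (V := C_R_NormedModule)).

Lemma CD_eps (f : C -> C) (u l : C) :
  CD f u l <-> forall eps : posreal, exists d : posreal, forall h, Cmod h < d ->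
    Cmod (f (u + h) - f u - h * l) <= eps * Cmod h.
Proof.
  split.
  - intros [_ H] eps. destruct (H u (fun P H => H) eps) as [d Hd].
    exists d. intros h Hh. specialize (Hd (u + h)).
    assert (E : @minus C_AbsRing (u + h) u = h) by (unfold minus, plus, opp; simpl; ring).
    assert (B : ball (M := AbsRing_UniformSpace C_AbsRing) u d (u + h)).
    { unfold ball; simpl; unfold AbsRing_ball. rewrite E. exact Hh. }
    specialize (Hd B). cbv beta in Hd.
    change (minus (u + h) u) with (@minus C_AbsRing (u + h) u) in Hd.
    rewrite E in Hd. exact Hd.
  - intros H. split; [apply is_linear_scal_l|].
    intros x Hx eps.
    apply (is_filter_lim_locally_unique (V := AbsRing_NormedModule C_AbsRing)) in Hx.
    subst x. destruct (H eps) as [d Hd]. exists d. intros y Hy.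
    specialize (Hd (y - u) Hy).
    assert (E : forall a b : C, a + (b - a) = b) by (intros; ring).
    rewrite E in Hd. exact Hd.
Qed.

Lemma norm_CR (x : C) : norm (V := C_R_NormedModule) x = Cmod x.
Proof.
  unfold norm; simpl. unfold prod_norm, Cmod, norm; simpl. unfold abs; simpl.
  now rewrite !Rmult_1_r, <- !Rabs_mult, !(Rabs_pos_eq (_ * _)) by apply Rle_0_sqr.
Qed.

Lemma scal_CR (r : R) (x : C) : scal (V := C_R_NormedModule) r x = r * x.
Proof.
  unfold scal; simpl; unfold prod_scal, scal; simpl; unfold mult; simpl.
  apply injective_projections; simpl; ring.
Qed.

Lemma RD_eps (f : R -> C) (s : R) (l : C) :
  RD f s l <-> forall eps : posreal, exists d : posreal, forall h : R, Rabs h < d ->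
    Cmod (f (s + h)%R - f s - h * l) <= eps * Rabs h.
Proof.
  split.
  - intros [_ H] eps. destruct (H s (fun P H => H) eps) as [d Hd].
    exists d. intros h Hh. specialize (Hd (s + h)%R).
    assert (E : @minus R_AbsRing (s + h)%R s = h) by (unfold minus, plus, opp; simpl; ring).
    assert (B : ball (M := AbsRing_UniformSpace R_AbsRing) s d (s + h)%R).
    { unfold ball; simpl; unfold AbsRing_ball. rewrite E. exact Hh. }
    specialize (Hd B). cbv beta in Hd.
    change (minus (s + h)%R s) with (@minus R_AbsRing (s + h)%R s) in Hd.
    rewrite E, norm_CR, scal_CR in Hd. exact Hd.
  - intros H. split; [apply is_linear_scal_l|].
    intros x Hx eps.
    apply (is_filter_lim_locally_unique (V := AbsRing_NormedModule R_AbsRing)) in Hx.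
    subst x. destruct (H eps) as [d Hd]. exists d. intros y Hy.
    specialize (Hd (y - s)%R Hy).
    assert (E : forall a b : R, (a + (b - a))%R = b) by (intros; ring).
    rewrite E, <- scal_CR in Hd. rewrite norm_CR. exact Hd.
Qed.

(** Differentiability only involves the norm, so that the two normed module structures
    on [C] give the same notion; the product and chain rules are stated for the second. *)
Lemma CD_conv (f : C -> C) (u l : C) :
  CD f u l <-> is_derive (K := C_AbsRing) (V := AbsRing_NormedModule C_AbsRing) f u l.
Proof.
  split; intros [[A B N] H2]; (split; [split; [exact A|exact B|exact N]|exact H2]).
Qed.

Lemma CD_mult (f g : C -> C) (u l m : C) :
  CD f u l -> CD g u m -> CD (fun x => f x * g x) u (l * g u + f u * m).
Proof.
  rewrite !CD_conv. intros A B.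
  apply (is_derive_mult (K := C_AbsRing) _ _ _ _ _ A B). intros; apply Cmult_comm.
Qed.

Lemma CD_const (c u : C) : CD (fun _ => c) u (RtoC 0).
Proof. exact (is_derive_const (V := C_NormedModule) c u). Qed.

Lemma CD_id (u : C) : CD (fun x => x) u (RtoC 1).
Proof. apply CD_conv. exact (is_derive_id u). Qed.

Lemma CD_plus (f g : C -> C) (u l m : C) :
  CD f u l -> CD g u m -> CD (fun x => f x + g x) u (l + m).
Proof. intros A B. exact (is_derive_plus _ _ _ _ _ A B). Qed.

Lemma CD_opp (f : C -> C) (u l : C) : CD f u l -> CD (fun x => - f x) u (- l).
Proof. intros A. exact (is_derive_opp _ _ _ A). Qed.

Lemma CD_minus (f g : C -> C) (u l m : C) :
  CD f u l -> CD g u m -> CD (fun x => f x - g x) u (l - m).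
Proof. intros A B. exact (is_derive_minus _ _ _ _ _ A B). Qed.

Lemma CD_scal (c : C) (f : C -> C) (u l : C) : CD f u l -> CD (fun x => c * f x) u (c * l).
Proof.
  intros A. pose proof (CD_mult _ _ _ _ _ (CD_const c u) A) as H. simpl in H.
  replace (c * l) with (0 * f u + c * l) by ring. exact H.
Qed.

Lemma CD_ext (f g : C -> C) (u l : C) : (forall x, f x = g x) -> CD f u l -> CD g u l.
Proof. intros E. apply is_derive_ext. exact E. Qed.

Lemma CD_comp (f g : C -> C) (u l m : C) :
  CD f (g u) l -> CD g u m -> CD (fun x => f (g x)) u (m * l).
Proof.
  intros A B. apply CD_conv in B.
  exact (is_derive_comp (K := C_AbsRing) (V := C_NormedModule) f g u l m A B).
Qed.

Lemma CD_lipschitz (f : C -> C) (u l : C) : CD f u l ->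
  exists d : posreal, forall h, Cmod h < d -> Cmod (f (u + h) - f u) <= (Cmod l + 1) * Cmod h.
Proof.
  intros H. destruct (proj1 (CD_eps f u l) H (mkposreal 1 Rlt_0_1)) as [d Hd].
  exists d. intros h Hh. specialize (Hd h Hh). simpl in Hd.
  replace (f (u + h) - f u) with ((f (u + h) - f u - h * l) + h * l) by ring.
  eapply Rle_trans; [apply Cmod_triangle|]. rewrite Cmod_mult. lra.
Qed.

Lemma CD_continuous (f : C -> C) (u l : C) : CD f u l ->
  forall eps : posreal, exists d : posreal, forall h, Cmod h < d -> Cmod (f (u + h) - f u) < eps.
Proof.
  intros H eps. destruct (CD_lipschitz f u l H) as [d Hd].
  assert (Hl : 0 < Cmod l + 1) by (pose proof (Cmod_ge_0 l); lra).
  assert (Hm : 0 < Rmin d (eps / (Cmod l + 1))).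
  { apply Rmin_case; [apply cond_pos|]. apply Rdiv_lt_0_compat; [apply cond_pos|exact Hl]. }
  exists (mkposreal _ Hm). intros h Hh. simpl in Hh.
  eapply Rle_lt_trans; [apply Hd; eapply Rlt_le_trans; [exact Hh|apply Rmin_l]|].
  apply Rlt_le_trans with ((Cmod l + 1) * (eps / (Cmod l + 1)))%R.
  - apply Rmult_lt_compat_l; [exact Hl|]. eapply Rlt_le_trans; [exact Hh|apply Rmin_r].
  - right. field. lra.
Qed.

Lemma CD_RD_comp (f : C -> C) (c : R -> C) (s : R) (l m : C) :
  CD f (c s) l -> RD c s m -> RD (fun r => f (c r)) s (m * l).
Proof.
  intros Hf Hc. apply RD_eps. intros eps.
  pose proof (Cmod_ge_0 l) as Hl0. pose proof (Cmod_ge_0 m) as Hm0.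
  assert (He1 : 0 < eps / (2 * (Cmod m + 1))).
  { apply Rdiv_lt_0_compat; [apply cond_pos|lra]. }
  assert (He2 : 0 < Rmin 1 (eps / (2 * (Cmod l + 1)))).
  { apply Rmin_case; [lra|]. apply Rdiv_lt_0_compat; [apply cond_pos|lra]. }
  destruct (proj1 (CD_eps _ _ _) Hf (mkposreal _ He1)) as [d1 H1].
  destruct (proj1 (RD_eps _ _ _) Hc (mkposreal _ He2)) as [d2 H2].
  assert (Hd : 0 < Rmin d2 (d1 / (Cmod m + 1))).
  { apply Rmin_case; [apply cond_pos|]. apply Rdiv_lt_0_compat; [apply cond_pos|lra]. }
  exists (mkposreal _ Hd). intros h Hh. simpl in Hh, H1, H2.
  assert (Hh2 : Rabs h < d2) by (eapply Rlt_le_trans; [exact Hh|apply Rmin_l]).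
  specialize (H2 h Hh2).
  set (k := c (s + h)%R - c s) in *.
  pose proof (Rabs_pos h) as Hh0.
  assert (Hk : Cmod k <= (Cmod m + 1) * Rabs h).
  { replace k with ((k - h * m) + h * m) by ring.
    eapply Rle_trans; [apply Cmod_triangle|]. rewrite Cmod_mult, Cmod_R.
    pose proof (Rmin_l 1 (eps / (2 * (Cmod l + 1)))).
    nra. }
  assert (Hkd : Cmod k < d1).
  { eapply Rle_lt_trans; [exact Hk|].
    apply Rlt_le_trans with ((Cmod m + 1) * (d1 / (Cmod m + 1)))%R.
    - apply Rmult_lt_compat_l; [lra|]. eapply Rlt_le_trans; [exact Hh|apply Rmin_r].
    - right; field; lra. }
  specialize (H1 k Hkd).
  replace (c s + k) with (c (s + h)%R) in H1 by (unfold k; ring).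
  replace (f (c (s + h)%R) - f (c s) - h * (m * l))
    with ((f (c (s + h)%R) - f (c s) - k * l) + (k - h * m) * l) by ring.
  eapply Rle_trans; [apply Cmod_triangle|]. rewrite Cmod_mult.
  assert (A1 : (eps / (2 * (Cmod m + 1)) * Cmod k <= eps / 2 * Rabs h)%R).
  { apply Rle_trans with (eps / (2 * (Cmod m + 1)) * ((Cmod m + 1) * Rabs h))%R.
    - apply Rmult_le_compat_l; [lra|exact Hk].
    - right; field; lra. }
  assert (A2 : (Cmod (k - h * m) * Cmod l <= eps / 2 * Rabs h)%R).
  { apply Rle_trans with ((eps / (2 * (Cmod l + 1)) * Rabs h) * (Cmod l + 1))%R.
    - apply Rmult_le_compat; try apply Cmod_ge_0; [|lra].
      eapply Rle_trans; [exact H2|]. apply Rmult_le_compat_r; [exact Hh0|apply Rmin_r].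
    - right; field; lra. }
  lra.
Qed.

Lemma RD_Re (f : R -> C) (s : R) (l : C) : RD f s l -> is_derive (fun r => Re (f r)) s (Re l).
Proof.
  intros [_ H]. split; [apply is_linear_scal_l|]. intros x Hx eps.
  destruct (H x Hx eps) as [d Hd]. exists d. intros y Hy. specialize (Hd y Hy).
  rewrite norm_CR in Hd. eapply Rle_trans; [|exact Hd].
  apply Rle_trans with (Rabs (Re (minus (minus (f y) (f x)) (scal (minus y x) l) : C))).
  - right. reflexivity.
  - apply re_le_Cmod.
Qed.

Lemma im_le_Cmod (c : C) : Rabs (Im c) <= Cmod c.
Proof. eapply Rle_trans; [apply Rmax_r|apply Rmax_Cmod]. Qed.

Lemma RD_Im (f : R -> C) (s : R) (l : C) : RD f s l -> is_derive (fun r => Im (f r)) s (Im l).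
Proof.
  intros [_ H]. split; [apply is_linear_scal_l|]. intros x Hx eps.
  destruct (H x Hx eps) as [d Hd]. exists d. intros y Hy. specialize (Hd y Hy).
  rewrite norm_CR in Hd. eapply Rle_trans; [|exact Hd].
  apply Rle_trans with (Rabs (Im (minus (minus (f y) (f x)) (scal (minus y x) l) : C))).
  - right. reflexivity.
  - apply im_le_Cmod.
Qed.

Lemma Cmod_le_Re_Im (c : C) : Cmod c <= Rabs (Re c) + Rabs (Im c).
Proof.
  destruct c as [x y]. replace ((x, y) : C) with (RtoC x + RtoC y * Ci).
  2: { apply injective_projections; simpl; ring. }
  eapply Rle_trans; [apply Cmod_triangle|]. rewrite Cmod_mult, Cmod_Ci, !Cmod_R. simpl.
  right. f_equal; [f_equal; ring|]. rewrite Rmult_1_r. f_equal. ring.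
Qed.

Lemma RD_pair (f : R -> C) (s : R) (l : C) :
  is_derive (fun r => Re (f r)) s (Re l) -> is_derive (fun r => Im (f r)) s (Im l) -> RD f s l.
Proof.
  intros [_ H1] [_ H2]. apply RD_eps. intros eps.
  assert (He : 0 < eps / 2) by (pose proof (cond_pos eps); lra).
  destruct (H1 s (fun P H => H) (mkposreal _ He)) as [d1 A1].
  destruct (H2 s (fun P H => H) (mkposreal _ He)) as [d2 A2].
  assert (Hd : 0 < Rmin d1 d2) by (apply Rmin_case; apply cond_pos).
  exists (mkposreal _ Hd). intros h Hh. simpl in Hh.
  assert (E : @minus R_AbsRing (s + h)%R s = h) by (unfold minus, plus, opp; simpl; ring).
  assert (B : forall d : posreal, Rmin d1 d2 <= d ->
      ball (M := AbsRing_UniformSpace R_AbsRing) s d (s + h)%R).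
  { intros d Hle. unfold ball; simpl; unfold AbsRing_ball. rewrite E. eapply Rlt_le_trans; [exact Hh|exact Hle]. }
  specialize (A1 _ (B d1 (Rmin_l _ _))). specialize (A2 _ (B d2 (Rmin_r _ _))).
  cbv beta in A1, A2.
  change (minus (s + h)%R s) with (@minus R_AbsRing (s + h)%R s) in A1, A2.
  rewrite E in A1, A2.
  eapply Rle_trans; [apply Cmod_le_Re_Im|].
  apply Rle_trans with (eps / 2 * Rabs h + eps / 2 * Rabs h)%R; [|lra].
  apply Rplus_le_compat.
  - eapply Rle_trans; [|exact A1]. right. unfold norm; simpl. unfold abs; simpl. f_equal.
    unfold minus, plus, opp, scal; simpl; unfold mult; simpl. unfold Re. simpl. ring.
  - eapply Rle_trans; [|exact A2]. right. unfold norm; simpl. unfold abs; simpl. f_equal.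
    unfold minus, plus, opp, scal; simpl; unfold mult; simpl. unfold Im. simpl. ring.
Qed.

Lemma RD_RtoC (f : R -> R) (s l : R) : is_derive f s l -> RD (fun r => RtoC (f r)) s (RtoC l).
Proof.
  intros H. apply RD_pair; simpl; [exact H|]. apply (is_derive_const (V := R_NormedModule) 0%R s).
Qed.

Lemma RD_line (u0 tau : C) (s : R) : RD (fun r => u0 + RtoC r * tau) s tau.
Proof.
  apply RD_pair; simpl; (evar_last; [auto_derive; [exact I|reflexivity]|]); destruct tau; simpl; ring.
Qed.

Lemma CD_zero_const (f : C -> C) : (forall u, CD f u (RtoC 0)) -> forall u v, f u = f v.
Proof.
  intros H u v.
  assert (E := eq_is_derive (V := C_R_NormedModule) (fun r => f (u + RtoC r * (v - u))) 0 1).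
  cbv beta in E.
  replace u with (u + 0%R * (v - u)) at 1 by ring.
  replace v with (u + 1%R * (v - u)) at 2 by ring.
  apply E; [|lra]. intros t _.
  evar_last; [apply (CD_RD_comp f (fun r => u + RtoC r * (v - u)) t (RtoC 0) (v - u)); [apply H|apply RD_line]|].
  change (zero : C_R_NormedModule) with (RtoC 0). ring.
Qed.

(** * The complex exponential *)

Lemma Cexp_plus (u v : C) : Cexp (u + v) = Cexp u * Cexp v.
Proof.
  unfold Cexp. destruct u as [a b], v as [c d]. simpl.
  apply injective_projections; simpl; rewrite exp_plus, ?cos_plus, ?sin_plus; ring.
Qed.

Lemma Cexp_R (x : R) : Cexp x = exp x.
Proof. unfold Cexp. simpl. rewrite cos_0, sin_0. apply injective_projections; simpl; ring. Qed.

Lemma Cexp_0 : Cexp 0 = 1.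
Proof. rewrite Cexp_R, exp_0. reflexivity. Qed.

Lemma Cmod_Cexp (u : C) : Cmod (Cexp u) = exp (Re u).
Proof.
  unfold Cexp. rewrite Cmod_mult, Cmod_R, (Rabs_pos_eq (exp _)) by (left; apply exp_pos).
  unfold Cmod; simpl. replace (cos (Im u) * (cos (Im u) * 1) + sin (Im u) * (sin (Im u) * 1))%R with 1%R.
  - rewrite sqrt_1. ring.
  - pose proof (sin2_cos2 (Im u)). unfold Rsqr in H. lra.
Qed.

Lemma Cexp_neq_0 (u : C) : Cexp u <> 0.
Proof. apply Cmod_gt_0. rewrite Cmod_Cexp. apply exp_pos. Qed.

Lemma Cexp_piI (x : R) : Cexp (RtoC x * piI) = (cos (x * PI), sin (x * PI)).
Proof.
  unfold Cexp, piI. simpl.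
  replace (x * (PI * 0 - 0 * 1) - 0 * (PI * 1 + 0 * 0))%R with 0%R by ring.
  replace (x * (PI * 1 + 0 * 0) + 0 * (PI * 0 - 0 * 1))%R with (x * PI)%R by ring.
  rewrite exp_0. apply injective_projections; simpl; ring.
Qed.

Lemma Cexp_turns (a : nat) : Cexp (RtoC (2 * INR a) * piI) = 1.
Proof.
  rewrite Cexp_piI.
  replace (2 * INR a * PI)%R with (0 + 2 * INR a * PI)%R by ring.
  rewrite cos_period, sin_period, cos_0, sin_0. reflexivity.
Qed.

Lemma is_derive_0_eps (f : R -> R) (l : R) : is_derive f 0 l ->
  forall eps : posreal, exists d : posreal, forall h, Rabs h < d ->
    Rabs (f h - f 0 - h * l) <= eps * Rabs h.
Proof.
  intros H eps. apply RD_RtoC in H.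
  destruct (proj1 (RD_eps _ _ _) H eps) as [d Hd]. exists d. intros h Hh.
  specialize (Hd h Hh). cbv beta in Hd. rewrite Rplus_0_l, <- RtoC_mult, <- !RtoC_minus, Cmod_R in Hd. exact Hd.
Qed.

(** Additivity reduces to the origin, where the first order expansions of [exp], [cos]
    and [sin] suffice. *)
Lemma CD_Cexp (u : C) : CD Cexp u (Cexp u).
Proof.
  assert (H0 : CD Cexp (RtoC 0) (RtoC 1)).
  { apply CD_eps. intros eps.
    assert (He : 0 < Rmin (eps / 6) 1) by (apply Rmin_case; pose proof (cond_pos eps); lra).
    pose (e := mkposreal _ He).
    assert (De : is_derive exp 0 1) by (evar_last; [apply is_derive_exp|apply exp_0]).
    assert (Dc : is_derive cos 0 0) by (evar_last; [apply is_derive_cos|rewrite sin_0; ring]).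
    assert (Ds : is_derive sin 0 1) by (evar_last; [apply is_derive_sin|apply cos_0]).
    destruct (is_derive_0_eps _ _ De e) as [d1 H1].
    destruct (is_derive_0_eps _ _ Dc e) as [d2 H2].
    destruct (is_derive_0_eps _ _ Ds e) as [d3 H3].
    assert (Hd : 0 < Rmin (Rmin d1 d2) (Rmin d3 (Rmin (eps / 12) (1 / 4)))).
    { pose proof (cond_pos eps). repeat apply Rmin_case; try apply cond_pos; lra. }
    exists (mkposreal _ Hd). intros h Hh. simpl in Hh.
    destruct h as [x y].
    pose proof (re_le_Cmod (x, y)) as Hx. pose proof (im_le_Cmod (x, y)) as Hy. simpl in Hx, Hy.
    set (m := Cmod (x, y)) in *.
    assert (Hm : m < d1 /\ m < d2 /\ m < d3 /\ m < eps / 12 /\ m < 1 / 4).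
    { repeat split; eapply Rlt_le_trans; try exact Hh.
      - eapply Rle_trans; [apply Rmin_l|apply Rmin_l].
      - eapply Rle_trans; [apply Rmin_l|apply Rmin_r].
      - eapply Rle_trans; [apply Rmin_r|apply Rmin_l].
      - eapply Rle_trans; [apply Rmin_r|]. eapply Rle_trans; [apply Rmin_r|apply Rmin_l].
      - eapply Rle_trans; [apply Rmin_r|]. eapply Rle_trans; [apply Rmin_r|apply Rmin_r]. }
    destruct Hm as (M1 & M2 & M3 & M4 & M5).
    specialize (H1 x ltac:(lra)). specialize (H2 y ltac:(lra)). specialize (H3 y ltac:(lra)).
    rewrite exp_0 in H1. rewrite cos_0 in H2. rewrite sin_0 in H3. simpl in H1, H2, H3.
    assert (E1 : Rmin (eps / 6) 1 <= eps / 6) by apply Rmin_l.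
    assert (E2 : Rmin (eps / 6) 1 <= 1) by apply Rmin_r.
    set (e' := Rmin (eps / 6) 1) in *.
    pose proof (Rabs_pos x) as Px. pose proof (Rabs_pos y) as Py.
    assert (Hex : Rabs (exp x - 1) <= 2 * m).
    { replace (exp x - 1)%R with ((exp x - 1 - x * 1) + x)%R by ring.
      eapply Rle_trans; [apply Rabs_triang|]. nra. }
    assert (Hex2 : 0 < exp x <= 2).
    { split; [apply exp_pos|]. apply Rabs_def2 in Hex as [? ?] || apply Rabs_le_between in Hex. lra. }
    replace (Cexp (0 + (x, y)) - Cexp 0 - (x, y) * 1)
      with ((exp x - 1 - x * 1 + exp x * (cos y - 1 - y * 0))%R,
            (exp x * (sin y - 0 - y * 1) + y * (exp x - 1))%R).
    2: { rewrite Cexp_0, Cplus_0_l. unfold Cexp. simpl. apply injective_projections; simpl; ring. }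
    eapply Rle_trans; [apply Cmod_le_Re_Im|]. simpl Re; simpl Im.
    eapply Rle_trans; [apply Rplus_le_compat; apply Rabs_triang|].
    rewrite !Rabs_mult, (Rabs_pos_eq (exp x)) by lra.
    assert (B1 : Rabs (exp x - 1 - x * 1) <= eps / 6 * m) by nra.
    assert (B2 : exp x * Rabs (cos y - 1 - y * 0) <= 2 * (eps / 6 * m)).
    { apply Rmult_le_compat; try lra; try apply Rabs_pos. nra. }
    assert (B3 : exp x * Rabs (sin y - 0 - y * 1) <= 2 * (eps / 6 * m)).
    { apply Rmult_le_compat; try lra; try apply Rabs_pos. nra. }
    assert (B4 : Rabs y * Rabs (exp x - 1) <= m * (2 * (eps / 12))).
    { apply Rmult_le_compat; try lra; try apply Rabs_pos. }
    lra. }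
  apply CD_eps. intros eps.
  assert (He : 0 < eps / exp (Re u)) by (apply Rdiv_lt_0_compat; [apply cond_pos|apply exp_pos]).
  destruct (proj1 (CD_eps _ _ _) H0 (mkposreal _ He)) as [d Hd].
  exists d. intros h Hh. specialize (Hd h Hh). simpl in Hd.
  rewrite Cplus_0_l, Cexp_0 in Hd.
  replace (Cexp (u + h) - Cexp u - h * Cexp u) with (Cexp u * (Cexp h - 1 - h * 1)).
  2: { rewrite Cexp_plus. ring. }
  rewrite Cmod_mult, Cmod_Cexp.
  apply Rle_trans with (exp (Re u) * (eps / exp (Re u) * Cmod h))%R.
  - apply Rmult_le_compat_l; [left; apply exp_pos|exact Hd].
  - right. field. apply Rgt_not_eq, exp_pos.
Qed.

(** * Entire power series with real coefficients *)

Lemma ex_series_Rscal (l : R) (a : nat -> R) :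
  ex_series a -> ex_series (fun n => (l * a n)%R).
Proof. apply (ex_series_scal_l (V := R_NormedModule) l). Qed.

Definition CSer (c : nat -> C) : C :=
  (Series (fun n => Re (c n)), Series (fun n => Im (c n))).

Definition dominated (c : nat -> C) (g : nat -> R) : Prop :=
  ex_series g /\ forall n, Cmod (c n) <= g n.

Lemma dominated_Re (c : nat -> C) (g : nat -> R) : dominated c g ->
  ex_series (fun n => Rabs (Re (c n))).
Proof.
  intros [Hg H]. apply (ex_series_le (V := R_CompleteNormedModule) _ g); [|exact Hg].
  intros n. unfold norm; simpl. unfold abs; simpl. rewrite Rabs_Rabsolu.
  eapply Rle_trans; [apply re_le_Cmod|apply H].
Qed.

Lemma dominated_Im (c : nat -> C) (g : nat -> R) : dominated c g ->
  ex_series (fun n => Rabs (Im (c n))).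
Proof.
  intros [Hg H]. apply (ex_series_le (V := R_CompleteNormedModule) _ g); [|exact Hg].
  intros n. unfold norm; simpl. unfold abs; simpl. rewrite Rabs_Rabsolu.
  eapply Rle_trans; [apply im_le_Cmod|apply H].
Qed.

Lemma CSer_ext (c d : nat -> C) : (forall n, c n = d n) -> CSer c = CSer d.
Proof.
  intros H. unfold CSer. f_equal; apply Series_ext; intros n; now rewrite H.
Qed.

Lemma CSer_plus (c d : nat -> C) (g h : nat -> R) : dominated c g -> dominated d h ->
  CSer (fun n => c n + d n) = CSer c + CSer d.
Proof.
  intros Hc Hd. unfold CSer.
  apply injective_projections; simpl; (rewrite <- Series_plus; [reflexivity| |]);
    apply ex_series_Rabs;
    (eapply dominated_Re; eassumption) || (eapply dominated_Im; eassumption).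
Qed.

Lemma CSer_scal (l : C) (c : nat -> C) (g : nat -> R) : dominated c g ->
  CSer (fun n => l * c n) = l * CSer c.
Proof.
  intros Hc. unfold CSer. destruct l as [a b].
  pose proof (ex_series_Rabs _ (dominated_Re _ _ Hc)) as HR.
  pose proof (ex_series_Rabs _ (dominated_Im _ _ Hc)) as HI.
  apply injective_projections; simpl; rewrite <- !Series_scal_l.
  - rewrite <- Series_minus; [reflexivity| |]; now apply ex_series_Rscal.
  - rewrite <- Series_plus; [reflexivity| |]; now apply ex_series_Rscal.
Qed.

Lemma CSer_incr_1 (c : nat -> C) (g : nat -> R) : dominated c g ->
  CSer c = c 0%nat + CSer (fun n => c (S n)).
Proof.
  intros Hc. unfold CSer.
  pose proof (ex_series_Rabs _ (dominated_Re _ _ Hc)) as HR.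
  pose proof (ex_series_Rabs _ (dominated_Im _ _ Hc)) as HI.
  apply injective_projections; simpl; now rewrite Series_incr_1.
Qed.

Lemma CSer_bound (c : nat -> C) (g : nat -> R) : dominated c g ->
  Cmod (CSer c) <= 2 * Series g.
Proof.
  intros Hc. eapply Rle_trans; [apply Cmod_le_Re_Im|].
  replace (2 * Series g)%R with (Series g + Series g)%R by ring.
  apply Rplus_le_compat; simpl;
    (eapply Rle_trans; [apply Series_Rabs; (eapply dominated_Re; eassumption) || (eapply dominated_Im; eassumption)|]);
    destruct Hc as [Hg H]; apply Series_le; try exact Hg; intros n; (split; [apply Rabs_pos|]);
    (eapply Rle_trans; [|apply H]).
  - apply re_le_Cmod.
  - apply im_le_Cmod.
Qed.

Lemma dominated_plus (c d : nat -> C) (g h : nat -> R) : dominated c g -> dominated d h ->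
  dominated (fun n => c n + d n) (fun n => (g n + h n)%R).
Proof.
  intros [Hg Hc] [Hh Hd]. split; [now apply (ex_series_plus (V := R_NormedModule))|].
  intros n. eapply Rle_trans; [apply Cmod_triangle|]. now apply Rplus_le_compat.
Qed.

Lemma dominated_scal (l : C) (c : nat -> C) (g : nat -> R) : dominated c g ->
  dominated (fun n => l * c n) (fun n => (Cmod l * g n)%R).
Proof.
  intros [Hg Hc]. split; [now apply ex_series_Rscal|].
  intros n. rewrite Cmod_mult. apply Rmult_le_compat_l; [apply Cmod_ge_0|apply Hc].
Qed.

(** Coefficients bounded like those of the exponential; this class is stable under
    formal differentiation. *)
Definition exp_type (M : R) (a : nat -> R) : Prop := forall n, Rabs (a n) <= M / INR (fact n).

Definition PSC (a : nat -> R) (z : C) : C := CSer (fun n => RtoC (a n) * z ^ n).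

Lemma is_series_exp (r : R) : is_series (fun n => (r ^ n / INR (fact n))%R) (exp r).
Proof.
  pose proof (is_exp_Reals r) as H. unfold is_pseries in H.
  eapply is_series_ext; [|exact H]. intros n. cbv beta.
  rewrite pow_n_pow. unfold scal; simpl; unfold mult; simpl. field. apply INR_fact_neq_0.
Qed.

Lemma dominated_PSC (M r : R) (a : nat -> R) (c : nat -> C) : exp_type M a ->
  (forall n, Cmod (c n) <= r ^ n) ->
  dominated (fun n => RtoC (a n) * c n) (fun n => (M * (r ^ n / INR (fact n)))%R).
Proof.
  intros Ha Hc. split.
  - apply ex_series_Rscal. eexists; apply is_series_exp.
  - intros n. rewrite Cmod_mult, Cmod_R.
    replace (M * (r ^ n / INR (fact n)))%R with (M / INR (fact n) * r ^ n)%R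
      by (field; apply INR_fact_neq_0).
    apply Rmult_le_compat; [apply Rabs_pos|apply Cmod_ge_0|apply Ha|apply Hc].
Qed.

Lemma Series_exp (M r : R) : Series (fun n => (M * (r ^ n / INR (fact n)))%R) = (M * exp r)%R.
Proof. rewrite Series_scal_l. f_equal. apply is_series_unique, is_series_exp. Qed.

Lemma dominated_PSC_z (M : R) (a : nat -> R) (z : C) : exp_type M a ->
  dominated (fun n => RtoC (a n) * z ^ n) (fun n => (M * (Cmod z ^ n / INR (fact n)))%R).
Proof. intros Ha. apply dominated_PSC; [exact Ha|]. intros n. right. apply Cmod_pow. Qed.

Lemma PSC_bound (M : R) (a : nat -> R) (z : C) : exp_type M a ->
  Cmod (PSC a z) <= 2 * (M * exp (Cmod z)).
Proof.
  intros Ha. rewrite <- Series_exp. apply CSer_bound. now apply dominated_PSC_z.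
Qed.

Lemma exp_type_pos (M : R) (a : nat -> R) : exp_type M a -> 0 <= M.
Proof.
  intros Ha. specialize (Ha 0%nat). simpl in Ha. pose proof (Rabs_pos (a 0%nat)). lra.
Qed.

Lemma exp_type_derive (M : R) (a : nat -> R) : exp_type M a -> exp_type M (PS_derive a).
Proof.
  intros Ha n. unfold PS_derive. rewrite Rabs_mult, Rabs_pos_eq by apply pos_INR.
  apply Rle_trans with (INR (S n) * (M / INR (fact (S n))))%R.
  - apply Rmult_le_compat_l; [apply pos_INR|apply Ha].
  - right. rewrite fact_simpl, mult_INR. field. split; [apply INR_fact_neq_0|apply not_0_INR; lia].
Qed.

Lemma exp_type_shift (M : R) (a : nat -> R) : exp_type M a -> exp_type M (fun n => a (S n)).
Proof.
  intros Ha n. eapply Rle_trans; [apply Ha|]. unfold Rdiv.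
  apply Rmult_le_compat_l; [now apply (exp_type_pos M a)|].
  apply Rinv_le_contravar; [apply lt_0_INR, lt_O_fact|].
  apply le_INR, fact_le. lia.
Qed.

Lemma PSC_incr (M : R) (a : nat -> R) (z : C) : exp_type M a ->
  PSC a z = a 0%nat + z * PSC (fun n => a (S n)) z.
Proof.
  intros Ha. unfold PSC.
  rewrite (CSer_incr_1 _ _ (dominated_PSC_z M a z Ha)).
  rewrite <- (CSer_scal z _ _ (dominated_PSC_z M _ z (exp_type_shift M a Ha))).
  f_equal; [rewrite Cpow_0_r; ring|]. apply CSer_ext. intros n. rewrite Cpow_S. ring.
Qed.

Definition pow_diff (z h : C) (n : nat) : C := (z + h) ^ n - z ^ n - h * (INR n * z ^ pred n).

(** Second order remainder of [z^n]; [n^2 <= 4^n] turns the bound into a geometric one. *)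
Lemma pow_diff_bound (z h : C) (r : R) (n : nat) : 1 <= r -> Cmod z + Cmod h <= r ->
  Cmod (pow_diff z h n) <= Cmod h ^ 2 * (4 * r) ^ n.
Proof.
  intros Hr Hz.
  pose proof (Cmod_ge_0 z) as Pz. pose proof (Cmod_ge_0 h) as Ph.
  assert (Hp : forall n, Cmod z ^ n <= r ^ n) by (intros; apply pow_incr; lra).
  assert (Hrp : forall n, 0 < r ^ n) by (intros; apply pow_lt; lra).
  assert (D : forall n, Cmod ((z + h) ^ n - z ^ n) <= INR n * Cmod h * r ^ n).
  { clear n. induction n as [|n IH].
    - rewrite !Cpow_0_r. replace (RtoC 1 - 1) with (RtoC 0) by ring. rewrite Cmod_0. simpl. lra.
    - rewrite !Cpow_S.
      replace ((z + h) * (z + h) ^ n - z * z ^ n)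
        with ((z + h) * ((z + h) ^ n - z ^ n) + h * z ^ n) by ring.
      eapply Rle_trans; [apply Cmod_triangle|]. rewrite !Cmod_mult, Cmod_pow, S_INR.
      pose proof (Cmod_triangle z h) as Ht.
      assert (A1 : (Cmod (z + h) * Cmod ((z + h) ^ n - z ^ n) <= r * (INR n * Cmod h * r ^ n))%R).
      { apply Rmult_le_compat; try apply Cmod_ge_0; [lra|exact IH]. }
      assert (A2 : (Cmod h * Cmod z ^ n <= Cmod h * r ^ S n)%R).
      { apply Rmult_le_compat_l; [lra|]. eapply Rle_trans; [apply Hp|]. simpl.
        pose proof (Hrp n). nra. }
      simpl in *. nra. }
  assert (E : Cmod (pow_diff z h n) <= INR n * INR n * Cmod h ^ 2 * r ^ n).
  { induction n as [|n IH]; unfold pow_diff.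
    - rewrite !Cpow_0_r. simpl (INR 0). replace (RtoC 1 - 1 - h * (0 * 1)) with (RtoC 0) by ring.
      rewrite Cmod_0. lra.
    - replace ((z + h) ^ S n - z ^ S n - h * (INR (S n) * z ^ pred (S n)))
        with (z * pow_diff z h n + h * ((z + h) ^ n - z ^ n)).
      + eapply Rle_trans; [apply Cmod_triangle|]. rewrite !Cmod_mult, S_INR.
        assert (A1 : (Cmod z * Cmod (pow_diff z h n) <= r * (INR n * INR n * Cmod h ^ 2 * r ^ n))%R).
        { apply Rmult_le_compat; try apply Cmod_ge_0; [lra|exact IH]. }
        assert (A2 : (Cmod h * Cmod ((z + h) ^ n - z ^ n) <= Cmod h * (INR n * Cmod h * r ^ S n))%R).
        { apply Rmult_le_compat_l; [lra|]. eapply Rle_trans; [apply D|].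
          apply Rmult_le_compat_l; [apply Rmult_le_pos; [apply pos_INR|lra]|].
          simpl. pose proof (Hrp n). nra. }
        assert (A3 : 0 <= Cmod h ^ 2 * r ^ S n).
        { apply Rmult_le_pos; [apply pow2_ge_0|left; apply Hrp]. }
        pose proof (pos_INR n). simpl in *. nra.
      + unfold pow_diff. rewrite S_INR, RtoC_plus, !Cpow_S. simpl pred.
        destruct n as [|n]; [simpl (INR 0); rewrite !Cpow_0_r; ring|].
        rewrite !Cpow_S. simpl pred. ring. }
  eapply Rle_trans; [exact E|].
  rewrite Rpow_mult_distr.
  replace (INR n * INR n * Cmod h ^ 2 * r ^ n)%R with (Cmod h ^ 2 * (INR n * INR n * r ^ n))%R by ring.
  apply Rmult_le_compat_l; [apply pow2_ge_0|].
  apply Rmult_le_compat_r; [left; apply Hrp|].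
  replace 4%R with (INR 4) by (simpl; ring).
  rewrite <- mult_INR, <- pow_INR. apply le_INR.
  clear. induction n as [|n IH]; [simpl; lia|].
  simpl Nat.pow. destruct n as [|[|n]]; simpl in *; lia.
Qed.

(** Termwise differentiation: the second order remainders of the monomials sum up to
    [O(|h|^2)] by [pow_diff_bound]. *)
Lemma CD_PSC (M : R) (a : nat -> R) (z : C) : exp_type M a ->
  CD (PSC a) z (PSC (PS_derive a) z).
Proof.
  intros Ha. apply CD_eps. intros eps.
  pose proof (exp_type_pos M a Ha) as HM.
  pose proof (Cmod_ge_0 z) as Pz.
  set (r := (Cmod z + 1)%R).
  set (K := (2 * (M * exp (4 * r)))%R).
  assert (HK : 0 <= K).
  { unfold K. pose proof (exp_pos (4 * r)). apply Rmult_le_pos; [lra|]. apply Rmult_le_pos; lra. }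
  assert (Hd : 0 < Rmin 1 (eps / (K + 1))).
  { apply Rmin_case; [lra|]. apply Rdiv_lt_0_compat; [apply cond_pos|lra]. }
  exists (mkposreal _ Hd). intros h Hh. simpl in Hh.
  assert (Hh1 : Cmod h < 1) by (eapply Rlt_le_trans; [exact Hh|apply Rmin_l]).
  assert (Hh2 : Cmod h < eps / (K + 1)) by (eapply Rlt_le_trans; [exact Hh|apply Rmin_r]).
  pose proof (Cmod_ge_0 h) as Ph.
  assert (Dd : dominated (fun n => RtoC (a n) * pow_diff z h n)
     (fun n => (Cmod h ^ 2 * (M * ((4 * r) ^ n / INR (fact n))))%R)).
  { split.
    - apply ex_series_Rscal, ex_series_Rscal.
      eexists; apply is_series_exp.
    - intros n. rewrite Cmod_mult, Cmod_R.
      replace (Cmod h ^ 2 * (M * ((4 * r) ^ n / INR (fact n))))%R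
        with (M / INR (fact n) * (Cmod h ^ 2 * (4 * r) ^ n))%R by (field; apply INR_fact_neq_0).
      apply Rmult_le_compat; [apply Rabs_pos|apply Cmod_ge_0|apply Ha|].
      apply pow_diff_bound; unfold r; lra. }
  assert (Dz := dominated_PSC_z M a z Ha).
  assert (Dzh := dominated_PSC_z M a (z + h) Ha).
  assert (Dp := dominated_PSC_z M _ z (exp_type_derive M a Ha)).
  assert (DP : dominated (fun n => RtoC (a n) * (INR n * z ^ pred n))
      (fun n => (M * ((2 * (1 + Cmod z)) ^ n / INR (fact n)))%R)).
  { apply dominated_PSC; [exact Ha|]. intros n. rewrite Cmod_mult, Cmod_R, Rabs_pos_eq by apply pos_INR.
    rewrite Rpow_mult_distr, Cmod_pow.
    apply Rmult_le_compat; [apply pos_INR|apply pow_le; lra| |].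
    - replace 2%R with (INR 2) by (simpl; ring). rewrite <- pow_INR. apply le_INR.
      clear. induction n as [|n IH]; [simpl; lia|]. simpl. destruct n; simpl in *; lia.
    - destruct n as [|n]; simpl pred; [simpl; lra|].
      apply Rle_trans with ((1 + Cmod z) ^ n)%R; [apply pow_incr; lra|].
      simpl. assert (0 < (1 + Cmod z) ^ n) by (apply pow_lt; lra). nra. }
  assert (E1 : CSer (fun n => RtoC (a n) * (INR n * z ^ pred n)) = PSC (PS_derive a) z).
  { rewrite (CSer_incr_1 _ _ DP). simpl (INR 0).
    replace (a 0%nat * (0 * z ^ pred 0)) with (RtoC 0) by ring. rewrite Cplus_0_l.
    apply CSer_ext. intros n. unfold PS_derive. simpl pred. rewrite RtoC_mult. ring. }
  assert (E : PSC a (z + h) - PSC a z - h * PSC (PS_derive a) z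
     = CSer (fun n => RtoC (a n) * pow_diff z h n)).
  { transitivity (PSC a (z + h) + ((- (1)) * PSC a z + (- h) * PSC (PS_derive a) z)); [ring|].
    rewrite <- E1. unfold PSC at 1 2.
    rewrite <- (CSer_scal _ _ _ Dz), <- (CSer_scal _ _ _ DP).
    rewrite <- (CSer_plus _ _ _ _ (dominated_scal (- (1)) _ _ Dz) (dominated_scal (- h) _ _ DP)).
    rewrite <- (CSer_plus _ _ _ _ Dzh (dominated_plus _ _ _ _ (dominated_scal (- (1)) _ _ Dz) (dominated_scal (- h) _ _ DP))).
    apply CSer_ext. intros n. unfold pow_diff. ring. }
  rewrite E. eapply Rle_trans; [apply (CSer_bound _ _ Dd)|].
  rewrite Series_scal_l, Series_exp.
  replace (2 * (Cmod h ^ 2 * (M * exp (4 * r))))%R with (K * Cmod h * Cmod h)%R by (unfold K; ring).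
  apply Rmult_le_compat_r; [exact Ph|].
  apply Rle_trans with ((K + 1) * Cmod h)%R; [nra|].
  apply Rle_trans with ((K + 1) * (eps / (K + 1)))%R; [apply Rmult_le_compat_l; lra|].
  right. field. lra.
Qed.

Lemma PSC_real (a : nat -> R) (x : R) : PSC a x = PSeries a x.
Proof.
  unfold PSC, CSer, PSeries. apply injective_projections; simpl.
  - apply Series_ext. intros n. rewrite <- RtoC_pow. simpl. ring.
  - rewrite (Series_ext _ (fun _ => (0 * 0)%R)).
    + rewrite Series_scal_l. ring.
    + intros n. rewrite <- RtoC_pow. simpl. ring.
Qed.

(** * Flat sections of [Kl_2] *)

Definition coefI (n : nat) : R := / INR (fact n) ^ 2.

(** Coefficients of the companion solution [u S - T] of the Bessel equation in the
    variable [u], [z = e^u]: the recurrence is [z T'' + T' = T + 2 S']. *)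
Fixpoint coefT (n : nat) : R :=
  match n with
  | 0%nat => 0
  | S m => ((coefT m + 2 * (INR (S m) * coefI (S m))) / INR (S m) ^ 2)%R
  end.

Lemma coefI_bound (n : nat) : (0 < coefI n <= 1 / INR (fact n))%R.
Proof.
  unfold coefI.
  assert (H : 1 <= INR (fact n)) by (change 1%R with (INR 1); apply le_INR, lt_O_fact).
  split.
  - apply Rinv_0_lt_compat, pow_lt. lra.
  - unfold Rdiv. rewrite Rmult_1_l. apply Rinv_le_contravar; [lra|]. simpl. nra.
Qed.

Lemma coefI_rec (n : nat) : (INR (S n) * INR (S n) * coefI (S n) = coefI n)%R.
Proof.
  unfold coefI. rewrite fact_simpl, mult_INR. field.
  split; [apply INR_fact_neq_0|apply not_0_INR; lia].
Qed.

Lemma exp_type_I : exp_type 1 coefI.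
Proof.
  intros n. pose proof (coefI_bound n). rewrite Rabs_pos_eq; lra.
Qed.

Lemma coefT_rec (n : nat) :
  (INR (S n) * INR (S n) * coefT (S n) = coefT n + 2 * (INR (S n) * coefI (S n)))%R.
Proof. cbn [coefT]. field. apply not_0_INR; lia. Qed.

Lemma exp_type_T : exp_type 2 coefT.
Proof.
  assert (H : forall n, (0 <= coefT n <= 2 / INR (fact n))%R).
  { induction n as [|n IH].
    - simpl. lra.
    - pose proof (coefT_rec n) as Hr.
      assert (Hn : 1 <= INR (S n)) by (change 1%R with (INR 1); apply le_INR; lia).
      assert (Hf : 0 < / INR (fact n)) by (apply Rinv_0_lt_compat, lt_0_INR, lt_O_fact).
      assert (HI : (0 <= INR (S n) * coefI (S n) <= / INR (fact n))%R).
      { pose proof (coefI_bound (S n)) as [A B]. split; [nra|].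
        apply Rle_trans with (INR (S n) * (1 / INR (fact (S n))))%R; [nra|].
        right. rewrite fact_simpl, mult_INR. field.
        split; [apply INR_fact_neq_0|apply not_0_INR; lia]. }
      assert (HE : (2 / INR (fact (S n)) = 2 * / INR (fact n) / INR (S n))%R).
      { rewrite fact_simpl, mult_INR. field. split; [apply INR_fact_neq_0|apply not_0_INR; lia]. }
      rewrite HE. unfold Rdiv in IH.
      set (f := (/ INR (fact n))%R) in *. set (m := INR (S n)) in *.
      assert (Hm0 : (coefT n + 2 * (m * coefI (S n)) <= 2 * f * m)%R).
      { destruct n as [|n].
        - simpl coefT in *. nra.
        - assert (2 <= m) by (unfold m; change 2%R with (INR 2); apply le_INR; lia). nra. }
      split.
      + apply Rmult_le_reg_l with (m * m)%R; [nra|]. rewrite Hr. nra.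
      + apply Rmult_le_reg_l with (m * m)%R; [nra|]. rewrite Hr.
        replace (m * m * (2 * f / m))%R with (2 * f * m)%R by (field; lra). exact Hm0. }
  intros n. rewrite Rabs_pos_eq; apply H.
Qed.

Lemma dominated_theta (M : R) (d : nat -> R) (z : C) : exp_type M d ->
  dominated (fun n => RtoC (d n) * (INR n * z ^ n))
    (fun n => (M * ((2 * Cmod z) ^ n / INR (fact n)))%R).
Proof.
  intros Hd. apply dominated_PSC; [exact Hd|]. intros n.
  rewrite Cmod_mult, Cmod_R, Rabs_pos_eq, Cmod_pow, Rpow_mult_distr by apply pos_INR.
  apply Rmult_le_compat_r; [apply pow_le, Cmod_ge_0|].
  change 2%R with (INR 2). rewrite <- pow_INR. apply le_INR.
  clear. induction n as [|n IH]; [simpl; lia|]. simpl. destruct n; simpl in *; lia.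
Qed.

Lemma PSC_theta (M : R) (d : nat -> R) (z : C) : exp_type M d ->
  z * PSC (PS_derive d) z = CSer (fun n => RtoC (d n) * (INR n * z ^ n)).
Proof.
  intros Hd. rewrite (CSer_incr_1 _ _ (dominated_theta M d z Hd)). simpl (INR 0).
  replace (RtoC (d 0%nat) * (0 * z ^ 0)) with (RtoC 0) by ring. rewrite Cplus_0_l.
  unfold PSC. rewrite <- (CSer_scal z _ _ (dominated_PSC_z M _ z (exp_type_derive M d Hd))).
  apply CSer_ext. intros n. unfold PS_derive. rewrite Cpow_S, RtoC_mult. ring.
Qed.

Lemma coefI_ode (z : C) :
  PSC (PS_derive coefI) z + z * PSC (PS_derive (PS_derive coefI)) z = PSC coefI z.
Proof.
  pose proof (exp_type_derive _ _ exp_type_I) as H1.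
  rewrite (PSC_theta _ _ z H1). unfold PSC at 1.
  rewrite <- (CSer_plus _ _ _ _ (dominated_PSC_z _ _ z H1) (dominated_theta _ _ z H1)).
  apply CSer_ext. intros n. unfold PS_derive. rewrite <- (coefI_rec n).
  rewrite !RtoC_mult, S_INR, RtoC_plus. ring.
Qed.

Lemma coefT_ode (z : C) :
  PSC (PS_derive coefT) z + z * PSC (PS_derive (PS_derive coefT)) z
  = PSC coefT z + 2 * PSC (PS_derive coefI) z.
Proof.
  pose proof (exp_type_derive _ _ exp_type_I) as H1.
  pose proof (exp_type_derive _ _ exp_type_T) as H2.
  rewrite (PSC_theta _ _ z H2). unfold PSC.
  rewrite <- (CSer_scal 2 _ _ (dominated_PSC_z _ _ z H1)).
  rewrite <- (CSer_plus _ _ _ _ (dominated_PSC_z _ _ z H2) (dominated_theta _ _ z H2)).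
  rewrite <- (CSer_plus _ _ _ _ (dominated_PSC_z _ _ z exp_type_T)
                 (dominated_scal 2 _ _ (dominated_PSC_z _ _ z H1))).
  apply CSer_ext. intros n. unfold PS_derive.
  transitivity (RtoC (INR (S n) * INR (S n) * coefT (S n))%R * z ^ n).
  - rewrite !RtoC_mult, S_INR, RtoC_plus. ring.
  - rewrite coefT_rec. rewrite RtoC_plus, !RtoC_mult. ring.
Qed.

(** Two solutions of [y'' = e^u y]: [solI] is [I_0(t)], and [solL] grows like [u] as
    [z -> 0]. *)
Definition solI (u : C) : C := PSC coefI (Cexp u).
Definition solI' (u : C) : C := Cexp u * PSC (PS_derive coefI) (Cexp u).
Definition solL (u : C) : C := u * solI u - PSC coefT (Cexp u).
Definition solL' (u : C) : C :=
  solI u + u * solI' u - Cexp u * PSC (PS_derive coefT) (Cexp u).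

Lemma CD_PSC_exp (M : R) (a : nat -> R) (u : C) : exp_type M a ->
  CD (fun u => PSC a (Cexp u)) u (Cexp u * PSC (PS_derive a) (Cexp u)).
Proof. intros Ha. apply (CD_comp (PSC a) Cexp); [now apply (CD_PSC M)|apply CD_Cexp]. Qed.

Lemma CD_value (f : C -> C) (u l l' : C) : l = l' -> CD f u l -> CD f u l'.
Proof. now intros ->. Qed.

Lemma CD_solI (u : C) : CD solI u (solI' u).
Proof. exact (CD_PSC_exp _ _ u exp_type_I). Qed.

Lemma CD_solI' (u : C) : CD solI' u (Cexp u * solI u).
Proof.
  eapply CD_value; [|exact (CD_mult _ _ _ _ _ (CD_Cexp u)
     (CD_PSC_exp _ _ u (exp_type_derive _ _ exp_type_I)))].
  unfold solI. rewrite <- (coefI_ode (Cexp u)). ring.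
Qed.

Lemma CD_solL (u : C) : CD solL u (solL' u).
Proof.
  eapply CD_value; [|exact (CD_minus _ _ _ _ _ (CD_mult _ _ _ _ _ (CD_id u) (CD_solI u))
     (CD_PSC_exp _ _ u exp_type_T))].
  unfold solL'. ring.
Qed.

Lemma CD_solL' (u : C) : CD solL' u (Cexp u * solL u).
Proof.
  eapply CD_value; [|exact (CD_minus _ _ _ _ _
     (CD_plus _ _ _ _ _ (CD_solI u) (CD_mult _ _ _ _ _ (CD_id u) (CD_solI' u)))
     (CD_mult _ _ _ _ _ (CD_Cexp u) (CD_PSC_exp _ _ u (exp_type_derive _ _ exp_type_T))))].
  unfold solL. transitivity (2 * solI' u + u * (Cexp u * solI u) -
    Cexp u * (PSC (PS_derive coefT) (Cexp u) + Cexp u * PSC (PS_derive (PS_derive coefT)) (Cexp u))).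
  - ring.
  - rewrite coefT_ode. unfold solI'. ring.
Qed.

Lemma PSC_0 (M : R) (a : nat -> R) : exp_type M a -> PSC a 0 = a 0%nat.
Proof. intros Ha. rewrite (PSC_incr M a 0 Ha). ring. Qed.

(** The Wronskian is entire in [z] with zero derivative, and equals [1] at [z = 0]. *)
Lemma wronskian (u : C) : solI u * solL' u - solI' u * solL u = 1.
Proof.
  pose proof exp_type_I as HI. pose proof exp_type_T as HT.
  pose proof (exp_type_derive _ _ HI) as HI1. pose proof (exp_type_derive _ _ HT) as HT1.
  pose (D := fun z => PSC coefI z * PSC coefI z
    + z * (PSC (PS_derive coefI) z * PSC coefT z - PSC (PS_derive coefT) z * PSC coefI z)).
  assert (HD : forall z, CD D z (RtoC 0)).
  { intros z.
    pose proof (CD_PSC _ _ z HI) as A. pose proof (CD_PSC _ _ z HT) as B.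
    pose proof (CD_PSC _ _ z HI1) as A1. pose proof (CD_PSC _ _ z HT1) as B1.
    eapply CD_value; [|exact (CD_plus _ _ _ _ _ (CD_mult _ _ _ _ _ A A)
      (CD_mult _ _ _ _ _ (CD_id z) (CD_minus _ _ _ _ _ (CD_mult _ _ _ _ _ A1 B) (CD_mult _ _ _ _ _ B1 A))))].
    pose proof (coefI_ode z) as OI. pose proof (coefT_ode z) as OT.
    cbv beta. set (S0 := PSC coefI z) in *. set (S1 := PSC (PS_derive coefI) z) in *.
    set (S2 := PSC (PS_derive (PS_derive coefI)) z) in *.
    set (T0 := PSC coefT z) in *. set (T1 := PSC (PS_derive coefT) z) in *.
    set (T2 := PSC (PS_derive (PS_derive coefT)) z) in *.
    transitivity (2 * S0 * S1 + T0 * (S1 + z * S2) - S0 * (T1 + z * T2)); [ring|].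
    rewrite OI, OT. ring. }
  transitivity (D (Cexp u)); [unfold D, solL, solL', solI, solI'; ring|].
  rewrite (CD_zero_const D HD (Cexp u) 0).
  unfold D. rewrite (PSC_0 _ _ HI). unfold coefI at 1 2. simpl.
  replace (/ (1 * (1 * 1)))%R with 1%R by field. ring.
Qed.

Lemma RD_unique (f : R -> C) (s : R) (l m : C) : RD f s l -> RD f s m -> l = m.
Proof.
  intros A B. apply injective_projections.
  - pose proof (is_derive_unique _ _ _ (RD_Re _ _ _ A)) as HA.
    pose proof (is_derive_unique _ _ _ (RD_Re _ _ _ B)) as HB.
    unfold Re in HA, HB. congruence.
  - pose proof (is_derive_unique _ _ _ (RD_Im _ _ _ A)) as HA.
    pose proof (is_derive_unique _ _ _ (RD_Im _ _ _ B)) as HB.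
    unfold Im in HA, HB. congruence.
Qed.

Lemma CD_RD_real (f : C -> C) (x : R) (l : C) : CD f (RtoC x) l -> RD (fun r => f (RtoC r)) x l.
Proof.
  intros H. assert (Hr : RD RtoC x (RtoC 1)) by (apply RD_RtoC, (is_derive_id (K := R_AbsRing) x)).
  pose proof (CD_RD_comp f RtoC x l (RtoC 1) H Hr) as A. rewrite Cmult_1_l in A. exact A.
Qed.

Lemma flat_snd (E : C -> C * C) (u : C) : is_flat_Kl2 E ->
  CD (fun u => snd (E u)) u (- fst (E u)).
Proof. intros H. apply H. Qed.

Lemma flat_fst (E : C -> C * C) (u : C) : is_flat_Kl2 E ->
  CD (fun u => fst (E u)) u (- (Cexp u * snd (E u))).
Proof. intros H. apply H. Qed.

(** The Wronskians of [E] against the two basic solutions are constants [a] and [b];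
    as these solutions have Wronskian [1] themselves, [E] can be solved for. *)
Lemma flat_expansion (E : C -> C * C) (x0 : C) : is_flat_Kl2 E -> forall u,
  let a := fst (E x0) * solI x0 + snd (E x0) * solI' x0 in
  let b := fst (E x0) * solL x0 + snd (E x0) * solL' x0 in
  E u = (a * solL' u - b * solI' u, b * solI u - a * solL u).
Proof.
  intros H u a b.
  assert (HA : forall v, CD (fun v => fst (E v) * solI v + snd (E v) * solI' v) v (RtoC 0)).
  { intros v. eapply CD_value; [|exact (CD_plus _ _ _ _ _
      (CD_mult _ _ _ _ _ (flat_fst E v H) (CD_solI v)) (CD_mult _ _ _ _ _ (flat_snd E v H) (CD_solI' v)))].
    cbv beta. ring. }
  assert (HB : forall v, CD (fun v => fst (E v) * solL v + snd (E v) * solL' v) v (RtoC 0)).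
  { intros v. eapply CD_value; [|exact (CD_plus _ _ _ _ _
      (CD_mult _ _ _ _ _ (flat_fst E v H) (CD_solL v)) (CD_mult _ _ _ _ _ (flat_snd E v H) (CD_solL' v)))].
    cbv beta. ring. }
  pose proof (CD_zero_const _ HA x0 u) as EA. cbv beta in EA. fold a in EA.
  pose proof (CD_zero_const _ HB x0 u) as EB. cbv beta in EB. fold b in EB.
  rewrite EA, EB. pose proof (wronskian u) as W.
  destruct (E u) as [p q]; simpl. f_equal.
  - transitivity (p * (solI u * solL' u - solI' u * solL u)); [rewrite W; ring|ring].
  - transitivity (q * (solI u * solL' u - solI' u * solL u)); [rewrite W; ring|ring].
Qed.

Lemma sqrt_exp (x : R) : sqrt (exp x) = exp (x / 2).
Proof.
  replace (exp x) with (exp (x / 2) * exp (x / 2))%R.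
  - apply sqrt_square. left; apply exp_pos.
  - rewrite <- exp_plus. f_equal. field.
Qed.

Lemma solI_real (x : R) : solI x = I0 (2 * sqrt (exp x)).
Proof.
  unfold solI, I0. rewrite Cexp_R, PSC_real. f_equal. rewrite sqrt_exp.
  f_equal. replace (2 * exp (x / 2) / 2)%R with (exp (x / 2)) by field.
  simpl. rewrite Rmult_1_r, <- exp_plus. f_equal. field.
Qed.

(** On the real axis [E0] is parallel to [(solI', - solI)], so its Wronskian against
    that solution vanishes, there and hence everywhere. *)
Lemma E0_explicit (E0 : C -> C * C) (u : C) : is_continuation e0_real E0 ->
  E0 u = (solI' u, - solI u).
Proof.
  intros [Hf Hr].
  assert (Hq : forall x : R, snd (E0 x) = - solI x).
  { intros x. rewrite Hr, solI_real. simpl. now rewrite RtoC_opp. }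
  assert (Hp : fst (E0 0) = solI' 0).
  { pose proof (CD_RD_real _ 0%R _ (flat_snd E0 0 Hf)) as A.
    pose proof (CD_RD_real _ 0%R _ (CD_opp _ _ _ (CD_solI 0))) as B.
    assert (A' : RD (fun r => - solI (RtoC r)) 0 (- fst (E0 0))).
    { eapply is_derive_ext; [|exact A]. intros x. apply Hq. }
    pose proof (RD_unique _ _ _ _ A' B) as HH.
    replace (fst (E0 0)) with (- - fst (E0 0)) by ring. rewrite HH. ring. }
  rewrite (flat_expansion E0 0 Hf u). rewrite Hp, Hq.
  pose proof (wronskian 0) as W.
  f_equal.
  - transitivity ((solI 0 * solL' 0 - solI' 0 * solL 0) * solI' u); [ring|rewrite W; ring].
  - transitivity (- ((solI 0 * solL' 0 - solI' 0 * solL 0) * solI u)); [ring|rewrite W; ring].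
Qed.

Lemma piI_neq_0 : piI <> 0.
Proof.
  unfold piI. apply Cmult_neq_0.
  - intros H. apply (f_equal Re) in H. simpl in H. pose proof PI_RGT_0. lra.
  - intros H. apply (f_equal Im) in H. simpl in H. lra.
Qed.

Lemma x_exp_bound (x : R) : x <= 0 -> Rabs x * exp x <= 1.
Proof.
  intros Hx. rewrite Rabs_left1 by exact Hx.
  pose proof (exp_ineq1_le (- x)) as H. rewrite exp_Ropp in H.
  pose proof (exp_pos x) as P.
  apply Rmult_le_reg_r with (/ exp x)%R; [now apply Rinv_0_lt_compat|].
  rewrite Rmult_assoc, Rinv_r by lra. lra.
Qed.

Lemma coef_bounded_linear (a : C) (M : R) :
  (forall x : R, x <= 0 -> Cmod (a * x) <= M) -> a = 0.
Proof.
  intros H. apply Cmod_eq_0. destruct (Cmod_ge_0 a) as [Hp|He]; [|now symmetry].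
  exfalso. assert (HM : 0 <= M).
  { pose proof (H 0%R (Rle_refl _)). pose proof (Cmod_ge_0 (a * 0%R)). lra. }
  assert (Hd : 0 <= (M + 1) / Cmod a) by (apply Rdiv_le_0_compat; lra).
  specialize (H (- ((M + 1) / Cmod a))%R ltac:(lra)).
  rewrite Cmod_mult, Cmod_R, Rabs_Ropp, Rabs_pos_eq in H by exact Hd.
  replace (Cmod a * ((M + 1) / Cmod a))%R with (M + 1)%R in H by (field; lra). lra.
Qed.

(** The logarithmic growth of [K0] at [0] fixes the coefficient of the logarithmic
    solution; that of [solI] is left undetermined. *)
Lemma E1_explicit (E1 : C -> C * C) : is_continuation e1_real E1 ->
  exists c, forall u, E1 u =
    (/ (2 * piI) * solL' u - c * solI' u, c * solI u - / (2 * piI) * solL u).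
Proof.
  intros [Hf Hr].
  pose proof (flat_expansion E1 0 Hf) as HE. cbv zeta in HE.
  set (a := fst (E1 0) * solI 0 + snd (E1 0) * solI' 0) in HE.
  set (b := fst (E1 0) * solL 0 + snd (E1 0) * solL' 0) in HE.
  exists b. intros u. rewrite HE. replace (/ (2 * piI)) with a; [reflexivity|].
  pose proof piI_neq_0 as Hpi.
  assert (H2 : (2 : C) <> 0) by (intros H; apply (f_equal Re) in H; simpl in H; lra).
  (* As [x -> -oo], [K0] is [- x / 2] and [solL] is [x], both up to a bounded error. *)
  assert (Hk : 2 * piI * a - 1 = 0).
  { set (A := (2 * exp 1)%R). set (B := (4 * exp 1)%R).
    apply coef_bounded_linear with
      (2 + 2 * Cmod piI * (Cmod b * A) + 2 * Cmod piI * Cmod a * (A + B))%R.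
    intros x Hx.
    assert (He : 0 < exp x <= 1).
    { split; [apply exp_pos|]. rewrite <- exp_0. now apply exp_le_exp. }
    assert (Hee : exp (exp x) <= exp 1) by now apply exp_le_exp.
    assert (BI : Cmod (solI x) <= A).
    { unfold solI. rewrite Cexp_R. eapply Rle_trans; [apply (PSC_bound _ _ _ exp_type_I)|].
      rewrite Cmod_R, Rabs_pos_eq by lra. unfold A. lra. }
    assert (BI1 : Cmod (solI x - 1) <= exp x * A).
    { unfold solI. rewrite (PSC_incr _ _ _ exp_type_I). rewrite Cexp_R.
      replace (coefI 0 + exp x * PSC (fun n => coefI (S n)) (exp x) - 1)
        with (exp x * PSC (fun n => coefI (S n)) (exp x)).
      - rewrite Cmod_mult, Cmod_R, Rabs_pos_eq by lra. apply Rmult_le_compat_l; [lra|].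
        eapply Rle_trans; [apply (PSC_bound _ _ _ (exp_type_shift _ _ exp_type_I))|].
        rewrite Cmod_R, Rabs_pos_eq by lra. unfold A. lra.
      - unfold coefI at 2. simpl. replace (/ (1 * (1 * 1)))%R with 1%R by field. ring. }
    assert (BT : Cmod (PSC coefT (Cexp x)) <= B).
    { rewrite Cexp_R. eapply Rle_trans; [apply (PSC_bound _ _ _ exp_type_T)|].
      rewrite Cmod_R, Rabs_pos_eq by lra. unfold B. lra. }
    (* Flatness alone leaves the coefficients free; [K0] enters through the real axis. *)
    assert (HK : Cdiv (RtoC (K0 (2 * sqrt (exp x)))) piI = b * solI x - a * solL x).
    { change (snd (e1_real (2 * sqrt (exp x))) = b * solI x - a * solL x). rewrite <- Hr, HE. reflexivity. }
    assert (HL : Rabs (K0 (2 * sqrt (exp x)) - (- x / 2)) <= 1).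
    { replace (- x / 2)%R with (ln (2 / (2 * sqrt (exp x)))).
      - apply K0_log. rewrite sqrt_exp. split; [pose proof (exp_pos (x / 2)); lra|].
        assert (exp (x / 2) <= 1); [|lra]. rewrite <- exp_0.
        apply exp_le_exp. lra.
      - rewrite sqrt_exp. replace (2 / (2 * exp (x / 2)))%R with (exp (- x / 2)); [apply ln_exp|].
        replace (- x / 2)%R with (- (x / 2))%R by field. rewrite exp_Ropp. field.
        apply Rgt_not_eq, exp_pos. }
    set (k := K0 (2 * sqrt (exp x))) in *.
    assert (Hk : RtoC k = piI * (b * solI x - a * solL x)) by (rewrite <- HK; field; exact Hpi).
    replace ((2 * piI * a - 1) * x)
      with (- 2 * RtoC (k - - x / 2) + (2 * piI * (b * solI x)
         + 2 * piI * a * (PSC coefT (Cexp x) - x * (solI x - 1)))).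
    2: { rewrite RtoC_minus, Hk. unfold solL.
         replace (RtoC (- x / 2)) with (- RtoC x / 2).
         - field.
         - rewrite RtoC_div, RtoC_opp; [reflexivity|lra]. }
    rewrite Rplus_assoc.
    eapply Rle_trans; [apply Cmod_triangle|]. apply Rplus_le_compat.
    { rewrite Cmod_mult, !Cmod_R, (Rabs_left1 (-2)) by lra. lra. }
    pose proof (Cmod_ge_0 piI) as P1. pose proof (Cmod_ge_0 a) as P2. pose proof (Cmod_ge_0 b) as P3.
    eapply Rle_trans; [apply Cmod_triangle|]. apply Rplus_le_compat.
    - rewrite !Cmod_mult, Cmod_R, (Rabs_pos_eq 2) by lra.
      apply Rmult_le_compat_l; [lra|]. apply Rmult_le_compat_l; [lra|exact BI].
    - rewrite !Cmod_mult, Cmod_R, (Rabs_pos_eq 2) by lra.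
      apply Rmult_le_compat_l; [apply Rmult_le_pos; lra|].
      eapply Rle_trans; [apply Cmod_triangle|]. rewrite Cmod_opp, Cmod_mult, Cmod_R, Rplus_comm.
      apply Rplus_le_compat; [|exact BT].
      pose proof (x_exp_bound x Hx) as Hxe. pose proof (Rabs_pos x).
      assert (HA : 0 < A) by (unfold A; pose proof (exp_pos 1); lra).
      apply Rle_trans with (Rabs x * (exp x * A))%R; [apply Rmult_le_compat_l; lra|]. nra. }
  assert (Ha : a = (2 * piI * a - 1 + 1) / (2 * piI)) by (field; repeat split; assumption).
  rewrite Ha, Hk. field. exact Hpi.
Qed.

(** ** Monodromy and Wronskian *)

(** Increment of [u] after [a] turns around [0]. *)
Definition turns (a : nat) : C := RtoC (2 * INR a) * piI.

Lemma Cexp_add_turns (u : C) (a : nat) : Cexp (u + turns a) = Cexp u.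
Proof. rewrite Cexp_plus. unfold turns. rewrite Cexp_turns. ring. Qed.

Lemma E0_turns (E0 : C -> C * C) (u : C) (a : nat) : is_continuation e0_real E0 ->
  E0 (u + turns a) = E0 u.
Proof.
  intros H. rewrite !(E0_explicit _ _ H). unfold solI, solI'. now rewrite Cexp_add_turns.
Qed.

(** The factor [u] in [solL] increases by [2 pi i a], and [solL] enters [E1] with
    coefficient [1 / (2 pi i)]. *)
Lemma E1_turns (E0 E1 : C -> C * C) (u : C) (a : nat) :
  is_continuation e0_real E0 -> is_continuation e1_real E1 ->
  E1 (u + turns a) = vcomb 1 (E1 u) (INR a) (E0 u).
Proof.
  intros H0 H1. destruct (E1_explicit _ H1) as [c Hc].
  rewrite !Hc, (E0_explicit _ _ H0). unfold vcomb, solL, solL', solI', solI; cbn [fst snd].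
  rewrite Cexp_add_turns. unfold turns. rewrite RtoC_mult.
  pose proof piI_neq_0. f_equal; field; assumption.
Qed.

Lemma det_E0_E1 (E0 E1 : C -> C * C) (u : C) :
  is_continuation e0_real E0 -> is_continuation e1_real E1 ->
  fst (E0 u) * snd (E1 u) - fst (E1 u) * snd (E0 u) = / (2 * piI).
Proof.
  intros H0 H1. destruct (E1_explicit _ H1) as [c Hc].
  rewrite Hc, (E0_explicit _ _ H0). cbn [fst snd]. pose proof piI_neq_0.
  transitivity (/ (2 * piI) * (solI u * solL' u - solI' u * solL u)).
  - field; assumption.
  - rewrite wronskian. ring.
Qed.

(** ** Growth at [0] and at infinity *)

Lemma E_growth_0 (E0 E1 : C -> C * C) :
  is_continuation e0_real E0 -> is_continuation e1_real E1 ->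
  exists M, 0 <= M /\ forall u, Re u <= 0 ->
    Cmod (snd (E0 u)) <= M /\ Cmod (snd (E1 u)) <= M * (1 + Cmod u).
Proof.
  intros H0 H1. destruct (E1_explicit _ H1) as [c Hc].
  set (A := (2 * exp 1)%R). set (B := (4 * exp 1)%R). set (D := Cmod (/ (2 * piI))).
  assert (HA : 0 < A) by (unfold A; pose proof (exp_pos 1); lra).
  assert (HB : 0 < B) by (unfold B; pose proof (exp_pos 1); lra).
  assert (HD : 0 <= D) by apply Cmod_ge_0. pose proof (Cmod_ge_0 c) as Hc0.
  exists (A + Cmod c * A + D * (A + B))%R. split; [nra|].
  intros u Hu.
  assert (Hm : 0 <= Cmod (Cexp u) <= 1).
  { split; [apply Cmod_ge_0|]. rewrite Cmod_Cexp, <- exp_0. now apply exp_le_exp. }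
  assert (Hee : exp (Cmod (Cexp u)) <= exp 1) by now apply exp_le_exp.
  assert (BI : Cmod (solI u) <= A).
  { unfold solI. eapply Rle_trans; [apply (PSC_bound _ _ _ exp_type_I)|]. unfold A. lra. }
  assert (BT : Cmod (PSC coefT (Cexp u)) <= B).
  { eapply Rle_trans; [apply (PSC_bound _ _ _ exp_type_T)|]. unfold B. lra. }
  rewrite (E0_explicit _ _ H0), Hc. cbn [fst snd]. rewrite Cmod_opp.
  pose proof (Cmod_ge_0 u) as Hu0. split; [nra|].
  unfold solL.
  assert (X1 : Cmod (c * solI u) <= Cmod c * A).
  { rewrite Cmod_mult. now apply Rmult_le_compat_l. }
  assert (X2 : Cmod (/ (2 * piI) * (u * solI u - PSC coefT (Cexp u))) <= D * (Cmod u * A + B)).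
  { rewrite Cmod_mult. apply Rmult_le_compat_l; [exact HD|].
    eapply Rle_trans; [apply Cmod_triangle|]. rewrite Cmod_opp, Cmod_mult.
    apply Rplus_le_compat; [now apply Rmult_le_compat_l|exact BT]. }
  eapply Rle_trans; [apply Cmod_triangle|]. rewrite Cmod_opp.
  assert (0 <= Cmod c * A) by nra. assert (0 <= D * A) by nra. assert (0 <= D * B) by nra.
  nra.
Qed.

Lemma nonincreasing_of_derive (f f' : R -> R) (x : R) :
  (forall y, 0 <= y -> is_derive f y (f' y)) -> (forall y, 0 <= y -> f' y <= 0) ->
  0 <= x -> f x <= f 0.
Proof.
  intros Hd Hs Hx.
  destruct (MVT_gen f 0 x f') as (c & Hc & He).
  - intros y Hy. rewrite Rmin_left, Rmax_right in Hy by exact Hx. apply Hd. lra.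
  - intros y Hy. rewrite Rmin_left, Rmax_right in Hy by exact Hx.
    apply continuity_pt_filterlim.
    apply (ex_derive_continuous (K := R_AbsRing) (V := R_NormedModule)).
    eexists. apply Hd. lra.
  - rewrite Rmin_left, Rmax_right in Hc by exact Hx.
    specialize (Hs c ltac:(lra)). nra.
Qed.

Lemma antitone_derive_le_0 (f : R -> R) (x l : R) :
  (forall y, x <= y -> f y <= f x) -> is_derive f x l -> l <= 0.
Proof.
  intros Hf Hd. apply Rnot_lt_le. intros Hl.
  apply RD_RtoC in Hd. assert (He : 0 < l / 2) by lra.
  destruct (proj1 (RD_eps _ _ _) Hd (mkposreal _ He)) as [d H].
  pose proof (cond_pos d) as Hd0.
  specialize (H (d / 2)%R). rewrite (Rabs_pos_eq (d / 2)) in H by lra. specialize (H ltac:(lra)).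
  rewrite <- RtoC_minus, <- RtoC_mult, <- RtoC_minus, Cmod_R in H. simpl in H.
  apply Rabs_le_between in H. specialize (Hf (x + d / 2)%R ltac:(lra)). nra.
Qed.

Lemma exp_half_ge_1 (x : R) : 0 <= x -> 1 <= exp (x / 2).
Proof. intros Hx. rewrite <- exp_0. apply exp_le_exp. lra. Qed.

Lemma exp_half_inv (x : R) : (exp (- x / 2) * exp (x / 2) = 1)%R.
Proof. rewrite <- exp_plus. replace (- x / 2 + x / 2)%R with 0%R by field. apply exp_0. Qed.

Lemma exp_half_sqr (x : R) : (exp (x / 2) * exp (x / 2) = exp x)%R.
Proof. rewrite <- exp_plus. f_equal. field. Qed.

(** For the growing solution [q] of [q'' = e^x q], [(q + e^(-x/2) q') exp (- 2 e^(x/2))]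
    is nonincreasing; in the variable [t = 2 e^(x/2)] it is [(q + dq/dt) e^(-t)]. *)
Lemma growing_bound (q m : R -> R) :
  (forall x, is_derive q x (m x)) -> (forall x, is_derive m x (exp x * q x)%R) ->
  (forall x, 0 <= q x) -> (forall x, 0 <= m x) -> forall x, 0 <= x ->
  q x + exp (- x / 2) * m x <= (q 0%R + m 0%R) * exp (2 * exp (x / 2)).
Proof.
  intros Hq Hm Pq Pm x Hx.
  pose (f := fun x => ((q x + exp (- x / 2) * m x) * exp (- 2 * exp (x / 2)))%R).
  assert (H : f x <= f 0).
  { apply (nonincreasing_of_derive f (fun x => - exp (- x / 2) / 2 * m x * exp (- 2 * exp (x / 2)))%R); [| |exact Hx].
    - intros y Hy. unfold f.
      assert (Eq : Derive (fun x => q x) y = m y) by (apply is_derive_unique, Hq).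
      assert (Em : Derive (fun x => m x) y = (exp y * q y)%R) by (apply is_derive_unique, Hm).
      auto_derive; [repeat split; eexists; apply Hq || apply Hm|].
      rewrite Eq, Em.
      rewrite <- (exp_half_sqr y). pose proof (exp_half_inv y) as E1.
      unfold Rdiv in *.
      set (a := exp (- y * / 2)) in *. set (b := exp (y * / 2)) in *. set (e := exp (- 2 * b)).
      transitivity ((m y - a / 2 * m y + (a * b) * b * q y - b * q y - (a * b) * m y) * e)%R.
      + field.
      + rewrite E1. field.
    - intros y Hy. assert (0 <= exp (- y / 2) / 2 * m y * exp (- 2 * exp (y / 2))).
      { apply Rmult_le_pos; [|left; apply exp_pos]. apply Rmult_le_pos; [|apply Pm].
        pose proof (exp_pos (- y / 2)). lra. }
      unfold Rdiv in *. lra. }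
  unfold f in H.
  replace (- 0 / 2)%R with 0%R in H by field. replace (0 / 2)%R with 0%R in H by field.
  rewrite exp_0, Rmult_1_r in H.
  assert (H2 : exp (-2) <= 1) by (rewrite <- exp_0; apply exp_le_exp; lra).
  assert (H3 : (exp (- 2 * exp (x / 2)) * exp (2 * exp (x / 2)) = 1)%R).
  { rewrite <- exp_plus. replace (- 2 * exp (x / 2) + 2 * exp (x / 2))%R with 0%R by ring. apply exp_0. }
  pose proof (exp_pos (2 * exp (x / 2))) as P.
  pose proof (Pq 0%R). pose proof (Pm 0%R). pose proof (exp_pos (-2)).
  apply Rle_trans with ((q x + exp (- x / 2) * m x) * exp (- 2 * exp (x / 2)) * exp (2 * exp (x / 2)))%R.
  - rewrite Rmult_assoc, H3. lra.
  - apply Rmult_le_compat_r; [lra|]. eapply Rle_trans; [exact H|]. nra.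
Qed.

(** Likewise [(q - dq/dt) e^t] is nonincreasing for the decaying solution. *)
Lemma decaying_bound (q m : R -> R) :
  (forall x, is_derive q x (m x)) -> (forall x, is_derive m x (exp x * q x)%R) ->
  (forall x, 0 <= q x) -> (forall x, m x <= 0) -> forall x, 0 <= x ->
  q x - exp (- x / 2) * m x <= (q 0%R - m 0%R) * exp 2 * exp (- 2 * exp (x / 2)).
Proof.
  intros Hq Hm Pq Pm x Hx.
  pose (f := fun x => ((q x - exp (- x / 2) * m x) * exp (2 * exp (x / 2)))%R).
  assert (H : f x <= f 0).
  { apply (nonincreasing_of_derive f (fun x => exp (- x / 2) / 2 * m x * exp (2 * exp (x / 2)))%R); [| |exact Hx].
    - intros y Hy. unfold f.
      assert (Eq : Derive (fun x => q x) y = m y) by (apply is_derive_unique, Hq).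
      assert (Em : Derive (fun x => m x) y = (exp y * q y)%R) by (apply is_derive_unique, Hm).
      auto_derive; [repeat split; eexists; apply Hq || apply Hm|].
      rewrite Eq, Em.
      rewrite <- (exp_half_sqr y). pose proof (exp_half_inv y) as E1.
      unfold Rdiv in *.
      set (a := exp (- y * / 2)) in *. set (b := exp (y * / 2)) in *. set (e := exp (2 * b)).
      transitivity ((m y + a / 2 * m y - (a * b) * b * q y + b * q y - (a * b) * m y) * e)%R.
      + field.
      + rewrite E1. field.
    - intros y Hy. assert (0 <= exp (- y / 2) / 2 * (- m y) * exp (2 * exp (y / 2))).
      { apply Rmult_le_pos; [|left; apply exp_pos]. apply Rmult_le_pos; [|specialize (Pm y); lra].
        pose proof (exp_pos (- y / 2)). lra. }
      unfold Rdiv in *. lra. }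
  unfold f in H.
  replace (- 0 / 2)%R with 0%R in H by field. replace (0 / 2)%R with 0%R in H by field.
  rewrite exp_0, Rmult_1_r in H.
  assert (H3 : (exp (2 * exp (x / 2)) * exp (- 2 * exp (x / 2)) = 1)%R).
  { rewrite <- exp_plus. replace (2 * exp (x / 2) + - 2 * exp (x / 2))%R with 0%R by ring. apply exp_0. }
  pose proof (exp_pos (- 2 * exp (x / 2))) as P.
  apply Rle_trans with ((q x - exp (- x / 2) * m x) * exp (2 * exp (x / 2)) * exp (- 2 * exp (x / 2)))%R.
  - rewrite Rmult_assoc, H3. lra.
  - apply Rmult_le_compat_r; [lra|]. lra.
Qed.

Lemma PSeries_nonneg (M x : R) (a : nat -> R) : exp_type M a ->
  (forall n, 0 <= a n)%R -> 0 <= x -> 0 <= PSeries a x.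
Proof.
  intros Ha Hp Hx. unfold PSeries.
  replace 0%R with (Series (fun _ => 0 * 0)%R) by (rewrite Series_scal_l; ring).
  apply Series_le.
  - intros n. rewrite Rmult_0_l. split; [lra|]. apply Rmult_le_pos; [apply Hp|now apply pow_le].
  - pose proof (dominated_Re _ _ (dominated_PSC_z M a x Ha)) as H.
    eapply ex_series_ext; [|exact H]. intros n. cbv beta.
    rewrite <- RtoC_pow, <- RtoC_mult. simpl.
    apply Rabs_pos_eq. apply Rmult_le_pos; [apply Hp|now apply pow_le].
Qed.

Lemma E0_growth_infty (E0 : C -> C * C) : is_continuation e0_real E0 ->
  exists M, 0 <= M /\ forall x : R, 0 <= x ->
    Cmod (fst (E0 x)) <= M * exp (x / 2) * exp (2 * exp (x / 2)) /\
    Cmod (snd (E0 x)) <= M * exp (x / 2) * exp (2 * exp (x / 2)).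
Proof.
  intros H0. destruct (H0) as [Hf _].
  pose (q := fun x : R => PSeries coefI (exp x)).
  pose (m := fun x : R => (exp x * PSeries (PS_derive coefI) (exp x))%R).
  assert (Eq : forall x : R, snd (E0 x) = RtoC (- q x)).
  { intros x. rewrite (E0_explicit _ _ H0). simpl. unfold solI, q. rewrite Cexp_R, PSC_real. now rewrite RtoC_opp. }
  assert (Em : forall x : R, fst (E0 x) = RtoC (m x)).
  { intros x. rewrite (E0_explicit _ _ H0). simpl. unfold solI', m. rewrite Cexp_R, PSC_real. now rewrite RtoC_mult. }
  assert (Pc : forall n, 0 <= coefI n) by (intros n; pose proof (coefI_bound n); lra).
  assert (Pq : forall x, 0 <= q x).
  { intros x. apply (PSeries_nonneg 1); [exact exp_type_I|exact Pc|left; apply exp_pos]. }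
  assert (Pm : forall x, 0 <= m x).
  { intros x. apply Rmult_le_pos; [left; apply exp_pos|].
    apply (PSeries_nonneg 1); [apply exp_type_derive, exp_type_I| |left; apply exp_pos].
    intros n. apply Rmult_le_pos; [apply pos_INR|apply Pc]. }
  assert (Dq : forall x, is_derive q x (m x)).
  { intros x. pose proof (RD_Re _ _ _ (CD_RD_real _ x _ (CD_opp _ _ _ (flat_snd E0 x Hf)))) as A.
    eapply is_derive_ext; [|evar_last; [exact A|]].
    - intros r. cbv beta. rewrite Eq. simpl. ring.
    - rewrite Em. simpl. ring. }
  assert (Dm : forall x, is_derive m x (exp x * q x)%R).
  { intros x. pose proof (RD_Re _ _ _ (CD_RD_real _ x _ (flat_fst E0 x Hf))) as A.
    eapply is_derive_ext; [|evar_last; [exact A|]].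
    - intros r. cbv beta. rewrite Em. reflexivity.
    - rewrite Eq, Cexp_R. simpl. ring. }
  exists (q 0%R + m 0%R)%R. split; [apply Rplus_le_le_0_compat; auto|].
  intros x Hx. rewrite Em, Eq, RtoC_opp, Cmod_opp, !Cmod_R, !Rabs_pos_eq by auto.
  pose proof (growing_bound q m Dq Dm Pq Pm x Hx) as B.
  set (e := exp (2 * exp (x / 2))) in *.
  assert (He : 0 < e) by apply exp_pos.
  pose proof (exp_half_ge_1 x Hx) as H1.
  pose proof (exp_half_inv x) as E1.
  pose proof (Pq x) as Qx. pose proof (Pm x) as Mx. pose proof (exp_pos (- x / 2)) as P2.
  set (b := exp (x / 2)) in *. set (a := exp (- x / 2)) in *.
  assert (K0 : 0 <= (q 0%R + m 0%R) * e).
  { apply Rmult_le_pos; [apply Rplus_le_le_0_compat; auto|lra]. }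
  split.
  - apply Rle_trans with (b * (a * m x))%R; [right; rewrite <- Rmult_assoc, (Rmult_comm b a), E1; ring|].
    replace ((q 0%R + m 0%R) * b * e)%R with (b * ((q 0%R + m 0%R) * e))%R by ring.
    apply Rmult_le_compat_l; lra.
  - assert (0 <= a * m x) by (apply Rmult_le_pos; lra).
    replace ((q 0%R + m 0%R) * b * e)%R with (b * ((q 0%R + m 0%R) * e))%R by ring. nra.
Qed.

Lemma E1_growth_infty (E1 : C -> C * C) : is_continuation e1_real E1 ->
  exists M, 0 <= M /\ forall x : R, 0 <= x ->
    Cmod (fst (E1 x)) <= M * exp (x / 2) * exp (- 2 * exp (x / 2)) /\
    Cmod (snd (E1 x)) <= M * exp (x / 2) * exp (- 2 * exp (x / 2)).
Proof.
  intros [Hf Hr]. pose proof piI_neq_0 as Hpi.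
  pose (t := fun x : R => (2 * sqrt (exp x))%R).
  pose (q := fun x : R => K0 (t x)).
  pose (m := fun x : R => (t x / 2 * Derive K0 (t x))%R).
  assert (Ht : forall x, t x = (2 * exp (x / 2))%R) by (intros x; unfold t; now rewrite sqrt_exp).
  assert (Eq : forall x : R, piI * snd (E1 x) = RtoC (q x)).
  { intros x. rewrite Hr. unfold e1_real. cbn [fst snd]. unfold q, t. field. exact Hpi. }
  assert (Em : forall x : R, piI * fst (E1 x) = RtoC (- m x)).
  { intros x. rewrite Hr. unfold e1_real. cbn [fst snd]. unfold m, t. field. exact Hpi. }
  assert (Dq : forall x, is_derive q x (m x)).
  { intros x. pose proof (RD_Re _ _ _ (CD_RD_real _ x _ (CD_scal piI _ _ _ (flat_snd E1 x Hf)))) as A.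
    eapply is_derive_ext; [|evar_last; [exact A|]].
    - intros r. cbv beta. rewrite Eq. reflexivity.
    - replace (piI * - fst (E1 x)) with (- (piI * fst (E1 x))) by ring. rewrite Em. simpl. ring. }
  assert (Dm : forall x, is_derive m x (exp x * q x)%R).
  { intros x. pose proof (RD_Re _ _ _ (CD_RD_real _ x _ (CD_scal (- piI) _ _ _ (flat_fst E1 x Hf)))) as A.
    eapply is_derive_ext; [|evar_last; [exact A|]].
    - intros r. cbv beta. replace (- piI * fst (E1 r)) with (- (piI * fst (E1 r))) by ring. rewrite Em. simpl. ring.
    - replace (- piI * - (Cexp x * snd (E1 x))) with (Cexp x * (piI * snd (E1 x))) by ring.
      rewrite Eq, Cexp_R. simpl. ring. }
  assert (Tp : forall x, 0 < t x) by (intros x; rewrite Ht; pose proof (exp_pos (x / 2)); lra).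
  assert (Pq : forall x, 0 <= q x) by (intros x; apply K0_pos, Tp).
  assert (Pm : forall x, m x <= 0).
  { intros x. apply (antitone_derive_le_0 q x); [|apply Dq].
    intros y Hy. apply K0_antitone; [apply Tp|]. rewrite !Ht.
    apply Rmult_le_compat_l; [lra|]. apply exp_le_exp. lra. }
  set (N := ((q 0%R - m 0%R) * exp 2)%R).
  assert (HN : 0 <= N).
  { apply Rmult_le_pos; [|left; apply exp_pos]. pose proof (Pq 0%R). pose proof (Pm 0%R). lra. }
  assert (Hi : 0 < / Cmod piI) by (apply Rinv_0_lt_compat; now apply Cmod_gt_0).
  exists (N * / Cmod piI)%R. split; [apply Rmult_le_pos; lra|].
  intros x Hx.
  assert (Cq : Cmod (snd (E1 x)) = (q x * / Cmod piI)%R).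
  { replace (snd (E1 x)) with (RtoC (q x) / piI) by (rewrite <- Eq; field; exact Hpi).
    rewrite Cmod_div, Cmod_R, Rabs_pos_eq by auto. reflexivity. }
  assert (Cm : Cmod (fst (E1 x)) = (- m x * / Cmod piI)%R).
  { replace (fst (E1 x)) with (RtoC (- m x) / piI) by (rewrite <- Em; field; exact Hpi).
    rewrite Cmod_div, Cmod_R, Rabs_pos_eq by (auto; specialize (Pm x); lra). reflexivity. }
  rewrite Cq, Cm.
  pose proof (decaying_bound q m Dq Dm Pq Pm x Hx) as B. fold N in B.
  set (e := exp (- 2 * exp (x / 2))) in *.
  assert (He : 0 < e) by apply exp_pos.
  pose proof (exp_half_ge_1 x Hx) as H1.
  pose proof (exp_half_inv x) as E1'.
  pose proof (Pq x) as Qx. pose proof (Pm x) as Mx. pose proof (exp_pos (- x / 2)) as P2.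
  set (b := exp (x / 2)) in *. set (a := exp (- x / 2)) in *.
  assert (HNe : 0 <= N * e) by (apply Rmult_le_pos; lra).
  assert (Ham : 0 <= a * - m x) by (apply Rmult_le_pos; lra).
  replace (N * / Cmod piI * b * e)%R with (b * (N * e) * / Cmod piI)%R by ring.
  split; apply Rmult_le_compat_r; try lra.
  - apply Rle_trans with (b * (a * - m x))%R; [right; rewrite <- Rmult_assoc, (Rmult_comm b a), E1'; ring|].
    apply Rmult_le_compat_l; lra.
  - nra.
Qed.

(** * Shifting contours *)

Local Notation CInt := (RInt (V := C_R_CompleteNormedModule)).
Local Notation is_CInt := (is_RInt (V := C_R_NormedModule)).

(** Two derivatives are asked for because differentiation under the integral sign needs
    the first one to be continuous. *)
Definition entire2 (f : C -> C) : Prop :=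
  exists f' f'' : C -> C, forall u, CD f u (f' u) /\ CD f' u (f'' u).

Lemma entire2_const (c : C) : entire2 (fun _ => c).
Proof.
  exists (fun _ => RtoC 0), (fun _ => RtoC 0). intros u; split; apply CD_const.
Qed.

Lemma entire2_mult (f g : C -> C) : entire2 f -> entire2 g -> entire2 (fun u => f u * g u).
Proof.
  intros (f1 & f2 & Hf) (g1 & g2 & Hg).
  exists (fun u => f1 u * g u + f u * g1 u),
    (fun u => (f2 u * g u + f1 u * g1 u) + (f1 u * g1 u + f u * g2 u)).
  intros u. destruct (Hf u) as [A1 A2], (Hg u) as [B1 B2]. split.
  - now apply CD_mult.
  - apply (CD_plus (fun u => f1 u * g u)); now apply CD_mult.
Qed.

Lemma entire2_pow (f : C -> C) (n : nat) : entire2 f -> entire2 (fun u => f u ^ n).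
Proof.
  intros Hf. induction n as [|n IH].
  - exact (entire2_const 1).
  - exact (entire2_mult _ _ Hf IH).
Qed.

Lemma entire2_scal (c : C) (f : C -> C) : entire2 f -> entire2 (fun u => c * f u).
Proof. apply (entire2_mult (fun _ => c)), entire2_const. Qed.

Lemma entire2_Cexp : entire2 Cexp.
Proof. exists Cexp, Cexp. intros u; split; apply CD_Cexp. Qed.

Lemma entire2_flat_snd (E : C -> C * C) : is_flat_Kl2 E -> entire2 (fun u => snd (E u)).
Proof.
  intros H. exists (fun u => - fst (E u)), (fun u => - - (Cexp u * snd (E u))).
  intros u. split; [now apply flat_snd|]. apply CD_opp. now apply flat_fst.
Qed.

Lemma RD_continuous (f : R -> C) (s : R) (l : C) : RD f s l ->
  continuous (U := C_R_NormedModule) f s.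
Proof.
  intros H. apply (ex_derive_continuous (K := R_AbsRing) (V := C_R_NormedModule)). now exists l.
Qed.

Lemma RD_entire_line (f : C -> C) (u0 tau : C) (s : R) (l : C) : CD f (u0 + RtoC s * tau) l ->
  RD (fun r => f (u0 + RtoC r * tau)) s (tau * l).
Proof. intros H. apply (CD_RD_comp f (fun r => u0 + RtoC r * tau)); [exact H|apply RD_line]. Qed.

(** Integral of [f] over the segment from [x] to [x + tau]. *)
Definition Jint (f : C -> C) (tau : C) (x : R) : C :=
  CInt (fun s => f (RtoC x + RtoC s * tau) * tau) 0 1.

Lemma ex_CInt_line (f : C -> C) (u0 tau : C) : (forall u, exists l, CD f u l) ->
  ex_RInt (V := C_R_NormedModule) (fun s => f (u0 + RtoC s * tau) * tau) 0 1.
Proof.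
  intros H. apply (ex_RInt_continuous (V := C_R_CompleteNormedModule)). intros s _.
  destruct (H (u0 + RtoC s * tau)) as [l Hl].
  apply (RD_continuous _ _ (tau * (l * tau))).
  apply (RD_entire_line (fun u => f u * tau)).
  eapply CD_value; [|exact (CD_mult _ _ _ _ _ Hl (CD_const tau _))]. cbv beta. ring.
Qed.

Lemma CInt_Re (f : R -> C) (a b : R) : ex_RInt (V := C_R_NormedModule) f a b ->
  RInt (fun s => Re (f s)) a b = Re (CInt f a b).
Proof.
  intros [l H]. rewrite (is_RInt_unique (V := C_R_CompleteNormedModule) _ _ _ _ H).
  apply is_RInt_unique. exact (is_RInt_fct_extend_fst _ _ _ _ H).
Qed.

Lemma CInt_Im (f : R -> C) (a b : R) : ex_RInt (V := C_R_NormedModule) f a b ->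
  RInt (fun s => Im (f s)) a b = Im (CInt f a b).
Proof.
  intros [l H]. rewrite (is_RInt_unique (V := C_R_CompleteNormedModule) _ _ _ _ H).
  apply is_RInt_unique. exact (is_RInt_fct_extend_snd _ _ _ _ H).
Qed.

Lemma continuity_2d_line (f : C -> C) (proj : C -> R) (tau : C) (x y : R) :
  (forall c d, Rabs (proj c - proj d) <= Cmod (c - d)) ->
  (forall u, exists l, CD f u l) ->
  continuity_2d_pt (fun u v => proj (f (RtoC u + RtoC v * tau))) x y.
Proof.
  intros Hp H eps. destruct (H (RtoC x + RtoC y * tau)) as [l Hl].
  destruct (CD_continuous _ _ _ Hl eps) as [d Hd].
  pose proof (Cmod_ge_0 tau) as Ht.
  assert (He : 0 < d / (1 + Cmod tau)) by (apply Rdiv_lt_0_compat; [apply cond_pos|lra]).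
  exists (mkposreal _ He). intros u v Hu Hv. simpl in Hu, Hv.
  eapply Rle_lt_trans; [apply Hp|].
  replace (RtoC u + RtoC v * tau) with (RtoC x + RtoC y * tau + (RtoC (u - x) + RtoC (v - y) * tau)).
  2: { rewrite !RtoC_minus. ring. }
  apply Hd. eapply Rle_lt_trans; [apply Cmod_triangle|]. rewrite Cmod_mult, !Cmod_R.
  apply Rlt_le_trans with (d / (1 + Cmod tau) * (1 + Cmod tau))%R.
  - nra.
  - right. field. lra.
Qed.

Lemma re_lip (c d : C) : Rabs (Re c - Re d) <= Cmod (c - d).
Proof. apply (re_le_Cmod (c - d)). Qed.

Lemma im_lip (c d : C) : Rabs (Im c - Im d) <= Cmod (c - d).
Proof. apply (im_le_Cmod (c - d)). Qed.

(** Cauchy's theorem in infinitesimal form: moving the segment [x, x + tau] along the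
    real axis changes the integral only through its two end points. *)
Lemma RD_Jint (f : C -> C) (tau : C) (x : R) : entire2 f ->
  RD (Jint f tau) x (f (RtoC x + tau) - f (RtoC x)).
Proof.
  intros (f1 & f2 & Hf).
  assert (H0 : forall u, exists l, CD f u l) by (intros u; exists (f1 u); apply Hf).
  assert (H1 : forall u, exists l, CD f1 u l) by (intros u; exists (f2 u); apply Hf).
  assert (H1t : forall u, exists l, CD (fun u => f1 u * tau) u l).
  { intros u. destruct (H1 u) as [l Hl]. eexists. exact (CD_mult _ _ _ _ _ Hl (CD_const tau u)). }
  assert (Dx : forall x s : R, RD (fun r => f (RtoC r + RtoC s * tau) * tau) x
                (f1 (RtoC x + RtoC s * tau) * tau)).
  { clear x. intros x s.
    assert (E : CD (fun u => f (u + RtoC s * tau) * tau) (RtoC x) (f1 (RtoC x + RtoC s * tau) * tau)).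
    { assert (Hs : CD (fun u => u + RtoC s * tau) (RtoC x) (RtoC 1)).
      { eapply CD_value; [|exact (CD_plus _ _ _ _ _ (CD_id (RtoC x)) (CD_const (RtoC s * tau) _))]. ring. }
      pose proof (CD_comp f _ _ _ _ (proj1 (Hf _)) Hs) as A. cbv beta in A.
      eapply CD_value; [|exact (CD_mult _ _ _ _ _ A (CD_const tau _))]. cbv beta. ring. }
    exact (CD_RD_real _ _ _ E). }
  assert (HI : is_CInt (fun s => f1 (RtoC x + RtoC s * tau) * tau) 0 1 (f (RtoC x + tau) - f (RtoC x))).
  { replace (f (RtoC x + tau) - f (RtoC x)) with
      (minus (G := C_R_NormedModule) (f (RtoC x + RtoC 1 * tau)) (f (RtoC x + RtoC 0 * tau))).
    2: { unfold minus, plus, opp; simpl. replace (RtoC x + 1 * tau) with (RtoC x + tau) by ring.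
         replace (RtoC x + 0 * tau) with (RtoC x) by ring. reflexivity. }
    apply (is_RInt_derive (V := C_R_CompleteNormedModule) (fun s => f (RtoC x + RtoC s * tau))).
    - intros s _. rewrite Cmult_comm. apply RD_entire_line. apply Hf.
    - intros s _. destruct (H1t (RtoC x + RtoC s * tau)) as [l Hl].
      exact (RD_continuous _ _ _ (RD_entire_line (fun u => f1 u * tau) _ _ _ _ Hl)). }
  assert (HIe : ex_RInt (V := C_R_NormedModule) (fun s => f1 (RtoC x + RtoC s * tau) * tau) 0 1)
    by (eexists; exact HI).
  pose proof (is_RInt_unique (V := C_R_CompleteNormedModule) _ _ _ _ HI) as HU.
  assert (P : forall proj : C -> R,
    (forall c d, Rabs (proj c - proj d) <= Cmod (c - d)) ->
    (forall (g : R -> C) s l, RD g s l -> is_derive (fun r => proj (g r)) s (proj l)) ->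
    (forall g a b, ex_RInt (V := C_R_NormedModule) g a b -> RInt (fun s => proj (g s)) a b = proj (CInt g a b)) ->
    is_derive (fun r => proj (Jint f tau r)) x (proj (f (RtoC x + tau) - f (RtoC x)))).
  { intros proj Hlip HD Hint.
    assert (E : forall r s, Derive (fun u => proj (f (RtoC u + RtoC s * tau) * tau)) r
       = proj (f1 (RtoC r + RtoC s * tau) * tau)).
    { intros r s. apply is_derive_unique. apply (HD _ _ _ (Dx r s)). }
    apply is_derive_ext with (fun r => RInt (fun s => proj (f (RtoC r + RtoC s * tau) * tau)) 0 1).
    { intros r. apply (Hint (fun s => f (RtoC r + RtoC s * tau) * tau)). now apply ex_CInt_line. }
    evar_last.
    - apply (is_derive_RInt_param (fun r s => proj (f (RtoC r + RtoC s * tau) * tau))).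
      + exists (mkposreal 1 Rlt_0_1). intros r _ s _. eexists. apply (HD _ _ _ (Dx r s)).
      + intros s _. apply continuity_2d_pt_ext with (fun u v => proj (f1 (RtoC u + RtoC v * tau) * tau)).
        * intros; now rewrite E.
        * now apply (continuity_2d_line (fun u => f1 u * tau)).
      + exists (mkposreal 1 Rlt_0_1). intros r _.
        apply (ex_RInt_continuous (V := R_CompleteNormedModule)). intros s _.
        destruct (H0 (RtoC r + RtoC s * tau)) as [l Hl].
        apply (ex_derive_continuous (K := R_AbsRing) (V := R_NormedModule)).
        eexists. apply HD. apply (RD_entire_line (fun u => f u * tau)).
        exact (CD_mult _ _ _ _ _ Hl (CD_const tau _)).
    - rewrite <- HU, <- (Hint _ _ _ HIe). apply RInt_ext. intros s _. apply E. }
  apply RD_pair.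
  - apply P; [apply re_lip|apply RD_Re|apply CInt_Re].
  - apply P; [apply im_lip|apply RD_Im|apply CInt_Im].
Qed.

(** With [K = n^n]: [y / n <= exp (y / n)], raised to the power [n]. *)
Lemma pow_le_exp (n : nat) : exists K, 0 < K /\ forall y, 0 <= y -> (y ^ n <= K * exp y)%R.
Proof.
  destruct n as [|n].
  - exists 1%R. split; [lra|]. intros y Hy. simpl. pose proof (exp_ineq1_le y). lra.
  - set (N := INR (S n)). assert (HN : 0 < N) by (apply lt_0_INR; lia).
    exists (N ^ S n)%R. split; [now apply pow_lt|]. intros y Hy.
    assert (E : forall m, exp (INR m * (y / N)) = (exp (y / N) ^ m)%R).
    { induction m as [|m IH]; [simpl; rewrite Rmult_0_l; apply exp_0|].
      rewrite S_INR, Rmult_plus_distr_r, exp_plus, IH, Rmult_1_l. simpl. ring. }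
    replace (exp y) with (exp (y / N) ^ S n)%R.
    2: { rewrite <- E. f_equal. fold N. field. lra. }
    rewrite <- Rpow_mult_distr. apply pow_incr. split; [exact Hy|].
    pose proof (exp_ineq1_le (y / N)) as H.
    apply Rle_trans with (N * (y / N))%R; [right; field; lra|].
    apply Rmult_le_compat_l; lra.
Qed.

(** Half of the exponential decay absorbs the polynomial factor. *)
Lemma strip_decay (n j : nat) (Y : R) : (1 <= j)%nat -> 0 <= Y ->
  exists K, 0 <= K /\ forall u : C, Re u <= 0 -> Rabs (Im u) <= Y ->
    ((1 + Cmod u) ^ n * Cmod (Cexp u) ^ j <= K * exp (Re u / 2))%R.
Proof.
  intros Hj HY. destruct (pow_le_exp n) as (K & HK & HKb).
  exists (2 ^ n * (K * exp ((1 + Y) / 2)))%R. split.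
  { apply Rmult_le_pos; [apply pow_le; lra|]. apply Rmult_le_pos; [lra|left; apply exp_pos]. }
  intros u Hu Hi. set (x := Re u) in *.
  assert (Hc : 0 <= 1 + Cmod u <= 1 + Y + - x).
  { split; [pose proof (Cmod_ge_0 u); lra|]. pose proof (Cmod_le_Re_Im u) as H. fold x in H.
    rewrite (Rabs_left1 x) in H by lra. lra. }
  assert (A : ((1 + Cmod u) ^ n <= 2 ^ n * (K * (exp ((1 + Y) / 2) * exp (- x / 2))))%R).
  { apply Rle_trans with ((1 + Y + - x) ^ n)%R; [now apply pow_incr|].
    replace (1 + Y + - x)%R with (2 * ((1 + Y + - x) / 2))%R by field.
    rewrite Rpow_mult_distr. apply Rmult_le_compat_l; [apply pow_le; lra|].
    rewrite <- exp_plus. replace ((1 + Y) / 2 + - x / 2)%R with ((1 + Y + - x) / 2)%R by field.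
    apply HKb. lra. }
  assert (B : (Cmod (Cexp u) ^ j <= exp x)%R).
  { rewrite Cmod_Cexp. fold x. destruct j as [|j]; [lia|]. simpl.
    rewrite <- (Rmult_1_r (exp x)) at 3. apply Rmult_le_compat_l; [left; apply exp_pos|].
    rewrite <- (pow1 j). apply pow_incr. split; [left; apply exp_pos|].
    rewrite <- exp_0. now apply exp_le_exp. }
  apply Rle_trans with (2 ^ n * (K * (exp ((1 + Y) / 2) * exp (- x / 2))) * exp x)%R.
  - apply Rmult_le_compat; [apply pow_le; lra|apply pow_le, Cmod_ge_0|exact A|exact B].
  - right. rewrite <- (exp_half_sqr x).
    replace (exp (- x / 2)) with (/ exp (x / 2))%R.
    2: { rewrite <- exp_Ropp. f_equal. field. }
    field. apply Rgt_not_eq, exp_pos.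
Qed.

Lemma Jint_decay (f : C -> C) (y : R) : (forall u, exists l, CD f u l) ->
  (exists K, 0 <= K /\ forall u : C, Re u <= 0 -> Rabs (Im u) <= Rabs y ->
     Cmod (f u) <= K * exp (Re u / 2)) ->
  exists K, 0 <= K /\ forall x : R, x <= 0 -> Cmod (Jint f (RtoC y * Ci) x) <= K * exp (x / 2).
Proof.
  intros Hf (K & HK & HKb). exists (K * Rabs y)%R.
  split; [apply Rmult_le_pos; [exact HK|apply Rabs_pos]|]. intros x Hx.
  unfold Jint. rewrite <- norm_CR.
  replace (K * Rabs y * exp (x / 2))%R with (scal (1 - 0)%R (K * Rabs y * exp (x / 2))%R).
  2: { unfold scal; simpl; unfold mult; simpl. ring. }
  apply (norm_RInt_le (V := C_R_NormedModule) (fun s => f (RtoC x + RtoC s * (RtoC y * Ci)) * (RtoC y * Ci))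
     (fun _ => K * Rabs y * exp (x / 2))%R 0 1).
  - lra.
  - intros s Hs. rewrite norm_CR, !Cmod_mult, Cmod_Ci, Cmod_R, Rmult_1_r.
    assert (E1 : Re (RtoC x + RtoC s * (RtoC y * Ci)) = x) by (simpl; ring).
    assert (E2 : Im (RtoC x + RtoC s * (RtoC y * Ci)) = (s * y)%R) by (simpl; ring).
    specialize (HKb (RtoC x + RtoC s * (RtoC y * Ci))). rewrite E1, E2 in HKb.
    assert (Hb : Rabs (s * y) <= Rabs y).
    { rewrite Rabs_mult, (Rabs_pos_eq s) by lra. pose proof (Rabs_pos y). nra. }
    specialize (HKb Hx Hb). pose proof (Rabs_pos y). nra.
  - apply (RInt_correct (V := C_R_CompleteNormedModule)). now apply ex_CInt_line.
  - apply (is_RInt_const (V := R_NormedModule)).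
Qed.

(** * The integrand and its primitive *)

(** [v_0 = - solX E_0 + solB E_1] along the universal cover. *)
Definition solX (E1 : C -> C * C) (u : C) : C := - (2 * piI) * snd (E1 u).
Definition solB (E0 : C -> C * C) (u : C) : C := - (2 * piI) * snd (E0 u).

(** The pairing of [e_0^p e_1^q] with [z^j v_0^k] for [p + q = k]; as [dz/z = du], also the
    integrand of the periods. *)
Definition phi (E0 E1 : C -> C * C) (p q j : nat) (u : C) : C :=
  solB E0 u ^ p * solX E1 u ^ q * Cexp u ^ j.

Lemma entire2_phi (E0 E1 : C -> C * C) (p q j : nat) :
  is_continuation e0_real E0 -> is_continuation e1_real E1 -> entire2 (phi E0 E1 p q j).
Proof.
  intros [H0 _] [H1 _]. unfold phi, solX, solB.
  apply (entire2_mult (fun u => _ * _)); [apply (entire2_mult (fun u => _ ^ p))|];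
    apply entire2_pow; try apply entire2_Cexp; apply entire2_scal; now apply entire2_flat_snd.
Qed.

Lemma lpow_0 (e : C * C) (n : nat) (y : vec) : lpow e n y 0%nat = fst e ^ n * y 0%nat.
Proof.
  induction n as [|n IH]; simpl lpow; [rewrite Cpow_0_r; ring|].
  unfold lmul. rewrite IH, Cpow_S. ring.
Qed.

Lemma Cbinomial (x y : C) (a : R) (n : nat) :
  (x + RtoC a * y) ^ n
  = Csum (fun m => RtoC (INR (bin n m)) * RtoC a ^ m * (y ^ m * x ^ (n - m))) (seq 0 (S n)).
Proof.
  pose proof (lpow_binomial 1 (RtoC a) (x, RtoC 0) (y, RtoC 0) n vone 0) as H.
  rewrite lpow_0 in H. cbn [vone vcomb fst] in H.
  replace (1 * x + a * y) with (x + a * y) in H by ring.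
  rewrite Cmult_1_r in H. rewrite H. apply Csum_ext. intros m _.
  rewrite !lpow_0, Cpow_1_l. cbn [vone fst]. ring.
Qed.

Lemma phi_turns (E0 E1 : C -> C * C) (p q j a : nat) (u : C) :
  is_continuation e0_real E0 -> is_continuation e1_real E1 ->
  phi E0 E1 p q j (u + turns a)
  = solB E0 u ^ p * (solX E1 u + RtoC (INR a) * solB E0 u) ^ q * Cexp u ^ j.
Proof.
  intros H0 H1. unfold phi. rewrite Cexp_add_turns.
  unfold solB, solX. rewrite (E0_turns _ _ _ H0), (E1_turns _ _ _ _ H0 H1).
  unfold vcomb; cbn [snd]. f_equal. f_equal. f_equal. ring.
Qed.

(** By [phi_turns] this is [Cn_extracts_linear] for a binomial expansion: the circles of
    [alpha_i] turn the monodromy of [e_0^(i-1) e_1^(k-i+1)] into [e_0^i e_1^(k-i)]. *)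
Lemma phi_circles (E0 E1 : C -> C * C) (p q j : nat) (u : C) :
  is_continuation e0_real E0 -> is_continuation e1_real E1 -> (1 <= q)%nat ->
  Csum (fun a => RtoC (Cn q a) * (phi E0 E1 p q j (u + turns a) - phi E0 E1 p q j u)) (seq 1 q)
  = phi E0 E1 (S p) (q - 1) j u.
Proof.
  intros H0 H1 Hq.
  pose proof (Cn_extracts_linear q (fun m => solB E0 u ^ p * (solB E0 u ^ m * solX E1 u ^ (q - m)) * Cexp u ^ j) Hq) as H.
  cbv beta in H. etransitivity; [|etransitivity; [exact H|]].
  - apply Csum_ext. intros a _. f_equal. rewrite (phi_turns _ _ _ _ _ _ _ H0 H1). unfold phi.
    rewrite Nat.sub_0_r, Cpow_0_r, Cbinomial. f_equal; [|ring].
    rewrite Cmult_comm, Cmult_assoc, <- Csum_scal. apply Csum_ext. intros; ring.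
  - unfold phi. rewrite (Cpow_S _ p). change (solB E0 u ^ 1) with (solB E0 u * 1). ring.
Qed.

(** The circle part of [alpha_i], with the circles moved to radius [e^x]. *)
Definition primW (E0 E1 : C -> C * C) (p q j : nat) (x : R) : C :=
  Csum (fun a => RtoC (Cn q a) * Jint (phi E0 E1 p q j) (turns a) x) (seq 1 q).

Lemma RD_scal (c : C) (f : R -> C) (s : R) (l : C) : RD f s l -> RD (fun r => c * f r) s (c * l).
Proof.
  intros H. rewrite (Cmult_comm c l).
  apply (CD_RD_comp (fun z => c * z) f); [|exact H].
  eapply CD_value; [|exact (CD_scal c _ _ _ (CD_id (f s)))]. ring.
Qed.

Lemma RD_Csum {A} (f : A -> R -> C) (l : A -> C) (s : R) (L : list A) :
  (forall a, RD (f a) s (l a)) -> RD (fun r => Csum (fun a => f a r) L) s (Csum l L).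
Proof.
  intros H. induction L as [|a L IH]; simpl.
  - exact (is_derive_const (V := C_R_NormedModule) (RtoC 0) s).
  - exact (is_derive_plus (V := C_R_NormedModule) _ _ _ _ _ (H a) IH).
Qed.

Lemma RD_primW (E0 E1 : C -> C * C) (p q j : nat) (x : R) :
  is_continuation e0_real E0 -> is_continuation e1_real E1 -> (1 <= q)%nat ->
  RD (primW E0 E1 p q j) x (phi E0 E1 (S p) (q - 1) j x).
Proof.
  intros H0 H1 Hq. rewrite <- (phi_circles E0 E1 p q j x H0 H1 Hq).
  apply RD_Csum. intros a. apply RD_scal, RD_Jint. now apply entire2_phi.
Qed.

Lemma turns_Ci (a : nat) : turns a = RtoC (2 * INR a * PI) * Ci.
Proof. unfold turns, piI. rewrite (RtoC_mult _ PI). ring. Qed.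

Lemma Jint_phi_decay (E0 E1 : C -> C * C) (p q j a : nat) :
  is_continuation e0_real E0 -> is_continuation e1_real E1 -> (1 <= j)%nat ->
  exists K, 0 <= K /\ forall x : R, x <= 0 ->
    Cmod (Jint (phi E0 E1 p q j) (turns a) x) <= K * exp (x / 2).
Proof.
  intros H0 H1 Hj. rewrite turns_Ci. apply Jint_decay.
  - destruct (entire2_phi E0 E1 p q j H0 H1) as (f1 & f2 & H). intros u. exists (f1 u). apply H.
  - destruct (E_growth_0 E0 E1 H0 H1) as (M & HM & HB).
    destruct (strip_decay q j (Rabs (2 * INR a * PI)) Hj (Rabs_pos _)) as (K & HK & HKb).
    set (c := Cmod (- (2 * piI))). assert (Hc : 0 <= c) by apply Cmod_ge_0.
    exists ((c * M) ^ p * (c * M) ^ q * K)%R.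
    assert (HcM : 0 <= c * M) by nra.
    split.
    { apply Rmult_le_pos; [apply Rmult_le_pos; now apply pow_le|exact HK]. }
    intros u Hu Hi. destruct (HB u Hu) as [B0 B1]. specialize (HKb u Hu Hi).
    unfold phi, solB, solX. rewrite !Cmod_mult, !Cmod_pow, !Cmod_mult. fold c.
    assert (A0 : ((c * Cmod (snd (E0 u))) ^ p <= (c * M) ^ p)%R).
    { apply pow_incr. split; [apply Rmult_le_pos; [exact Hc|apply Cmod_ge_0]|now apply Rmult_le_compat_l]. }
    assert (A1 : ((c * Cmod (snd (E1 u))) ^ q <= (c * M) ^ q * (1 + Cmod u) ^ q)%R).
    { rewrite <- Rpow_mult_distr. apply pow_incr.
      split; [apply Rmult_le_pos; [exact Hc|apply Cmod_ge_0]|].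
      rewrite Rmult_assoc. now apply Rmult_le_compat_l. }
    assert (P0 : forall z n, 0 <= (c * Cmod z) ^ n).
    { intros z n. apply pow_le, Rmult_le_pos; [exact Hc|apply Cmod_ge_0]. }
    apply Rle_trans with ((c * M) ^ p * ((c * M) ^ q * (1 + Cmod u) ^ q) * Cmod (Cexp u) ^ j)%R.
    + apply Rmult_le_compat_r; [apply pow_le, Cmod_ge_0|].
      apply Rmult_le_compat; [apply P0|apply P0|exact A0|exact A1].
    + replace ((c * M) ^ p * (c * M) ^ q * K * exp (Re u / 2))%R
        with ((c * M) ^ p * (c * M) ^ q * (K * exp (Re u / 2)))%R by ring.
      rewrite <- (Rmult_assoc ((c * M) ^ p)), (Rmult_assoc _ _ (Cmod (Cexp u) ^ j)).
      apply Rmult_le_compat_l; [|exact HKb]. apply Rmult_le_pos; now apply pow_le.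
Qed.

Lemma primW_decay (E0 E1 : C -> C * C) (p q j : nat) :
  is_continuation e0_real E0 -> is_continuation e1_real E1 -> (1 <= j)%nat ->
  exists K, 0 <= K /\ forall x : R, x <= 0 -> Cmod (primW E0 E1 p q j x) <= K * exp (x / 2).
Proof.
  intros H0 H1 Hj. unfold primW. induction (seq 1 q) as [|a L (K & HK & HKb)].
  - exists 0%R. split; [lra|]. intros x _. simpl. rewrite Cmod_0. lra.
  - destruct (Jint_phi_decay E0 E1 p q j a H0 H1 Hj) as (K' & HK' & HKb').
    exists (Cmod (Cn q a) * K' + K)%R.
    split; [pose proof (Cmod_ge_0 (Cn q a)); nra|].
    intros x Hx. simpl. eapply Rle_trans; [apply Cmod_triangle|].
    rewrite Rmult_plus_distr_r. apply Rplus_le_compat; [|now apply HKb].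
    rewrite Cmod_mult, Rmult_assoc. apply Rmult_le_compat_l; [apply Cmod_ge_0|now apply HKb'].
Qed.

(** The constant value is squeezed to [0] at [-oo]. This is how circle integrals of single
    valued integrands, and imaginary parts, are seen to vanish. *)
Lemma RD_zero_decay (f : R -> C) (K : R) : 0 <= K -> (forall x, RD f x (RtoC 0)) ->
  (forall x, x <= 0 -> Cmod (f x) <= K * exp (x / 2)) -> forall x, f x = 0.
Proof.
  intros HK Hd Hb.
  assert (Hc : forall x y, x < y -> f x = f y).
  { intros x y Hxy. apply (eq_is_derive (V := C_R_NormedModule) f x y); [|exact Hxy].
    intros t _. exact (Hd t). }
  assert (Hc0 : forall x, f x = f 0%R).
  { intros x. destruct (Rtotal_order x 0) as [H|[->|H]]; [now apply Hc|reflexivity|symmetry; now apply Hc]. }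
  assert (H0 : Cmod (f 0%R) = 0%R).
  { destruct (Cmod_ge_0 (f 0%R)) as [Hp|He]; [|now symmetry]. exfalso.
    set (m := Cmod (f 0%R)) in *.
    set (x := (- (2 * (K / m)))%R).
    assert (Hkm : 0 <= K / m) by (apply Rdiv_le_0_compat; lra).
    assert (Hx : x <= 0) by (unfold x; lra).
    specialize (Hb x Hx). rewrite Hc0 in Hb. fold m in Hb.
    pose proof (exp_ineq1_le (- (x / 2))) as He. rewrite exp_Ropp in He.
    pose proof (exp_pos (x / 2)) as Pe.
    assert (H1 : ((1 + - (x / 2)) * exp (x / 2) <= 1)%R).
    { apply Rle_trans with (/ exp (x / 2) * exp (x / 2))%R; [apply Rmult_le_compat_r; lra|].
      right. field. lra. }
    replace (- (x / 2))%R with (K / m)%R in H1 by (unfold x; field; lra).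
    assert (H2 : (m * ((1 + K / m) * exp (x / 2)) = m * exp (x / 2) + K * exp (x / 2))%R) by (field; lra).
    nra. }
  intros x. rewrite Hc0. now apply Cmod_eq_0.
Qed.

(** Without [e_1] the integrand is single valued: the integral does not depend on the
    radius, and tends to [0] with it since [j >= 1]. *)
Lemma Jint_phi_circle (E0 E1 : C -> C * C) (p j : nat) (x : R) :
  is_continuation e0_real E0 -> is_continuation e1_real E1 -> (1 <= j)%nat ->
  Jint (phi E0 E1 p 0 j) (turns 1) x = 0.
Proof.
  intros H0 H1 Hj. destruct (Jint_phi_decay E0 E1 p 0 j 1 H0 H1 Hj) as (K & HK & HKb).
  revert x. apply (RD_zero_decay _ K HK); [|exact HKb]. intros x.
  assert (E : phi E0 E1 p 0 j (RtoC x + turns 1) - phi E0 E1 p 0 j (RtoC x) = RtoC 0).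
  { rewrite (phi_turns _ _ _ _ _ _ _ H0 H1). unfold phi. rewrite !Cpow_0_r. ring. }
  rewrite <- E. apply RD_Jint. now apply entire2_phi.
Qed.

(** ** Passage to the variable [t] *)

(** In the variable [t = 2 e^(x/2)] the function [W / kap] is a primitive of [f] that tends
    to [0] as [t -> 0] and to [V / kap] as [t -> +oo], so the improper integral converges
    to [V / kap]. *)
Lemma improper_integral_of_primitive (f : R -> R) (kap V : C) (W ph : R -> C) (K : R) :
  kap <> 0 -> 0 <= K ->
  (forall x, RD W x (ph x)) -> (forall x, exists l, RD ph x l) ->
  (forall x, ph x = kap * RtoC (f (2 * exp (x / 2))%R * exp (x / 2))%R) ->
  (forall x, x <= 0 -> Cmod (W x) <= K * exp (x / 2)) ->
  (forall eps : posreal, exists X, forall x, X < x -> Cmod (W x - V) < eps) ->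
  kap * RtoC (RInt_gen f (at_right 0) (Rbar_locally p_infty)) = V.
Proof.
  intros Hk HK HW Hph Hf Hdec HV.
  set (w := fun x => / kap * W x).
  assert (Hki : 0 < Cmod (/ kap)).
  { apply Cmod_gt_0. intros H. apply Hk.
    assert (A : kap * / kap = 1) by (now apply Cinv_r). rewrite H, Cmult_0_r in A.
    apply (f_equal Re) in A. simpl in A. lra. }
  assert (Hw : forall x, RD w x (RtoC (f (2 * exp (x / 2))%R * exp (x / 2))%R)).
  { intros x. pose proof (RD_scal (/ kap) _ _ _ (HW x)) as A. rewrite Hf, Cmult_assoc, Cinv_l, Cmult_1_l in A by exact Hk. exact A. }
  assert (Hwd : forall x, x <= 0 -> Cmod (w x) <= Cmod (/ kap) * K * exp (x / 2)).
  { intros x Hx. unfold w. rewrite Cmod_mult, Rmult_assoc. apply Rmult_le_compat_l; [lra|now apply Hdec]. }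
  (* [W / kap] is real, having a real derivative and limit [0]; hence so is [V / kap]. *)
  assert (Him : forall x, Im (w x) = 0%R).
  { assert (A : forall x, RtoC (Im (w x)) = 0).
    { apply (RD_zero_decay (fun x => RtoC (Im (w x))) (Cmod (/ kap) * K)).
      - apply Rmult_le_pos; lra.
      - intros x. apply (RD_RtoC (fun x => Im (w x)) x 0%R). exact (RD_Im _ _ _ (Hw x)).
      - intros x Hx. rewrite Cmod_R. eapply Rle_trans; [apply im_le_Cmod|now apply Hwd]. }
    intros x. specialize (A x). now apply RtoC_inj in A. }
  assert (HwV : forall eps : posreal, exists X, forall x, X < x -> Cmod (w x - / kap * V) < eps).
  { intros eps. assert (He : 0 < eps / Cmod (/ kap)) by (apply Rdiv_lt_0_compat; [apply cond_pos|exact Hki]).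
    destruct (HV (mkposreal _ He)) as [X HX]. exists X. intros x Hx. specialize (HX x Hx). simpl in HX.
    unfold w. replace (/ kap * W x - / kap * V) with (/ kap * (W x - V)) by ring. rewrite Cmod_mult.
    apply Rlt_le_trans with (Cmod (/ kap) * (eps / Cmod (/ kap)))%R; [now apply Rmult_lt_compat_l|].
    right. field. lra. }
  assert (HimV : Im (/ kap * V) = 0%R).
  { apply Rabs_eq_0. destruct (Rabs_pos (Im (/ kap * V))) as [Hp|He]; [|now symmetry]. exfalso.
    destruct (HwV (mkposreal _ Hp)) as [X HX]. specialize (HX (X + 1)%R ltac:(lra)). simpl in HX.
    pose proof (im_le_Cmod (w (X + 1)%R - / kap * V)) as A.
    assert (E : Im (w (X + 1)%R - / kap * V) = (- Im (/ kap * V))%R).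
    { change (Im (w (X + 1)%R - / kap * V)) with (Im (w (X + 1)%R) + - Im (/ kap * V))%R. rewrite Him. ring. }
    rewrite E, Rabs_Ropp in A. simpl in A, HX. lra. }
  set (l := Re (/ kap * V)).
  assert (HVl : V = kap * RtoC l).
  { replace V with (kap * (/ kap * V)) at 1 by (field; exact Hk). f_equal.
    apply injective_projections; [reflexivity|exact HimV]. }
  rewrite HVl. f_equal. f_equal.
  set (H := fun t => Re (w (2 * ln (t / 2))%R)).
  assert (Hx : forall t, 0 < t -> exp (2 * ln (t / 2) / 2) = (t / 2)%R).
  { intros t Ht. replace (2 * ln (t / 2) / 2)%R with (ln (t / 2)) by field. apply exp_ln. lra. }
  assert (HD : forall t, 0 < t -> is_derive H t (f t)).
  { intros t Ht.
    pose proof (RD_Re _ _ _ (Hw (2 * ln (t / 2))%R)) as A. simpl in A. rewrite Hx in A by exact Ht.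
    replace (2 * (t / 2))%R with t in A by field.
    assert (B : is_derive (fun t => (2 * ln (t / 2))%R) t (2 / t)%R).
    { auto_derive; [lra|field; lra]. }
    pose proof (is_derive_comp (fun x => Re (w x)) (fun t => (2 * ln (t / 2))%R) t _ _ A B) as D.
    evar_last; [exact D|].
    transitivity (2 / t * (f t * (t / 2)))%R; [reflexivity|field; lra]. }
  assert (HCe : forall y : R, 0 < y -> (Re (/ kap * ph (2 * ln (y / 2))%R) * (2 / y))%R = f y).
  { intros y Py. rewrite Hf, Hx by exact Py. replace (2 * (y / 2))%R with y by field.
    replace (/ kap * (kap * (f y * (y / 2))%R)) with (RtoC (f y * (y / 2))) by (field; exact Hk).
    simpl. field. lra. }
  assert (HC : forall t, 0 < t -> continuous f t).
  { intros t Ht.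
    apply (continuous_ext_loc _ (fun t => (Re (/ kap * ph (2 * ln (t / 2))%R) * (2 / t))%R)).
    - exists (mkposreal _ Ht). intros y Hy.
      assert (Py : 0 < y).
      { unfold ball in Hy; simpl in Hy. unfold AbsRing_ball, abs, minus, plus, opp in Hy; simpl in Hy.
        apply Rabs_def2 in Hy. lra. }
      now apply HCe.
    - apply (ex_derive_continuous (K := R_AbsRing) (V := R_NormedModule)).
      destruct (Hph (2 * ln (t / 2))%R) as [d Hd].
      apply ex_derive_mult; [|auto_derive; lra].
      apply (ex_derive_comp (fun x => Re (/ kap * ph x)) (fun t => (2 * ln (t / 2))%R)).
      + eexists. apply (RD_Re (fun x => / kap * ph x)). apply RD_scal. exact Hd.
      + auto_derive. lra. }
  assert (HI : forall a b, 0 < a -> 0 < b -> is_RInt f a b (H b - H a)%R).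
  { intros a b Ha Hb. apply (is_RInt_derive (V := R_CompleteNormedModule) H).
    - intros t Ht. apply HD. eapply Rlt_le_trans; [|apply Ht]. now apply Rmin_case.
    - intros t Ht. apply HC. eapply Rlt_le_trans; [|apply Ht]. now apply Rmin_case. }
  apply is_RInt_gen_unique. intros P [eps HP].
  assert (He : 0 < eps / 2) by (pose proof (cond_pos eps); lra).
  destruct (HwV (mkposreal _ He)) as [X HX]. simpl in HX.
  set (K' := (Cmod (/ kap) * K + 1)%R).
  assert (HK' : 0 < K') by (unfold K'; pose proof (Rmult_le_pos _ _ (Rlt_le _ _ Hki) HK); lra).
  assert (Hd : 0 < Rmin 1 (eps / (2 * K'))).
  { apply Rmin_case; [lra|]. apply Rdiv_lt_0_compat; [apply cond_pos|lra]. }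
  apply (Filter_prod _ _ _ (fun a => 0 < a /\ Rabs (H a) < eps / 2) (fun b => 0 < b /\ Rabs (H b - l) < eps / 2)).
  - exists (mkposreal _ Hd). intros a Ha Pa. split; [exact Pa|].
    unfold ball in Ha; simpl in Ha. unfold AbsRing_ball, abs, minus, plus, opp in Ha; simpl in Ha.
    rewrite Ropp_0, Rplus_0_r, Rabs_pos_eq in Ha by lra.
    pose proof (Rmin_l 1 (eps / (2 * K'))) as M1. pose proof (Rmin_r 1 (eps / (2 * K'))) as M2.
    unfold H. eapply Rle_lt_trans; [apply re_le_Cmod|].
    eapply Rle_lt_trans; [apply Hwd|].
    + assert (ln (a / 2) < 0); [|lra]. rewrite <- ln_1. apply ln_increasing; lra.
    + rewrite Hx by exact Pa.
      apply Rle_lt_trans with (K' * a)%R; [unfold K'; pose proof (Rmult_le_pos _ _ (Rlt_le _ _ Hki) HK); nra|].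
      apply Rlt_le_trans with (K' * (eps / (2 * K')))%R; [apply Rmult_lt_compat_l; lra|].
      right. field. lra.
  - exists (Rmax 0 (2 * exp (X / 2)))%R. intros b Hb.
    pose proof (Rmax_l 0 (2 * exp (X / 2))) as M1. pose proof (Rmax_r 0 (2 * exp (X / 2))) as M2.
    assert (Pb : 0 < b) by lra. split; [exact Pb|].
    assert (HXb : X < 2 * ln (b / 2)).
    { assert (X / 2 < ln (b / 2)); [|lra]. rewrite <- (ln_exp (X / 2)). apply ln_increasing; [apply exp_pos|lra]. }
    specialize (HX _ HXb). eapply Rle_lt_trans; [|exact HX]. apply (re_lip (w (2 * ln (b / 2))%R) (/ kap * V)).
  - intros a b [Pa Ha] [Pb Hb]. exists (H b - H a)%R. split; [now apply HI|].
    apply HP. unfold ball; simpl. unfold AbsRing_ball, abs, minus, plus, opp; simpl.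
    replace (H b - H a + - l)%R with ((H b - l) + - H a)%R by ring.
    eapply Rle_lt_trans; [apply Rabs_triang|]. rewrite Rabs_Ropp. lra.
Qed.

(** * The pairing against powers of [v_0] *)

Lemma Csum_single (f : nat -> C) (n p : nat) : (p < n)%nat ->
  (forall m, m <> p -> f m = 0) -> Csum f (seq 0 n) = f p.
Proof.
  intros Hp H. induction n as [|n IH]; [lia|].
  rewrite Csum_seq_r. destruct (Nat.eq_dec n p) as [->|Hn].
  - rewrite Csum_zero; [ring|]. intros m Hm. apply in_seq in Hm. apply H. lia.
  - rewrite IH, (H n) by lia. ring.
Qed.

Lemma pairing_scal (k : nat) (G : C -> nat -> nat -> C) (z : C) (x : vec) (c : C) (y : vec) :
  pairing k G z x (fun a => c * y a) = c * pairing k G z x y.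
Proof.
  unfold pairing. rewrite <- Csum_scal. apply Csum_ext; intros a _.
  rewrite <- Csum_scal. apply Csum_ext; intros; ring.
Qed.

Lemma pairing_scal_l (k : nat) (G : C -> nat -> nat -> C) (z : C) (x : vec) (c : C) (y : vec) :
  pairing k G z (fun a => c * x a) y = c * pairing k G z x y.
Proof.
  unfold pairing. rewrite <- Csum_scal. apply Csum_ext; intros a _.
  rewrite <- Csum_scal. apply Csum_ext; intros; ring.
Qed.

Lemma pairing_plus (k : nat) (G : C -> nat -> nat -> C) (z : C) (x y y' : vec) :
  pairing k G z x (fun a => y a + y' a) = pairing k G z x y + pairing k G z x y'.
Proof.
  unfold pairing. rewrite <- Csum_plus. apply Csum_ext; intros a _.
  rewrite <- Csum_plus. apply Csum_ext; intros; ring.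
Qed.

Lemma pairing_Csum {T} (k : nat) (G : C -> nat -> nat -> C) (z : C) (x : vec)
    (c : T -> C) (v : T -> vec) (l : list T) :
  pairing k G z x (fun a => Csum (fun t => c t * v t a) l)
  = Csum (fun t => c t * pairing k G z x (v t)) l.
Proof.
  induction l as [|t l IH]; simpl.
  - unfold pairing. apply Csum_zero; intros a _. apply Csum_zero; intros; ring.
  - rewrite <- IH, <- pairing_scal, <- pairing_plus. reflexivity.
Qed.

Lemma lpow_v0 (k : nat) : lpow (RtoC 1, RtoC 0) k vone = vone.
Proof.
  induction k as [|k IH]; simpl; [reflexivity|]. rewrite IH. extensionality a.
  unfold lmul. destruct a; simpl; ring.
Qed.

Lemma v0_expansion (E0 E1 : C -> C * C) (u : C) :
  is_continuation e0_real E0 -> is_continuation e1_real E1 ->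
  vcomb (- solX E1 u) (E0 u) (solB E0 u) (E1 u) = (RtoC 1, RtoC 0).
Proof.
  intros H0 H1. pose proof (det_E0_E1 E0 E1 u H0 H1) as HD. pose proof piI_neq_0 as Hpi.
  unfold vcomb, solX, solB. f_equal.
  - transitivity (2 * piI * (fst (E0 u) * snd (E1 u) - fst (E1 u) * snd (E0 u))); [ring|].
    rewrite HD. field. exact Hpi.
  - ring.
Qed.

(** Expanding [v_0^k] in the flat basis, only the monomial dual to [e_0^p e_1^q] pairs
    nontrivially with it, and the binomial coefficient cancels the factorials. *)
Lemma pairing_v0 (k : nat) (E0 E1 : C -> C * C) (G : C -> nat -> nat -> C) (p q : nat) (u : C) :
  is_continuation e0_real E0 -> is_continuation e1_real E1 -> is_top_pairing k E0 E1 G ->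
  (p + q = k)%nat ->
  pairing k G (Cexp u) (mono (E0 u) p (E1 u) q) vone = solB E0 u ^ p * solX E1 u ^ q.
Proof.
  intros H0 H1 HG Hk.
  assert (HV : vone = fun a => Csum (fun m =>
     (RtoC (INR (bin k m)) * (- solX E1 u) ^ (k - m) * solB E0 u ^ m)
      * mono (E0 u) (k - m) (E1 u) m a) (seq 0 (S k))).
  { extensionality a.
    transitivity (lpow (vcomb (- solX E1 u) (E0 u) (solB E0 u) (E1 u)) k vone a).
    { now rewrite (v0_expansion E0 E1 u H0 H1), lpow_v0. }
    rewrite lpow_binomial.
    apply Csum_ext; intros m _. now rewrite mono_lpow. }
  rewrite HV, (pairing_Csum k G (Cexp u) _ (fun m =>
     RtoC (INR (bin k m)) * (- solX E1 u) ^ (k - m) * solB E0 u ^ m)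
     (fun m => mono (E0 u) (k - m) (E1 u) m)).
  rewrite (Csum_ext _ (fun m => RtoC (INR (bin k m)) * (- solX E1 u) ^ (k - m) * solB E0 u ^ m *
     (if (q + m =? k)%nat then RtoC ((-1) ^ q * (INR (fact q) * INR (fact m) / INR (fact k))) else 0))).
  2: { intros m Hm. apply in_seq in Hm. f_equal.
       pose proof (HG u q m ltac:(lia) ltac:(lia)) as Hm'.
       replace (k - q)%nat with p in Hm' by lia. exact Hm'. }
  rewrite (Csum_single _ _ p); [|lia|].
  - replace (q + p =? k)%nat with true by (symmetry; apply Nat.eqb_eq; lia).
    pose proof (bin_fact k p ltac:(lia)) as Hb. apply (f_equal INR) in Hb.
    rewrite !mult_INR in Hb. replace (k - p)%nat with q in * by lia.
    assert (E : (RtoC (INR (bin k p)) * RtoC ((-1) ^ q * (INR (fact q) * INR (fact p) / INR (fact k))) = RtoC ((-1) ^ q))).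
    { rewrite <- RtoC_mult. f_equal. rewrite <- Hb.
      field. repeat split; try apply INR_fact_neq_0.
      intros Hz. rewrite Hz, Rmult_0_l in Hb. symmetry in Hb. now apply INR_fact_neq_0 in Hb. }
    transitivity ((RtoC (INR (bin k p)) * RtoC ((-1) ^ q * (INR (fact q) * INR (fact p) / INR (fact k))))
       * (solB E0 u ^ p * (- solX E1 u) ^ q)); [ring|].
    rewrite E, RtoC_pow.
    replace (RtoC (-1)%R) with (- (1) : C) by (rewrite <- RtoC_opp; f_equal).
    replace (- solX E1 u) with (- (1) * solX E1 u) by ring. rewrite Cpow_mult_l.
    transitivity (((- (1)) * (- (1))) ^ q * (solB E0 u ^ p * solX E1 u ^ q)); [rewrite Cpow_mult_l; ring|].
    replace (- (1) * - (1)) with (RtoC 1) by ring. rewrite Cpow_1_l. ring.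
  - intros m Hm. replace (q + m =? k)%nat with false by (symmetry; apply Nat.eqb_neq; lia). ring.
Qed.

(** * Twisted simplices carried by monomials in [E_0], [E_1] *)

Definition vnorm (e : C * C) : R := (Cmod (fst e) + Cmod (snd e))%R.

Lemma vnorm_pos (e : C * C) : 0 <= vnorm e.
Proof. apply Rplus_le_le_0_compat; apply Cmod_ge_0. Qed.

Lemma lpow_bound (e : C * C) (n : nat) (y : vec) (M : R) : (forall a, Cmod (y a) <= M) ->
  forall a, Cmod (lpow e n y a) <= vnorm e ^ n * M.
Proof.
  intros H. induction n as [|n IH]; intros a; simpl lpow.
  - simpl. rewrite Rmult_1_l. apply H.
  - assert (HM : 0 <= vnorm e ^ n * M).
    { eapply Rle_trans; [apply Cmod_ge_0|apply (IH 0%nat)]. }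
    unfold lmul. eapply Rle_trans; [apply Cmod_triangle|].
    simpl. unfold vnorm at 1. rewrite Rmult_assoc, Rmult_plus_distr_r.
    apply Rplus_le_compat.
    + rewrite Cmod_mult. apply Rmult_le_compat_l; [apply Cmod_ge_0|apply IH].
    + destruct a as [|a].
      * rewrite Cmod_0. apply Rmult_le_pos; [apply Cmod_ge_0|exact HM].
      * rewrite Cmod_mult. apply Rmult_le_compat_l; [apply Cmod_ge_0|apply IH].
Qed.

Lemma mono_bound (e f : C * C) (p q a : nat) :
  Cmod (mono e p f q a) <= vnorm e ^ p * vnorm f ^ q.
Proof.
  rewrite mono_lpow. apply lpow_bound. intros b.
  rewrite <- (Rmult_1_r (vnorm f ^ q)). apply lpow_bound. intros [|c]; simpl.
  - rewrite Cmod_1. lra.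
  - rewrite Cmod_0. lra.
Qed.

(** Flat sections of [Sym^n Kl_2] over the universal cover. *)
Definition flat_family (n : nat) (y : C -> vec) : Prop :=
  forall u, vsupp n (y u) /\
    forall a, CD (fun u => y u a) u (- sym_conn n (Cexp u) (y u) a).

Lemma flat_family_vone : flat_family 0 (fun _ => vone).
Proof.
  intros u. split; [apply vsupp_vone|]. intros a.
  eapply CD_value; [|exact (CD_const (vone a) u)].
  rewrite (sym_conn_supp 0 _ _ _ vsupp_vone).
  destruct a as [|[|a]]; simpl; ring.
Qed.

Lemma flat_family_lmul (E : C -> C * C) (n : nat) (y : C -> vec) :
  is_flat_Kl2 E -> flat_family n y -> flat_family (S n) (fun u => lmul (E u) (y u)).
Proof.
  intros HE Hy u. destruct (Hy u) as [Hs HD]. split; [now apply vsupp_lmul|]. intros a.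
  rewrite sym_conn_lmul by exact Hs.
  pose proof (flat_fst E u HE) as D1. pose proof (flat_snd E u HE) as D2.
  unfold lmul at 1. destruct a as [|a].
  - eapply CD_value; [|exact (CD_plus _ _ _ _ _ (CD_mult _ _ _ _ _ D1 (HD 0%nat)) (CD_const 0 u))].
    unfold lmul, kl2_conn; cbn [fst snd]. ring.
  - eapply CD_value; [|exact (CD_plus _ _ _ _ _ (CD_mult _ _ _ _ _ D1 (HD (S a)))
       (CD_mult _ _ _ _ _ D2 (HD a)))].
    unfold lmul, kl2_conn; cbn [fst snd]. ring.
Qed.

Lemma flat_family_lpow (E : C -> C * C) (m n : nat) (y : C -> vec) :
  is_flat_Kl2 E -> flat_family n y -> flat_family (m + n) (fun u => lpow (E u) m (y u)).
Proof.
  intros HE Hy. induction m as [|m IH]; simpl; [exact Hy|]. now apply flat_family_lmul.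
Qed.

Lemma flat_family_mono (E0 E1 : C -> C * C) (p q : nat) :
  is_flat_Kl2 E0 -> is_flat_Kl2 E1 -> flat_family (p + q) (fun u => mono (E0 u) p (E1 u) q).
Proof.
  intros H0 H1. pose proof (flat_family_lpow E0 p _ _ H0 (flat_family_lpow E1 q _ _ H1 flat_family_vone)) as H.
  rewrite Nat.add_0_r in H. intros u. destruct (H u) as [A B]. split.
  - rewrite mono_lpow. exact A.
  - intros a. rewrite mono_lpow. eapply CD_ext; [|apply B]. intros x. now rewrite mono_lpow.
Qed.

Lemma RD_value (f : R -> C) (s : R) (l l' : C) : l = l' -> RD f s l -> RD f s l'.
Proof. now intros ->. Qed.

Lemma RD_CDerive (f : R -> C) (s : R) (l : C) : RD f s l -> CDerive f s = l.
Proof.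
  intros H. unfold CDerive. apply injective_projections.
  - exact (is_derive_unique _ _ _ (RD_Re _ _ _ H)).
  - exact (is_derive_unique _ _ _ (RD_Im _ _ _ H)).
Qed.

(** A local logarithm [lg] turns flat sections over the universal cover into flat sections
    along the simplex [c], on which [dz/z] is then [l ds]. *)
Definition log_lift (c : simplex1) (lg : R -> C) (s : R) (l : C) : Prop :=
  locally s (fun r => pt1 c r = Cexp (lg r)) /\ RD lg s l.

Lemma log_lift_dlog (c : simplex1) (lg : R -> C) (s : R) (l : C) : log_lift c lg s l ->
  pt1 c s = Cexp (lg s) /\ CDerive (pt1 c) s / pt1 c s = l.
Proof.
  intros [He Hl]. pose proof (locally_singleton _ _ He) as Hs. split; [exact Hs|].
  assert (HD : RD (pt1 c) s (l * Cexp (lg s))).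
  { eapply is_derive_ext_loc; [|exact (CD_RD_comp Cexp lg s _ _ (CD_Cexp _) Hl)].
    apply (filter_imp _ _ (fun r Hr => eq_sym Hr) He). }
  rewrite (RD_CDerive _ _ _ HD), Hs. field. apply Cexp_neq_0.
Qed.

Lemma is_twisted1_mono (k p q : nat) (E0 E1 : C -> C * C) (c : simplex1) (lg : R -> C) :
  is_flat_Kl2 E0 -> is_flat_Kl2 E1 -> (p + q = k)%nat -> is_simplex1 c ->
  (forall s, in01 s -> inner (hgt1 c s) -> exists l, log_lift c lg s l) ->
  (forall N : nat, exists M : R, forall (s : R) (a : nat),
     in01 s -> inner (hgt1 c s) -> (a <= k)%nat ->
     Cmod (mono (E0 (lg s)) p (E1 (lg s)) q a) <= M * (1 - Rabs (hgt1 c s)) ^ N) ->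
  is_twisted1 k (c, fun s => mono (E0 (lg s)) p (E1 (lg s)) q).
Proof.
  intros H0 H1 Hk Hc Hlg Hrd.
  pose proof (flat_family_mono E0 E1 p q H0 H1) as HF. rewrite Hk in HF.
  assert (D : forall s a, in01 s -> inner (hgt1 c s) ->
    RD (fun r => mono (E0 (lg r)) p (E1 (lg r)) q a) s
      (- (CDerive (pt1 c) s / pt1 c s * sym_conn k (pt1 c s) (mono (E0 (lg s)) p (E1 (lg s)) q) a))).
  { intros s a Hs Hi. destruct (Hlg s Hs Hi) as [l Hl]. pose proof (proj2 Hl) as Dl.
    apply log_lift_dlog in Hl. destruct Hl as [-> ->].
    replace (- (l * sym_conn k (Cexp (lg s)) (mono (E0 (lg s)) p (E1 (lg s)) q) a))
      with (l * - sym_conn k (Cexp (lg s)) (mono (E0 (lg s)) p (E1 (lg s)) q) a) by ring.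
    exact (CD_RD_comp (fun u => mono (E0 u) p (E1 u) q a) lg s _ _ (proj2 (HF _) a) Dl). }
  split; [exact Hc|]. split; [|split; [|exact Hrd]].
  - intros s a Hs Hi _. apply D; [|exact Hi]. unfold in01; lra.
  - intros s a Hs Hi _.
    eapply filterlim_filter_le_1; [apply filter_le_within|].
    exact (RD_continuous _ _ _ (D s a Hs Hi)).
Qed.

Lemma sym_conn_scal (k : nat) (z l : C) (x : vec) (a : nat) :
  sym_conn k z (fun b => l * x b) a = l * sym_conn k z x a.
Proof. unfold sym_conn. destruct a; destruct (_ <? _)%nat; ring. Qed.

Lemma is_twisted1_scale (k : nat) (l : C) (ce : twisted1) :
  is_twisted1 k ce -> is_twisted1 k (scale_twisted l ce).
Proof.
  destruct ce as [c e]. intros (Hc & Hd & Hcont & Hrd). unfold scale_twisted; cbn [fst snd].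
  split; [exact Hc|]. split; [|split].
  - intros s a Hs Hi Ha. cbv beta. rewrite sym_conn_scal.
    eapply RD_value; [|exact (RD_scal l _ _ _ (Hd s a Hs Hi Ha))]. ring.
  - intros s a Hs Hi Ha.
    apply (filterlim_comp _ _ _ (fun r => e r a) (fun z => l * z) _ (locally (e s a))); [now apply Hcont|].
    intros P [eps HP].
    destruct (CD_continuous _ _ _ (CD_scal l _ _ _ (CD_id (e s a))) eps) as [d Hdd].
    assert (Hd2 : 0 < d / 2) by (pose proof (cond_pos d); lra).
    exists (mkposreal _ Hd2). intros y Hy. apply HP.
    apply C_NormedModule_mixin_compat1.
    replace y with (e s a + (y - e s a)) by ring. apply Hdd.
    apply C_NormedModule_mixin_compat2 in Hy. simpl in Hy.
    eapply Rlt_le_trans; [exact Hy|].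
    assert (sqrt 2 <= 2).
    { rewrite <- (sqrt_square 2) at 2 by lra. apply sqrt_le_1; lra. }
    pose proof (cond_pos d). nra.
  - intros N. destruct (Hrd N) as [M HM]. exists (Cmod l * M)%R.
    intros s a Hs Hi Ha. rewrite Cmod_mult, Rmult_assoc.
    apply Rmult_le_compat_l; [apply Cmod_ge_0|now apply HM].
Qed.

(** * The circles and the half-line *)

Lemma circle_log_turns (a : nat) (s : R) : circle_log a s = RtoC s * turns a.
Proof. unfold circle_log, turns. rewrite !RtoC_mult. ring. Qed.

Lemma pt_circle (a : nat) (s : R) : pt1 (circle a) s = Cexp (circle_log a s).
Proof.
  unfold pt1, pt, circle, circle_log. cbn [dir1 hgt1]. rewrite Cexp_piI.
  replace ((1 + 0) / (1 - 0))%R with 1%R by field.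
  rewrite Cmult_1_r. f_equal; f_equal; ring.
Qed.

Lemma log_lift_circle (a : nat) (s : R) : log_lift (circle a) (circle_log a) s (turns a).
Proof.
  split.
  - apply filter_forall. intros r. apply pt_circle.
  - eapply is_derive_ext; [|exact (RD_line 0 (turns a) s)].
    intros r. exact (eq_trans (Cplus_0_l _) (eq_sym (circle_log_turns a r))).
Qed.

Lemma C1_of_derive (f f' : R -> R) : (forall s, is_derive f s (f' s)) ->
  (forall s, continuous f' s) -> Defs.C1 f.
Proof.
  intros Hd Hc s. split; [now exists (f' s)|].
  apply (continuous_ext f'); [|apply Hc]. intros x. symmetry. now apply is_derive_unique.
Qed.

Lemma is_simplex1_circle (a : nat) : is_simplex1 (circle a).
Proof.
  unfold circle, is_simplex1; cbn [dir1 hgt1].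
  split; [|split; [|split]].
  - apply (C1_of_derive _ (fun s => (2 * PI * INR a) * - sin (2 * PI * INR a * s))%R); cbn.
    + intros s. auto_derive; [exact I|ring].
    + intros s. apply (ex_derive_continuous (K := R_AbsRing) (V := R_NormedModule)). auto_derive. exact I.
  - apply (C1_of_derive _ (fun s => (2 * PI * INR a) * cos (2 * PI * INR a * s))%R); cbn.
    + intros s. auto_derive; [exact I|ring].
    + intros s. apply (ex_derive_continuous (K := R_AbsRing) (V := R_NormedModule)). auto_derive. exact I.
  - apply (C1_of_derive _ (fun s => 0%R)); intros s; [apply (is_derive_const (V := R_NormedModule))|apply continuous_const].
  - intros s _. split; [|lra]. unfold Cmod; cbn [fst snd]. rewrite <- sqrt_1. f_equal.
    pose proof (sin2_cos2 (2 * PI * INR a * s)) as A. unfold Rsqr in A. simpl. lra.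
Qed.

Lemma finite_bound (f : nat -> R -> R) (P : R -> Prop) (k : nat) :
  (forall a, exists M, forall s, P s -> f a s <= M) ->
  exists M, forall s a, P s -> (a <= k)%nat -> f a s <= M.
Proof.
  intros H. induction k as [|k [M IH]].
  - destruct (H 0%nat) as [M HM]. exists M. intros s a Hs Ha. replace a with 0%nat by lia. now apply HM.
  - destruct (H (S k)) as [M' HM']. exists (Rmax M M'). intros s a Hs Ha.
    destruct (Nat.eq_dec a (S k)) as [->|Hn].
    + eapply Rle_trans; [now apply HM'|apply Rmax_r].
    + eapply Rle_trans; [apply IH; [exact Hs|lia]|apply Rmax_l].
Qed.

Lemma is_twisted1_circle (k p q a : nat) (E0 E1 : C -> C * C) :
  is_flat_Kl2 E0 -> is_flat_Kl2 E1 -> (p + q = k)%nat ->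
  is_twisted1 k (circle a, fun s => mono (E0 (circle_log a s)) p (E1 (circle_log a s)) q).
Proof.
  intros H0 H1 Hk. apply is_twisted1_mono; try assumption.
  - apply is_simplex1_circle.
  - intros s _ _. exists (turns a). apply log_lift_circle.
  - intros N. destruct (finite_bound (fun b s => Cmod (mono (E0 (circle_log a s)) p (E1 (circle_log a s)) q b)) in01 k) as [M HM].
    + intros b. destruct (bounded_continuity (V := C_R_NormedModule)
        (fun s => mono (E0 (circle_log a s)) p (E1 (circle_log a s)) q b) 0 1) as [M HM].
      * intros s _. eapply RD_continuous.
        exact (CD_RD_comp (fun u => mono (E0 u) p (E1 u) q b) (circle_log a) s _ _
          (proj2 (flat_family_mono E0 E1 p q H0 H1 _) b) (proj2 (log_lift_circle a s))).
      * exists M. intros s Hs. left. specialize (HM s Hs). rewrite norm_CR in HM. exact HM.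
    + exists M. intros s b Hs _ Hb. cbn [circle hgt1]. rewrite Rabs_R0, Rminus_0_r, pow1, Rmult_1_r.
      now apply HM.
Qed.

Lemma is_simplex1_ray : is_simplex1 ray.
Proof.
  unfold ray, is_simplex1; cbn [dir1 hgt1].
  split; [|split; [|split]].
  1, 2: apply (C1_of_derive _ (fun s => 0%R)); intros s; [apply (is_derive_const (V := R_NormedModule))|apply continuous_const].
  - apply (C1_of_derive _ (fun s => 1%R)); intros s; [apply (is_derive_id (K := R_AbsRing))|apply continuous_const].
  - intros s [Hs Hs']. split; [apply Cmod_1|lra].
Qed.

Lemma ray_ratio_pos (s : R) : -1 < s < 1 -> 0 < (1 + s) / (1 - s).
Proof. intros Hs. apply Rdiv_lt_0_compat; lra. Qed.

Lemma ray_ln_nonneg (s : R) : 0 <= s < 1 -> 0 <= ln ((1 + s) / (1 - s)).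
Proof.
  intros Hs. rewrite <- ln_1. apply ln_le; [lra|].
  apply Rmult_le_reg_r with (1 - s)%R; [lra|]. unfold Rdiv. rewrite Rmult_assoc, Rinv_l; lra.
Qed.

Lemma log_lift_ray (s : R) : -1 < s < 1 -> log_lift ray ray_log s (RtoC (2 / ((1 - s) * (1 + s)))).
Proof.
  intros Hs. split.
  - apply (locally_open (fun r => -1 < r /\ r < 1)); [|intros r Hr|exact Hs].
    + apply open_and; [apply open_gt|apply open_lt].
    + unfold pt1, pt, ray, ray_log; cbn [dir1 hgt1].
      rewrite Cexp_R, exp_ln by now apply ray_ratio_pos. ring.
  - unfold ray_log. apply (RD_RtoC (fun s => ln ((1 + s) / (1 - s)))).
    auto_derive.
    + split; [lra|]. split; [|exact I]. now apply ray_ratio_pos.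
    + field. lra.
Qed.

(** [e_0^p e_1^q] with [p < q] decays like [exp (- t)], faster than any power. *)
Lemma growth_product (p q N : nat) (M : R) : (p < q)%nat -> 0 <= M ->
  exists K, 0 <= K /\ forall b m0 m1, 1 <= b -> 0 <= m0 <= M * b * exp (2 * b) ->
    0 <= m1 <= M * b * exp (- 2 * b) -> m0 ^ p * m1 ^ q * b ^ N <= K.
Proof.
  intros Hpq HM. destruct (pow_le_exp (p + q + N)) as (K & HK & HKb).
  exists (M ^ p * M ^ q * K)%R. split.
  { apply Rmult_le_pos; [|lra]. apply Rmult_le_pos; now apply pow_le. }
  intros b m0 m1 Hb H0 H1.
  assert (Hexp : forall (x : R) n, (exp x ^ n)%R = exp (INR n * x)).
  { intros x n. induction n as [|n IH]; [simpl; now rewrite Rmult_0_l, exp_0|].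
    rewrite S_INR, Rmult_plus_distr_r, exp_plus, Rmult_1_l, <- IH. simpl. ring. }
  apply Rle_trans with ((M * b * exp (2 * b)) ^ p * (M * b * exp (- 2 * b)) ^ q * b ^ N)%R.
  { apply Rmult_le_compat_r; [apply pow_le; lra|].
    apply Rmult_le_compat; try (apply pow_le; lra); now apply pow_incr. }
  rewrite !Rpow_mult_distr, !Hexp.
  replace (M ^ p * b ^ p * exp (INR p * (2 * b)) * (M ^ q * b ^ q * exp (INR q * (- 2 * b))) * b ^ N)%R
    with (M ^ p * M ^ q * (b ^ (p + q + N) * exp (INR p * (2 * b) + INR q * (- 2 * b))))%R.
  2: { rewrite exp_plus, !pow_add. ring. }
  apply Rmult_le_compat_l; [apply Rmult_le_pos; now apply pow_le|].
  specialize (HKb b ltac:(lra)).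
  assert (Hq : INR p + 1 <= INR q) by (rewrite <- S_INR; apply le_INR; lia).
  assert (He : exp (INR p * (2 * b) + INR q * (- 2 * b)) <= exp (- b)).
  { assert (Hle : INR p * (2 * b) + INR q * (- 2 * b) <= - b) by nra.
    now apply exp_le_exp. }
  apply Rle_trans with (K * exp b * exp (- b))%R.
  - apply Rmult_le_compat; try lra; [apply pow_le; lra|left; apply exp_pos].
  - rewrite Rmult_assoc, <- exp_plus, Rplus_opp_r, exp_0. lra.
Qed.

Lemma E_product_growth (E0 E1 : C -> C * C) (p q N : nat) :
  is_continuation e0_real E0 -> is_continuation e1_real E1 -> (p < q)%nat ->
  exists K, 0 <= K /\ forall x : R, 0 <= x ->
    vnorm (E0 x) ^ p * vnorm (E1 x) ^ q * exp (x / 2) ^ N <= K.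
Proof.
  intros H0 H1 Hpq.
  destruct (E0_growth_infty E0 H0) as (M0 & P0 & B0).
  destruct (E1_growth_infty E1 H1) as (M1 & P1 & B1).
  destruct (growth_product p q N (2 * (M0 + M1)) Hpq ltac:(lra)) as (K & HK & HKb).
  exists K. split; [exact HK|]. intros x Hx.
  destruct (B0 x Hx) as [B00 B01]. destruct (B1 x Hx) as [B10 B11].
  pose proof (exp_half_ge_1 x Hx) as Hb.
  apply HKb; [exact Hb| |]; (split; [apply vnorm_pos|]); unfold vnorm.
  - pose proof (exp_pos (2 * exp (x / 2))) as He.
    assert (0 <= M1 * exp (x / 2) * exp (2 * exp (x / 2))) by (apply Rmult_le_pos; [apply Rmult_le_pos|]; lra).
    lra.
  - pose proof (exp_pos (- 2 * exp (x / 2))) as He.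
    assert (0 <= M0 * exp (x / 2) * exp (- 2 * exp (x / 2))) by (apply Rmult_le_pos; [apply Rmult_le_pos|]; lra).
    lra.
Qed.

(** On the half-line [1 - s] is comparable with [1 / z = e^(-x)], so that rapid decay is a
    bound against all powers of [e^(x/2)]. *)
Lemma is_twisted1_ray (k p q : nat) (E0 E1 : C -> C * C) :
  is_continuation e0_real E0 -> is_continuation e1_real E1 -> (p + q = k)%nat -> (p < q)%nat ->
  is_twisted1 k (ray, fun s => mono (E0 (ray_log s)) p (E1 (ray_log s)) q).
Proof.
  intros H0 H1 Hk Hpq. apply is_twisted1_mono; try assumption; try apply H0; try apply H1.
  - apply is_simplex1_ray.
  - intros s _ Hi. eexists. now apply log_lift_ray.
  - intros N. destruct (E_product_growth E0 E1 p q (2 * N) H0 H1 Hpq) as (K & HK & HKb).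
    exists K. intros s a Hs Hi _. cbn [ray hgt1] in *. unfold inner in Hi. unfold in01 in Hs.
    eapply Rle_trans; [apply mono_bound|]. unfold ray_log.
    set (x := ln ((1 + s) / (1 - s))).
    assert (Ex : exp x = ((1 + s) / (1 - s))%R) by (apply exp_ln, ray_ratio_pos; lra).
    assert (Hx : 0 <= x) by (apply ray_ln_nonneg; lra).
    specialize (HKb x Hx). rewrite Rabs_pos_eq by lra.
    assert (Eb : (exp (x / 2) ^ (2 * N) = ((1 + s) / (1 - s)) ^ N)%R).
    { rewrite pow_mult. f_equal. simpl. rewrite Rmult_1_r, <- exp_plus, <- Ex. f_equal. field. }
    rewrite Eb in HKb.
    set (v := (vnorm (E0 x) ^ p * vnorm (E1 x) ^ q)%R) in *.
    assert (Hv : 0 <= v) by (apply Rmult_le_pos; apply pow_le, vnorm_pos).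
    assert (P : 0 < (1 - s) ^ N) by (apply pow_lt; lra).
    apply Rle_trans with (v * ((1 + s) / (1 - s)) ^ N * (1 - s) ^ N)%R.
    + rewrite Rmult_assoc, <- Rpow_mult_distr.
      replace ((1 + s) / (1 - s) * (1 - s))%R with (1 + s)%R by (field; lra).
      assert (1 <= (1 + s) ^ N) by (apply pow_R1_Rle; lra). nra.
    + apply Rmult_le_compat_r; lra.
Qed.

(** * The chains [alpha] are cycles *)

Lemma indic_ext (P Q : Prop) : (P <-> Q) -> indic P = indic Q.
Proof.
  intros H. unfold indic.
  destruct (excluded_middle_informative P), (excluded_middle_informative Q); tauto.
Qed.

Lemma indic_true (P : Prop) : P -> indic P = 1.
Proof. intros H. unfold indic. destruct (excluded_middle_informative P); tauto. Qed.

Lemma indic_false (P : Prop) : ~ P -> indic P = 0.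
Proof. intros H. unfold indic. destruct (excluded_middle_informative P); tauto. Qed.

(** The identity of [phi_circles], for sections instead of functions. *)
Lemma mono_turns_sum (e f : C * C) (p q b : nat) : (1 <= q)%nat ->
  Csum (fun a => RtoC (Cn q a) * (mono e p (vcomb 1 f (RtoC (INR a)) e) q b - mono e p f q b)) (seq 1 q)
  = mono e (S p) f (q - 1) b.
Proof.
  intros Hq.
  pose proof (Cn_extracts_linear q (fun m => lpow f (q - m) (lpow e m (lpow e p vone)) b) Hq) as H.
  cbv beta in H. etransitivity; [|etransitivity; [exact H|]].
  - apply Csum_ext. intros a _. f_equal. rewrite !mono_lpow, !(lpow_comm e _ p), lpow_binomial.
    rewrite Nat.sub_0_r. f_equal. apply Csum_ext. intros m _. rewrite Cpow_1_l. ring.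
  - rewrite mono_lpow, (lpow_comm e f (S p)). reflexivity.
Qed.

Lemma inner_0 : inner 0.
Proof. unfold inner. lra. Qed.

Lemma bd1_circle (a : nat) (e : R -> vec) (z : C) (b : nat) :
  bd1 [(circle a, e)] z b = indic (RtoC 1 = z) * (e 1%R b - e 0%R b).
Proof.
  unfold bd1. simpl.
  assert (E : forall s, (s = 0 \/ s = 1)%R -> indic (inner 0 /\ pt1 (circle a) s = z) = indic (RtoC 1 = z)).
  { intros s Hs. apply indic_ext. rewrite pt_circle, circle_log_turns.
    assert (E1 : Cexp (RtoC s * turns a) = 1).
    { destruct Hs as [-> | ->].
      - replace (0%R * turns a) with (RtoC 0) by ring. apply Cexp_0.
      - replace (1%R * turns a) with (turns a) by ring. apply Cexp_turns. }
    rewrite E1. pose proof inner_0. tauto. }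
  rewrite !E by auto. ring.
Qed.

Lemma bd1_ray (e : R -> vec) (z : C) (b : nat) :
  bd1 [(ray, e)] z b = - (indic (RtoC 1 = z) * e 0%R b).
Proof.
  unfold bd1. simpl.
  rewrite indic_false by (unfold inner; lra).
  rewrite (indic_ext (inner 0 /\ pt1 ray 0 = z) (RtoC 1 = z)); [ring|].
  unfold pt1, pt, ray; cbn [dir1 hgt1]. replace ((1 + 0) / (1 - 0))%R with 1%R by field.
  rewrite Cmult_1_r. pose proof inner_0. tauto.
Qed.

Lemma bd1_app (c d : chain1) (z : C) (b : nat) : bd1 (c ++ d) z b = bd1 c z b + bd1 d z b.
Proof. apply Csum_app. Qed.

Lemma bd1_scale (l : C) (ce : twisted1) (z : C) (b : nat) :
  bd1 [scale_twisted l ce] z b = l * bd1 [ce] z b.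
Proof. destruct ce as [c e]. unfold bd1, scale_twisted. simpl. ring. Qed.

Lemma Csum_singleton {A} (f : A -> C) (x : A) : Csum f [x] = f x.
Proof. simpl. ring. Qed.

Lemma bd1_map {A} (h : A -> twisted1) (l : list A) (z : C) (b : nat) :
  bd1 (map h l) z b = Csum (fun a => bd1 [h a] z b) l.
Proof.
  unfold bd1. rewrite Csum_map. apply Csum_ext. intros a _. simpl. ring.
Qed.

(** All boundary points in [G_m] lie at [z = 1]: [alpha_0] closes up since [e_0] is
    invariant, and the circles compensate the start of the half-line by
    [mono_turns_sum]. The condition [2 i < k] makes [e_0^i e_1^(k-i)] decay. *)
Lemma alpha_is_cycle (k i : nat) (E0 E1 : C -> C * C) :
  is_continuation e0_real E0 -> is_continuation e1_real E1 ->
  (1 <= i)%nat -> (2 * i < k)%nat -> is_rd_cycle k (alpha E0 E1 k i).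
Proof.
  intros H0 H1 Hi Hik. pose proof (proj1 H0) as F0. pose proof (proj1 H1) as F1.
  unfold alpha. split.
  - apply Forall_app. split; [|apply Forall_app; split].
    + unfold alpha0. simpl. constructor; [|constructor].
      apply is_twisted1_scale, is_twisted1_circle; try assumption. lia.
    + constructor; [|constructor]. apply is_twisted1_ray; try assumption; lia.
    + apply Forall_forall. intros ce Hce. apply in_map_iff in Hce. destruct Hce as (a & <- & _).
      apply is_twisted1_scale, is_twisted1_circle; try assumption. lia.
  - intros z b _. rewrite !bd1_app, !bd1_map.
    rewrite (Csum_ext _ (fun a => indic (RtoC 1 = z) * (RtoC (Cn (k - i + 1) a) *
       (mono (E0 0) (i - 1) (vcomb 1 (E1 0) (INR a) (E0 0)) (k - i + 1) b
        - mono (E0 0) (i - 1) (E1 0) (k - i + 1) b))) (seq 1 (k - i + 1))).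
    2: { intros a _. rewrite bd1_scale, bd1_circle, !circle_log_turns.
         replace (1%R * turns a) with (RtoC 0 + turns a) by ring.
         replace (0%R * turns a) with (RtoC 0) by ring.
         rewrite (E0_turns _ _ _ H0), (E1_turns _ _ _ _ H0 H1). ring. }
    rewrite Csum_scal, mono_turns_sum by lia.
    replace (S (i - 1)) with i by lia. replace (k - i + 1 - 1)%nat with (k - i)%nat by lia.
    rewrite bd1_ray. unfold ray_log. replace ((1 + 0) / (1 - 0))%R with 1%R by field. rewrite ln_1.
    unfold alpha0. rewrite Csum_singleton, bd1_scale, bd1_circle, !circle_log_turns.
    replace (1%R * turns 1) with (RtoC 0 + turns 1) by ring.
    replace (0%R * turns 1) with (RtoC 0) by ring.
    rewrite !mono_lpow. simpl (lpow _ 0 vone). rewrite (E0_turns _ _ _ H0). ring.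
Qed.

(** * Periods *)

Definition integrand (k : nat) (G : C -> nat -> nat -> C) (ce : twisted1) (f : sym_section)
    (r : R) : C :=
  indic (inner (hgt1 (fst ce) r)) *
    (pairing k G (pt1 (fst ce) r) (snd ce r) (fun a => leval (f a) (pt1 (fst ce) r))
     * (CDerive (pt1 (fst ce)) r / pt1 (fst ce) r)).

Lemma period_integrand (k : nat) (G : C -> nat -> nat -> C) (c : chain1) (f : sym_section) :
  period k G c f = Csum (fun ce => CInt (integrand k G ce f) 0 1) c.
Proof. unfold period. apply Csum_ext. intros [s e] _. reflexivity. Qed.

Lemma Cpowz_nat (z : C) (n : nat) : Cpowz z (Z.of_nat n) = z ^ n.
Proof.
  destruct n as [|n]; [reflexivity|]. simpl Z.of_nat. unfold Cpowz.
  now rewrite SuccNat2Pos.id_succ.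
Qed.

Lemma leval_omega (j : nat) (z : C) :
  (fun a => leval (omega j a) z) = (fun a => z ^ j * vone a).
Proof.
  extensionality a. destruct a as [|a]; unfold leval, omega, Csum, vone; cbn [fold_right fst snd].
  - rewrite Cpowz_nat. ring.
  - ring.
Qed.

Lemma leval_omega' (k : nat) (g : nat -> R) (j : nat) (z : C) : (k mod 4 = 0)%nat ->
  (fun a => leval (omega' k g j a) z)
  = (fun a => leval (omega j a) z + - RtoC (g j) * leval (omega (k / 4) a) z).
Proof.
  intros Hk. extensionality a. unfold omega'. rewrite Hk. cbn [Nat.eqb].
  destruct a as [|a]; unfold leval, omega, Csum; cbn [fold_right fst snd].
  - rewrite RtoC_opp. ring.
  - ring.
Qed.

Lemma integrand_omega (k p q j : nat) (E0 E1 : C -> C * C) (G : C -> nat -> nat -> C)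
    (c : simplex1) (lg : R -> C) (s : R) (l : C) :
  is_continuation e0_real E0 -> is_continuation e1_real E1 -> is_top_pairing k E0 E1 G ->
  (p + q = k)%nat -> inner (hgt1 c s) -> log_lift c lg s l ->
  integrand k G (c, fun s => mono (E0 (lg s)) p (E1 (lg s)) q) (omega j) s
  = phi E0 E1 p q j (lg s) * l.
Proof.
  intros H0 H1 HG Hk Hi Hl. apply log_lift_dlog in Hl. destruct Hl as [Hp Hd].
  unfold integrand. cbn [fst snd].
  rewrite indic_true, Hd, Hp, leval_omega, pairing_scal by exact Hi.
  rewrite (pairing_v0 k E0 E1 G p q _ H0 H1 HG Hk). unfold phi. ring.
Qed.

Lemma integrand_scale (k : nat) (G : C -> nat -> nat -> C) (l : C) (ce : twisted1)
    (f : sym_section) (r : R) :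
  integrand k G (scale_twisted l ce) f r = l * integrand k G ce f r.
Proof.
  unfold integrand, scale_twisted. cbn [fst snd].
  rewrite (pairing_scal_l k G _ (snd ce r) l). ring.
Qed.

Lemma integrand_omega' (k : nat) (G : C -> nat -> nat -> C) (ce : twisted1) (g : nat -> R)
    (j : nat) (r : R) : (k mod 4 = 0)%nat ->
  integrand k G ce (omega' k g j) r
  = integrand k G ce (omega j) r + - RtoC (g j) * integrand k G ce (omega (k / 4)) r.
Proof.
  intros Hk. unfold integrand. rewrite leval_omega' by exact Hk.
  rewrite (pairing_plus k G _ _ (fun a => leval (omega j a) (pt1 (fst ce) r))
     (fun a => - RtoC (g j) * leval (omega (k / 4) a) (pt1 (fst ce) r))), pairing_scal. ring.
Qed.

Lemma is_CInt_scal (l : C) (f : R -> C) (a b : R) (V : C) :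
  is_CInt f a b V -> is_CInt (fun s => l * f s) a b (l * V).
Proof.
  intros H. pose proof (is_RInt_fct_extend_fst _ _ _ _ H) as HR.
  pose proof (is_RInt_fct_extend_snd _ _ _ _ H) as HI.
  destruct l as [x y].
  apply (is_RInt_fct_extend_pair (U := R_NormedModule) (V := R_NormedModule)); cbn [fst snd].
  - exact (is_RInt_minus _ _ _ _ _ _ (is_RInt_scal _ _ _ x _ HR) (is_RInt_scal _ _ _ y _ HI)).
  - exact (is_RInt_plus _ _ _ _ _ _ (is_RInt_scal _ _ _ x _ HI) (is_RInt_scal _ _ _ y _ HR)).
Qed.

Lemma RD_mult (f g : R -> C) (s : R) (l m : C) :
  RD f s l -> RD g s m -> RD (fun r => f r * g r) s (l * g s + f s * m).
Proof.
  intros A B.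
  pose proof (RD_Re _ _ _ A) as A1. pose proof (RD_Im _ _ _ A) as A2.
  pose proof (RD_Re _ _ _ B) as B1. pose proof (RD_Im _ _ _ B) as B2.
  apply RD_pair; simpl.
  - evar_last; [exact (is_derive_minus _ _ _ _ _ (is_derive_mult _ _ _ _ _ A1 B1 Rmult_comm)
      (is_derive_mult _ _ _ _ _ A2 B2 Rmult_comm))|].
    unfold minus, plus, opp, mult, Re, Im; simpl. ring.
  - evar_last; [exact (is_derive_plus _ _ _ _ _ (is_derive_mult _ _ _ _ _ A1 B2 Rmult_comm)
      (is_derive_mult _ _ _ _ _ A2 B1 Rmult_comm))|].
    unfold minus, plus, opp, mult, Re, Im; simpl. ring.
Qed.

Lemma is_CInt_plus (f g : R -> C) (a b : R) (V W : C) :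
  is_CInt f a b V -> is_CInt g a b W -> is_CInt (fun s => f s + g s) a b (V + W).
Proof. intros A B. exact (is_RInt_plus (V := C_R_NormedModule) _ _ _ _ _ _ A B). Qed.

Lemma CInt_unique (f : R -> C) (a b : R) (V : C) : is_CInt f a b V -> CInt f a b = V.
Proof. apply (is_RInt_unique (V := C_R_CompleteNormedModule)). Qed.

(** Integrability along each simplex is what allows [RInt] to be split. *)
Lemma period_omega' (k : nat) (G : C -> nat -> nat -> C) (c : chain1) (g : nat -> R) (j : nat) :
  (k mod 4 = 0)%nat ->
  (forall ce m, In ce c -> (m = j \/ m = k / 4)%nat ->
     ex_RInt (V := C_R_NormedModule) (integrand k G ce (omega m)) 0 1) ->
  period k G c (omega' k g j) = period k G c (omega j) - RtoC (g j) * period k G c (omega (k / 4)).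
Proof.
  intros Hk Hex. rewrite !period_integrand.
  transitivity (Csum (fun ce => CInt (integrand k G ce (omega j)) 0 1) c
    + - RtoC (g j) * Csum (fun ce => CInt (integrand k G ce (omega (k / 4))) 0 1) c); [|ring].
  rewrite <- Csum_scal, <- Csum_plus. apply Csum_ext. intros ce Hce.
  apply CInt_unique.
  apply (is_RInt_ext (V := C_R_NormedModule) (fun s => integrand k G ce (omega j) s
     + - RtoC (g j) * integrand k G ce (omega (k / 4)) s)).
  - intros s _. symmetry. now apply integrand_omega'.
  - apply is_CInt_plus; [|apply is_CInt_scal];
      apply (RInt_correct (V := C_R_CompleteNormedModule)), Hex; auto.
Qed.

Lemma is_CInt_circle (k p q j a : nat) (E0 E1 : C -> C * C) (G : C -> nat -> nat -> C) :
  is_continuation e0_real E0 -> is_continuation e1_real E1 -> is_top_pairing k E0 E1 G ->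
  (p + q = k)%nat ->
  is_CInt (integrand k G (circle a, fun s => mono (E0 (circle_log a s)) p (E1 (circle_log a s)) q)
             (omega j)) 0 1 (Jint (phi E0 E1 p q j) (turns a) 0).
Proof.
  intros H0 H1 HG Hk.
  apply (is_RInt_ext (V := C_R_NormedModule)
    (fun s => phi E0 E1 p q j (RtoC 0 + RtoC s * turns a) * turns a)).
  - intros s _. rewrite (integrand_omega k p q j E0 E1 G (circle a) (circle_log a) s (turns a) H0 H1 HG Hk inner_0 (log_lift_circle a s)).
    rewrite circle_log_turns, Cplus_0_l. reflexivity.
  - apply (RInt_correct (V := C_R_CompleteNormedModule)), ex_CInt_line.
    destruct (entire2_phi E0 E1 p q j H0 H1) as (f1 & f2 & H). intros u. exists (f1 u). apply H.
Qed.

Lemma RD_phi_real (E0 E1 : C -> C * C) (p q j : nat) (x : R) :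
  is_continuation e0_real E0 -> is_continuation e1_real E1 ->
  exists l, RD (fun r => phi E0 E1 p q j (RtoC r)) x l.
Proof.
  intros H0 H1. destruct (entire2_phi E0 E1 p q j H0 H1) as (f1 & f2 & H).
  exists (f1 (RtoC x)). apply CD_RD_real, H.
Qed.

(** The bound [e^(-2x) = z^(-2)] leaves a factor [1 - s] after the pole of [dz/z] at the end
    of the half-line is accounted for. *)
Lemma phi_growth (E0 E1 : C -> C * C) (p q j : nat) :
  is_continuation e0_real E0 -> is_continuation e1_real E1 -> (p < q)%nat ->
  exists K, 0 <= K /\ forall x : R, 0 <= x -> Cmod (phi E0 E1 p q j x) <= K * exp (- 2 * x).
Proof.
  intros H0 H1 Hpq. destruct (E_product_growth E0 E1 p q (2 * j + 4) H0 H1 Hpq) as (K & HK & HKb).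
  set (c := Cmod (- (2 * piI))). assert (Hc : 0 <= c) by apply Cmod_ge_0.
  assert (Hcp : forall n, 0 <= c ^ n) by (intros; now apply pow_le).
  exists (c ^ p * c ^ q * K)%R. split; [apply Rmult_le_pos; [now apply Rmult_le_pos|exact HK]|].
  intros x Hx. specialize (HKb x Hx).
  unfold phi, solB, solX. rewrite !Cmod_mult, !Cmod_pow, !Cmod_mult, Cmod_Cexp. fold c. cbn [Re fst RtoC].
  set (b := exp (x / 2)) in *. assert (Hb : 0 < b) by apply exp_pos.
  replace (exp x) with (b ^ 2)%R by (unfold b; simpl; rewrite Rmult_1_r, <- exp_plus; f_equal; field).
  replace (exp (- 2 * x)) with (/ b ^ 4)%R.
  2: { unfold b. rewrite <- (Rinv_inv (exp (- 2 * x))), <- exp_Ropp. f_equal. simpl.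
       rewrite Rmult_1_r, <- !exp_plus. f_equal. field. }
  rewrite <- pow_mult, !Rpow_mult_distr.
  assert (V0 : 0 <= Cmod (snd (E0 x)) ^ p <= vnorm (E0 x) ^ p).
  { split; [apply pow_le, Cmod_ge_0|]. apply pow_incr. split; [apply Cmod_ge_0|].
    unfold vnorm. pose proof (Cmod_ge_0 (fst (E0 x))). lra. }
  assert (V1 : 0 <= Cmod (snd (E1 x)) ^ q <= vnorm (E1 x) ^ q).
  { split; [apply pow_le, Cmod_ge_0|]. apply pow_incr. split; [apply Cmod_ge_0|].
    unfold vnorm. pose proof (Cmod_ge_0 (fst (E1 x))). lra. }
  replace (c ^ p * Cmod (snd (E0 x)) ^ p * (c ^ q * Cmod (snd (E1 x)) ^ q) * b ^ (2 * j))%R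
    with (c ^ p * c ^ q * (Cmod (snd (E0 x)) ^ p * Cmod (snd (E1 x)) ^ q * b ^ (2 * j)))%R by ring.
  rewrite (Rmult_assoc (c ^ p * c ^ q)). apply Rmult_le_compat_l; [now apply Rmult_le_pos|].
  assert (Hb4 : 0 < b ^ 4) by now apply pow_lt.
  apply Rmult_le_reg_r with (b ^ 4)%R; [exact Hb4|].
  rewrite (Rmult_assoc K), Rinv_l, Rmult_1_r by lra.
  eapply Rle_trans; [|exact HKb]. rewrite pow_add, <- Rmult_assoc.
  apply Rmult_le_compat_r; [lra|]. apply Rmult_le_compat_r; [apply pow_le; lra|].
  apply Rmult_le_compat; tauto.
Qed.

(** The half-line, seen through a primitive [W] of the integrand: the integral over
    [[0,1]] is proper because rapid decay beats the pole of [dz/z] at [s = 1]. *)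
Lemma is_CInt_ray (k p q j : nat) (E0 E1 : C -> C * C) (G : C -> nat -> nat -> C) (W : R -> C) :
  is_continuation e0_real E0 -> is_continuation e1_real E1 -> is_top_pairing k E0 E1 G ->
  (p + q = k)%nat -> (p < q)%nat ->
  (forall x, RD W x (phi E0 E1 p q j x)) ->
  exists V, is_CInt (integrand k G (ray, fun s => mono (E0 (ray_log s)) p (E1 (ray_log s)) q)
             (omega j)) 0 1 V /\
    forall eps : posreal, exists X, forall x, X < x -> Cmod (W x - (V + W 0%R)) < eps.
Proof.
  intros H0 H1 HG Hk Hpq HW.
  destruct (phi_growth E0 E1 p q j H0 H1 Hpq) as (K & HK & HKb).
  set (lg := fun s => ln ((1 + s) / (1 - s))).
  set (psi0 := fun s => phi E0 E1 p q j (RtoC (lg s)) * RtoC (2 / ((1 - s) * (1 + s)))).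
  set (psi := fun s => if Rlt_dec s 1 then psi0 s else 0).
  assert (Hlg : forall s, -1 < s < 1 -> is_derive lg s (2 / ((1 - s) * (1 + s)))%R).
  { intros s Hs. unfold lg. auto_derive.
    - split; [lra|]. split; [|exact I]. now apply ray_ratio_pos.
    - field. lra. }
  assert (Hex : forall s, -1 < s < 1 -> exp (lg s) = ((1 + s) / (1 - s))%R).
  { intros s Hs. apply exp_ln, ray_ratio_pos. exact Hs. }
  assert (Hb : forall s, 0 <= s <= 1 -> Cmod (psi s) <= 2 * K * (1 - s)).
  { intros s Hs. unfold psi. destruct (Rlt_dec s 1) as [Hl|Hl].
    - unfold psi0. rewrite Cmod_mult, Cmod_R.
      assert (Hd : 0 < (1 - s) * (1 + s)) by (apply Rmult_lt_0_compat; lra).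
      rewrite Rabs_pos_eq by (apply Rdiv_le_0_compat; lra).
      assert (Hx : 0 <= lg s) by (apply ray_ln_nonneg; lra).
      specialize (HKb _ Hx).
      replace (exp (- 2 * lg s)) with ((1 - s) * (1 - s) / ((1 + s) * (1 + s)))%R in HKb.
      2: { replace (- 2 * lg s)%R with (- (lg s + lg s))%R by ring.
           rewrite exp_Ropp, exp_plus, !Hex by lra. field. lra. }
      apply Rle_trans with (K * ((1 - s) * (1 - s) / ((1 + s) * (1 + s))) * (2 / ((1 - s) * (1 + s))))%R.
      + apply Rmult_le_compat_r; [apply Rdiv_le_0_compat; lra|exact HKb].
      + replace (K * ((1 - s) * (1 - s) / ((1 + s) * (1 + s))) * (2 / ((1 - s) * (1 + s))))%R
          with (2 * K * (1 - s) * / ((1 + s) * (1 + s) * (1 + s)))%R by (field; lra).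
        rewrite <- (Rmult_1_r (2 * K * (1 - s))) at 2.
        apply Rmult_le_compat_l; [apply Rmult_le_pos; lra|].
        rewrite <- Rinv_1. apply Rinv_le_contravar; [lra|].
        assert (1 <= (1 + s) * (1 + s)) by nra. nra.
    - rewrite Cmod_0. apply Rmult_le_pos; lra. }
  assert (Hc0 : forall s, -1 < s < 1 -> continuous (U := C_R_NormedModule) psi s).
  { intros s Hs. apply (continuous_ext_loc (U := C_R_NormedModule) _ psi0).
    - apply (locally_open (fun r => r < 1)); [apply open_lt| |lra].
      intros r Hr. unfold psi. destruct (Rlt_dec r 1); [reflexivity|contradiction].
    - destruct (entire2_phi E0 E1 p q j H0 H1) as (f1 & f2 & Hf).
      pose proof (CD_RD_comp _ (fun s => RtoC (lg s)) s _ _ (proj1 (Hf (RtoC (lg s)))) (RD_RtoC _ _ _ (Hlg s Hs))) as D1.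
      assert (D2 : exists m, is_derive (fun s => (2 / ((1 - s) * (1 + s)))%R) s m).
      { eexists. auto_derive; [|reflexivity]. apply Rgt_not_eq. apply Rmult_lt_0_compat; lra. }
      destruct D2 as [m D2]. apply RD_RtoC in D2.
      eapply RD_continuous. exact (RD_mult _ _ _ _ _ D1 D2). }
  assert (Hc1 : continuous (U := C_R_NormedModule) psi 1).
  { intros P [eps HP].
    assert (Hd : 0 < Rmin 1 (eps / (2 * K + 1))).
    { apply Rmin_case; [lra|]. apply Rdiv_lt_0_compat; [apply cond_pos|lra]. }
    exists (mkposreal _ Hd). intros y Hy. apply HP.
    apply C_NormedModule_mixin_compat1.
    unfold ball in Hy; simpl in Hy. unfold AbsRing_ball, abs, minus, plus, opp in Hy; simpl in Hy.
    pose proof (Rmin_l 1 (eps / (2 * K + 1))) as M1. pose proof (Rmin_r 1 (eps / (2 * K + 1))) as M2.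
    apply Rabs_def2 in Hy.
    assert (E1' : psi 1%R = 0) by (unfold psi; destruct (Rlt_dec 1 1); [lra|reflexivity]).
    rewrite E1'. replace (minus (psi y) (RtoC 0)) with (psi y) by (unfold minus, plus, opp; simpl; ring).
    destruct (Rle_lt_dec 1 y) as [Hl|Hl].
    - unfold psi. destruct (Rlt_dec y 1); [lra|]. rewrite Cmod_0. apply cond_pos.
    - eapply Rle_lt_trans; [apply Hb; lra|].
      apply Rle_lt_trans with ((2 * K + 1) * (1 - y))%R; [apply Rmult_le_compat_r; lra|].
      apply Rlt_le_trans with ((2 * K + 1) * (eps / (2 * K + 1)))%R.
      + apply Rmult_lt_compat_l; lra.
      + right. field. lra. }
  assert (Hcont : forall s, 0 <= s <= 1 -> continuous (U := C_R_NormedModule) psi s).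
  { intros s Hs. destruct (Req_dec s 1) as [->|Hn]; [exact Hc1|apply Hc0; lra]. }
  assert (Hexi : forall a b, 0 <= a <= 1 -> 0 <= b <= 1 -> ex_RInt (V := C_R_NormedModule) psi a b).
  { intros a b Ha Hb'. apply (ex_RInt_continuous (V := C_R_CompleteNormedModule)). intros s Hs.
    apply Hcont. split.
    - eapply Rle_trans; [|apply Hs]. apply Rmin_case; lra.
    - eapply Rle_trans; [apply Hs|]. apply Rmax_case; lra. }
  assert (HI : forall s, 0 <= s < 1 -> is_CInt psi 0 s (W (lg s) - W 0%R)).
  { intros s Hs.
    replace (W (lg s) - W 0%R) with (minus (G := C_R_NormedModule) (W (lg s)) (W (lg 0))).
    2: { unfold lg at 2. replace ((1 + 0) / (1 - 0))%R with 1%R by field. rewrite ln_1. reflexivity. }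
    apply (is_RInt_derive (V := C_R_CompleteNormedModule) (fun s => W (lg s))).
    - intros r Hr. rewrite Rmin_left, Rmax_right in Hr by lra.
      unfold psi. destruct (Rlt_dec r 1); [|lra]. unfold psi0.
      assert (Hr1 : -1 < r < 1) by (split; lra).
      evar_last; [exact (is_derive_comp (K := R_AbsRing) (V := C_R_NormedModule) W lg r _ _ (HW (lg r)) (Hlg r Hr1))|].
      rewrite scal_CR. apply Cmult_comm.
    - intros r Hr. rewrite Rmin_left, Rmax_right in Hr by lra. apply Hcont. lra. }
  exists (CInt psi 0 1). split.
  - apply (is_RInt_ext (V := C_R_NormedModule) psi).
    + intros s Hs. rewrite Rmin_left, Rmax_right in Hs by lra.
      unfold psi. destruct (Rlt_dec s 1); [|lra]. symmetry.
      apply (integrand_omega k p q j E0 E1 G ray ray_log s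
        (RtoC (2 / ((1 - s) * (1 + s)))) H0 H1 HG Hk); [unfold inner; cbn; lra|].
      apply log_lift_ray. lra.
    + apply (RInt_correct (V := C_R_CompleteNormedModule)), Hexi; lra.
  - intros eps. set (D := (2 * (2 * K) / eps + 1)%R).
    pose proof (cond_pos eps) as Pe.
    assert (HD : 0 < D).
    { unfold D. assert (0 <= 2 * (2 * K) / eps) by (apply Rdiv_le_0_compat; lra). lra. }
    exists (Rmax 0 (ln D)). intros x Hx.
    pose proof (Rmax_l 0 (ln D)) as M1. pose proof (Rmax_r 0 (ln D)) as M2.
    set (s := ((exp x - 1) / (exp x + 1))%R).
    assert (Hex1 : 1 < exp x) by (rewrite <- exp_0; apply exp_increasing; lra).
    assert (HexD : D < exp x) by (rewrite <- (exp_ln D HD); apply exp_increasing; lra).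
    assert (Hs1 : (1 - s = 2 / (exp x + 1))%R) by (unfold s; field; lra).
    assert (Hs : 0 <= s < 1).
    { split; [unfold s; apply Rdiv_le_0_compat; lra|].
      assert (0 < 2 / (exp x + 1)) by (apply Rdiv_lt_0_compat; lra). lra. }
    assert (Hlx : lg s = x).
    { unfold lg. replace ((1 + s) / (1 - s))%R with (exp x); [apply ln_exp|].
      rewrite Hs1. unfold s. field. lra. }
    pose proof (HI s Hs) as A. rewrite Hlx in A.
    assert (B : is_CInt psi s 1 (CInt psi s 1)).
    { apply (RInt_correct (V := C_R_CompleteNormedModule)), Hexi; lra. }
    pose proof (CInt_unique _ _ _ _ (is_RInt_Chasles (V := C_R_NormedModule) _ _ _ _ _ _ A B)) as E.
    rewrite E. change (plus (W x - W 0%R) (CInt psi s 1)) with (W x - W 0%R + CInt psi s 1).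
    replace (W x - (W x - W 0%R + CInt psi s 1 + W 0%R)) with (- CInt psi s 1) by ring.
    rewrite Cmod_opp, <- norm_CR.
    apply Rle_lt_trans with (scal (1 - s)%R (2 * K)%R).
    + apply (norm_RInt_le (V := C_R_NormedModule) psi (fun _ => (2 * K)%R) s 1).
      * lra.
      * intros r Hr. rewrite norm_CR. eapply Rle_trans; [apply Hb; lra|]. nra.
      * exact B.
      * apply (is_RInt_const (V := R_NormedModule)).
    + change (scal (1 - s)%R (2 * K)%R) with ((1 - s) * (2 * K))%R. rewrite Hs1.
      apply Rmult_lt_reg_r with (exp x + 1)%R; [lra|].
      replace (2 / (exp x + 1) * (2 * K) * (exp x + 1))%R with (2 * (2 * K) / eps * eps)%R by (field; lra).
      unfold D in HexD. rewrite (Rmult_comm eps). apply Rmult_lt_compat_r; lra.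
Qed.

(** The constants of [IKM] come from [X = - 2 K_0], [B = 2 pi i I_0], [z = (t/2)^2] and
    [du = 2 dt / t]. *)
Lemma phi_IKM (k i j : nat) (E0 E1 : C -> C * C) (x : R) :
  is_continuation e0_real E0 -> is_continuation e1_real E1 -> (i <= k)%nat -> (1 <= j)%nat ->
  let t := (2 * exp (x / 2))%R in
  phi E0 E1 i (k - i) j x =
  RtoC ((-1) ^ (k - i) * powerRZ 2 (Z.of_nat k - Z.of_nat (2 * j - 1))) * piI ^ i
  * RtoC (I0 t ^ i * K0 t ^ (k - i) * t ^ (2 * j - 1) * exp (x / 2)).
Proof.
  intros [_ R0] [_ R1] Hik Hj t. pose proof piI_neq_0 as Hpi.
  assert (EB : solB E0 x = 2 * piI * RtoC (I0 t)).
  { unfold solB. rewrite R0, sqrt_exp. fold t. unfold e0_real. cbn [snd]. rewrite RtoC_opp. ring. }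
  assert (EX : solX E1 x = RtoC (-2) * RtoC (K0 t)).
  { unfold solX. rewrite R1, sqrt_exp. fold t. unfold e1_real. cbn [snd].
    replace (RtoC (-2)) with (- RtoC 2) by (rewrite <- RtoC_opp; reflexivity). field. exact Hpi. }
  assert (EZ : (RtoC (exp x) = RtoC (t / 2) ^ 2)).
  { rewrite <- RtoC_pow. f_equal. unfold t. simpl. rewrite Rmult_1_r.
    replace (2 * exp (x / 2) / 2)%R with (exp (x / 2)) by field. rewrite <- exp_plus. f_equal. field. }
  unfold phi. rewrite EB, EX, Cexp_R, EZ, !Cpow_mult_l, <- Cpow_mult_r, <- !RtoC_pow.
  rewrite !RtoC_mult.
  replace (exp (x / 2)) with (t / 2)%R by (unfold t; field).
  assert (Hpow : (2 ^ i * (-2) ^ (k - i) * (t / 2) ^ (2 * j)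
     = (-1) ^ (k - i) * powerRZ 2 (Z.of_nat k - Z.of_nat (2 * j - 1)) * (t ^ (2 * j - 1) * (t / 2)))%R).
  { unfold Zminus. rewrite powerRZ_add by lra. rewrite powerRZ_neg', <- !pow_powerRZ by lra.
    replace ((-2) ^ (k - i))%R with ((-1) ^ (k - i) * 2 ^ (k - i))%R.
    2: { rewrite <- Rpow_mult_distr. f_equal. ring. }
    replace (2 ^ k)%R with (2 ^ i * 2 ^ (k - i))%R by (rewrite <- pow_add; f_equal; lia).
    replace (2 * j)%nat with (S (2 * j - 1)) at 1 by lia.
    unfold Rdiv. rewrite Rpow_mult_distr, pow_inv. simpl pow. field.
    apply pow_nonzero; lra. }
  transitivity (piI ^ i * RtoC (I0 t ^ i) * RtoC (K0 t ^ (k - i)) *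
     RtoC (2 ^ i * (-2) ^ (k - i) * (t / 2) ^ (2 * j))).
  - rewrite !RtoC_mult. ring.
  - rewrite Hpow, !RtoC_mult. ring.
Qed.

(** With [W] the circle part as a function of the radius, the circles give [W 0], the
    half-line [W (+oo) - W 0], and [IKM] is [W (+oo) - W (-oo)]. *)
Lemma period_alpha (k i j : nat) (E0 E1 : C -> C * C) (G : C -> nat -> nat -> C) :
  is_continuation e0_real E0 -> is_continuation e1_real E1 -> is_top_pairing k E0 E1 G ->
  (1 <= i)%nat -> (2 * i < k)%nat -> (1 <= j)%nat ->
  (forall ce, In ce (alpha E0 E1 k i) ->
     ex_RInt (V := C_R_NormedModule) (integrand k G ce (omega j)) 0 1) /\
  period k G (alpha E0 E1 k i) (omega j) = IKM k i (2 * j - 1).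
Proof.
  intros H0 H1 HG Hi Hik Hj.
  set (W := primW E0 E1 (i - 1) (k - i + 1) j).
  assert (HW : forall x, RD W x (phi E0 E1 i (k - i) j x)).
  { intros x. pose proof (RD_primW E0 E1 (i - 1) (k - i + 1) j x H0 H1 ltac:(lia)) as A.
    replace (S (i - 1)) with i in A by lia. replace (k - i + 1 - 1)%nat with (k - i)%nat in A by lia. exact A. }
  destruct (is_CInt_ray k i (k - i) j E0 E1 G W H0 H1 HG ltac:(lia) ltac:(lia) HW) as (V & HV & Hlim).
  assert (HIK : IKM k i (2 * j - 1) = V + W 0%R).
  { destruct (primW_decay E0 E1 (i - 1) (k - i + 1) j H0 H1 Hj) as (K & HK & HKb).
    unfold IKM.
    apply (improper_integral_of_primitive (fun t => (I0 t ^ i * K0 t ^ (k - i) * t ^ (2 * j - 1))%R) _ _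
      W (fun x => phi E0 E1 i (k - i) j x) K); try assumption.
    - apply Cmult_neq_0; [|apply Cpow_nz, piI_neq_0].
      intros H. apply RtoC_inj in H. apply Rmult_integral in H. destruct H as [H|H].
      + revert H. apply pow_nonzero. lra.
      + revert H. apply powerRZ_NOR. lra.
    - intros x. now apply RD_phi_real.
    - intros x. exact (phi_IKM k i j E0 E1 x H0 H1 ltac:(lia) Hj). }
  assert (Hc : forall p q a, (p + q = k)%nat -> is_CInt (integrand k G (circle a,
      fun s => mono (E0 (circle_log a s)) p (E1 (circle_log a s)) q) (omega j)) 0 1
      (Jint (phi E0 E1 p q j) (turns a) 0)).
  { intros p q a Hpq. now apply is_CInt_circle. }
  assert (Hs : forall l ce U, is_CInt (integrand k G ce (omega j)) 0 1 U ->
     is_CInt (integrand k G (scale_twisted l ce) (omega j)) 0 1 (l * U)).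
  { intros l ce U HU. eapply (is_RInt_ext (V := C_R_NormedModule)); [|exact (is_CInt_scal l _ _ _ _ HU)].
    intros s _. symmetry. apply integrand_scale. }
  split.
  - intros ce Hce. unfold alpha, alpha0 in Hce. apply in_app_or in Hce. destruct Hce as [Hce|Hce].
    + simpl in Hce. destruct Hce as [<-|[]]. eexists. apply Hs, Hc. lia.
    + apply in_app_or in Hce. destruct Hce as [Hce|Hce].
      * destruct Hce as [<-|[]]. eexists. exact HV.
      * apply in_map_iff in Hce. destruct Hce as (a & <- & _). eexists. apply Hs, Hc. lia.
  - rewrite period_integrand, HIK. unfold alpha, alpha0.
    rewrite !Csum_app, !Csum_map, !Csum_singleton.
    rewrite (CInt_unique _ _ _ _ HV), (CInt_unique _ _ _ _ (Hs _ _ _ (Hc k 0%nat 1%nat ltac:(lia)))).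
    rewrite (Jint_phi_circle E0 E1 k j 0 H0 H1 Hj).
    rewrite (Csum_ext _ (fun a => RtoC (Cn (k - i + 1) a) * Jint (phi E0 E1 (i - 1) (k - i + 1) j) (turns a) 0)).
    2: { intros a _. apply CInt_unique, Hs, Hc. lia. }
    unfold W, primW. ring.
Qed.

Local Close Scope C_scope.

Theorem corollary5p7
  (k : nat) (hk : (1 <= k)%nat)
  (E0 E1 : C -> C * C)
  (hE0 : is_continuation e0_real E0) (hE1 : is_continuation e1_real E1)
  (G : C -> nat -> nat -> C) (hG : is_top_pairing k E0 E1 G)
  (g : nat -> R) (hg : is_gamma k g)
  (P : (chain1 -> Prop) -> (sym_section -> Prop) -> C)
  (hP : is_period_pairing k G P)
  (i j : nat) (hi : mid_index k i) (hj : mid_index k j) :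
  P_mid E0 E1 g P k i j =
    if (k mod 4 =? 0)%nat then
      if (i <? k / 4)%nat then
        Cminus (IKM k (i + 1) (2 * j - 1))
               (Cmult (RtoC (g j)) (IKM k (i + 1) (kprime k)))
      else
        Cminus (IKM k i (2 * j - 1))
               (Cmult (RtoC (g j)) (IKM k i (kprime k)))
    else IKM k i (2 * j - 1).
Proof.
  destruct hi as [[hi1 hi2] hi4]. destruct hj as [[hj1 hj2] hj4]. unfold kprime in *.
  assert (Hik : (2 * i < k)%nat).
  { pose proof (Nat.Div0.mul_div_le (k - 1) 2). lia. }
  unfold P_mid.
  destruct (Nat.eqb_spec (k mod 4) 0) as [Hk4|Hk4].
  - pose proof (Nat.div_mod k 4 ltac:(lia)) as Hdiv. rewrite Hk4, Nat.add_0_r in Hdiv.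
    assert (Hq1 : (1 <= k / 4)%nat) by lia.
    (* The exponent of [t] belonging to [omega (k / 4)] is [kprime k]. *)
    assert (Hkp : ((k - 1) / 2 = 2 * (k / 4) - 1)%nat).
    { rewrite Hdiv at 1. symmetry. apply (Nat.div_unique _ _ _ 1); lia. }
    rewrite Hkp.
    assert (Main : forall i', (1 <= i')%nat -> (2 * i' < k)%nat ->
      P (rd_class k (alpha E0 E1 k i')) (dR_class k (omega' k g j))
      = Cminus (IKM k i' (2 * j - 1)) (Cmult (RtoC (g j)) (IKM k i' (2 * (k / 4) - 1)))).
    { intros i' Hi1 Hi2.
      rewrite hP by now apply alpha_is_cycle.
      rewrite period_omega'; [|exact Hk4|].
      - destruct (period_alpha k i' j E0 E1 G hE0 hE1 hG Hi1 Hi2 hj1) as [_ ->].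
        now destruct (period_alpha k i' (k / 4) E0 E1 G hE0 hE1 hG Hi1 Hi2 Hq1) as [_ ->].
      - intros ce m Hce Hm. assert (Hm1 : (1 <= m)%nat) by (destruct Hm; lia).
        now apply (period_alpha k i' m E0 E1 G hE0 hE1 hG Hi1 Hi2 Hm1). }
    unfold alpha'. rewrite Hk4. cbn [Nat.eqb andb].
    destruct (Nat.ltb_spec i (k / 4)) as [Hl|Hl]; apply Main; lia.
  - unfold alpha'. apply Nat.eqb_neq in Hk4. rewrite Hk4. cbn [andb].
    unfold omega'. rewrite Hk4.
    rewrite hP by now apply alpha_is_cycle.
    now apply period_alpha.
Qed.
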